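(* Let $\beta=\sigma_{i_1}\cdots\sigma_{i_r}\in\mathrm{Br}_k^+$ be a positive braid containing a reduced expression for $w_0$ as a (not necessarily consecutive) subword, let $1\le r_1\le r$, $\beta^1=\sigma_{i_1}\cdots\sigma_{i_{r_1}}$, $\beta^2=\sigma_{i_{r_1+1}}\cdots\sigma_{i_r}$, and let $w\in S_k$ be such that $X\big(\underline{(w^{-1}w_0)}\beta^1\big)$ and $X\big(\beta^2\underline{w}\big)$ are nonempty. Let $f,f_1,f_2$ respectively denote the numbers of frozen variables for $X(\beta)$, $X\big(\underline{(w^{-1}w_0)}\beta^1\big)$ and $X\big(\beta^2\underline{w}\big)$. Then $$f_1+f_2\ge f.$$
   Context: $S_k$ is the symmetric group with simple transpositions $s_i$ and longest element $w_0$; $\mathrm{Br}_k^+$ is the positive braid monoid with generators $\sigma_1,\dots,\sigma_{k-1}$; $\underline{u}\in\mathrm{Br}_k^+$ is the minimal-length positive lift of $u\in S_k$. For $w\in S_k$ the coordinate flag $\mathcal{F}(w)$ in $\mathbb{C}^k$ has $j$-th subspace spanned by $e_{w(1)},\dots,e_{w(j)}$; $\mathcal{F}^{\mathrm{std}}=\mathcal{F}(e)$, $\mathcal{F}^{\mathrm{ant}}=\mathcal{F}(w_0)$. Write $\mathcal{F}\xrightarrow{w}\mathcal{F}'$ if some $g\in\mathrm{GL}(k)$ satisfies $g\mathcal{F}=\mathcal{F}^{\mathrm{std}}$, $g\mathcal{F}'=\mathcal{F}(w)$. The braid variety $X(\beta)$ of $\beta=\sigma_{i_1}\cdots\sigma_{i_r}$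 is the variety of tuples of complete flags $(\mathcal{F}^0,\dots,\mathcal{F}^r)$ with $\mathcal{F}^0=\mathcal{F}^{\mathrm{std}}$, $\mathcal{F}^r=\mathcal{F}^{\mathrm{ant}}$ and $\mathcal{F}^{j-1}\xrightarrow{s_{i_j}}\mathcal{F}^j$ for all $j$. If nonempty it is a smooth irreducible affine variety. It is known (Casals–Gorsky–Gorsky–Le–Shen–Simental; Galashin–Lam–Sherman-Bennett–Speyer) that, when $X(\beta)$ is nonempty, $\mathbb{C}[X(\beta)]$ admits a cluster structure, i.e. it is isomorphic to a cluster algebra $A(\Sigma)$ (of geometric type, skew-symmetric, with the frozen variables inverted). ''The number of frozen variables for $X(\beta)$'' is the number of frozen variables in this cluster structure. By a theorem of Geiss–Leclerc–Schröer, the group of units of a cluster algebra consists of the nonzero scalar multiples of Laurent monomials in the frozen variables; hence this number equals the rank of the free abelian group $\mathbb{C}[X(\beta)]^\times/\mathbb{C}^\times$ and is independent of the choice of seed. *)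

(* Defs.v *)
From mathcomp Require Import all_boot all_order all_fingroup all_algebra.
From mathcomp Require Import mpoly.

Set Implicit Arguments.
Unset Strict Implicit.
Unset Printing Implicit Defensive.

Import GRing.Theory Num.Theory.
Local Open Scope ring_scope.

(* Throughout, k = n.+1.  Everything is indexed from 0: the letter i : 'I_n
   stands for sigma_(i+1), and w : 'S_n.+1 permutes {0, ..., n}. *)

Section Braids.
Variable n : nat.

(* Composition of functions, i.e. x |-> u (v x); mathcomp's product is the
   opposite one. *)
Definition comp_perm (u v : 'S_n.+1) : 'S_n.+1 := (v * u)%g.

Definition simple_transp (i : 'I_n) : 'S_n.+1 :=
  tperm (widen_ord (leqnSn n) i) (lift ord0 i).

Definition longest : 'S_n.+1 := perm (@rev_ord_inj n.+1).

Definition word_perm (b : seq 'I_n) : 'S_n.+1 :=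
  foldr (fun i u => comp_perm (simple_transp i) u) 1%g b.

(* The reduced words of u are exactly the words of the positive lift of u, any
   two of them being related by braid moves. *)
Definition reduced_word (b : seq 'I_n) (u : 'S_n.+1) : Prop :=
  word_perm b = u /\ forall c, word_perm c = u -> (size b <= size c)%N.

Definition contains_longest (b : seq 'I_n) : Prop :=
  exists2 c, subseq c b & reduced_word c longest.

End Braids.

Section BraidVariety.
Variables (K : fieldType) (n : nat).

Local Notation V := 'cV[K]_n.+1.

(* A sequence F_0, ..., F_k of subspaces of K^k. *)
Definition flag := {ffun 'I_n.+2 -> {vspace V}}.

Definition complete_flag (F : flag) : Prop :=
  (forall j, \dim (F j) = j) /\
  (forall i j : 'I_n.+2, (i <= j)%N -> (F i <= F j)%VS).

Definition coord_flag (w : 'S_n.+1) : flag :=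
  [ffun j : 'I_n.+2 =>
     <<[seq delta_mx (w i) ord0 : V | i : 'I_n.+1 <- enum 'I_n.+1 & (i < j)%N]>>%VS].

Definition std_flag : flag := coord_flag 1%g.
Definition ant_flag : flag := coord_flag (longest n).

Definition act_flag (g : 'End(V)) (F : flag) : flag :=
  [ffun j => (g @: F j)%VS].

Definition relpos (w : 'S_n.+1) (F F' : flag) : Prop :=
  exists g : 'End(V),
    [/\ lker g = 0%VS, act_flag g F = std_flag & act_flag g F' = coord_flag w].

Definition flag_seq (r : nat) := {ffun 'I_r.+1 -> flag}.

Definition braid_variety (b : seq 'I_n) (x : flag_seq (size b)) : Prop :=
  [/\ forall j, complete_flag (x j), x ord0 = std_flag, x ord_max = ant_flag &
      forall j : 'I_(size b),
        relpos (simple_transp (tnth (in_tuple b) j))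
               (x (widen_ord (leqnSn _) j)) (x (lift ord0 j))].

Definition nonempty_braid_variety (b : seq 'I_n) : Prop :=
  exists x, @braid_variety b x.

Section Regular.
Variable r : nat.

(* The flag variety is GL_k / B: the j-th step of the flag of a matrix is
   spanned by its first j columns. *)
Definition flag_of_mx (M : 'M[K]_n.+1) : flag :=
  [ffun j : 'I_n.+2 => <<[seq col i M | i : 'I_n.+1 <- enum 'I_n.+1 & (i < j)%N]>>%VS].

Definition frames := {ffun 'I_r.+1 -> 'M[K]_n.+1}.

Definition flags_of (M : frames) : flag_seq r := [ffun j => flag_of_mx (M j)].

Definition invertible_frames (M : frames) : Prop :=
  forall j, M j \in unitmx.

Definition entry_index := ('I_r.+1 * ('I_n.+1 * 'I_n.+1))%type.

Definition entries (M : frames) (t : 'I_#|{: entry_index}|) : K :=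
  let: (j, (a, c)) := enum_val t in M j a c.

(* phi is a regular function on the locally closed subset Z of
   (GL_k / B)^(r+1), with its reduced structure: as GL_k -> GL_k / B has local
   sections, this means that the pull-back of phi to matrices is, locally for
   the Zariski topology, a quotient of two polynomials in the entries.  The
   values of phi outside Z are irrelevant. *)
Definition regular_on (Z : flag_seq r -> Prop) (phi : flag_seq r -> K) : Prop :=
  forall M, invertible_frames M -> Z (flags_of M) ->
    exists p q : {mpoly K[#|{: entry_index}|]},
      q.@[entries M] != 0 /\
      forall M', invertible_frames M' -> Z (flags_of M') ->
        q.@[entries M'] != 0 ->
        phi (flags_of M') = p.@[entries M'] / q.@[entries M'].

End Regular.
End BraidVariety.

(* Skew-symmetric cluster algebras of geometric type over K with m mutable and
   f frozen variables, frozen variables inverted. *)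
Section ClusterAlgebra.
Variables (K : fieldType) (m f : nat).

Definition ambient := {fraction {mpoly K[m + f]}}.

Definition ambient_cst (c : K) : ambient := tofrac c%:MP.

(* Mutable indices are [lshift f j], frozen ones [rshift m j]. *)
Definition exchange_mx := 'M[int]_(m + f, m).

Record seed := Seed { cvar : {ffun 'I_(m + f) -> ambient}; emx : exchange_mx }.

Definition pospart (a : int) : int := Num.max a 0.

Definition mutate_mx (k : 'I_m) (B : exchange_mx) : exchange_mx :=
  \matrix_(i, j)
    if (i == lshift f k) || (j == k) then - B i j
    else B i j + (pospart (B i k) * pospart (B (lshift f k) j)
                  - pospart (- B i k) * pospart (- B (lshift f k) j)).

Definition mutate_var (k : 'I_m) (S : seed) : {ffun 'I_(m + f) -> ambient} :=
  [ffun i =>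
     if i == lshift f k then
       (\prod_l cvar S l ^ pospart (emx S l k)
        + \prod_l cvar S l ^ pospart (- emx S l k)) / cvar S i
     else cvar S i].

Definition mutate (S : seed) (k : 'I_m) : seed :=
  Seed (mutate_var k S) (mutate_mx k (emx S)).

Definition initial_seed (B : exchange_mx) : seed :=
  Seed [ffun i => tofrac 'X_i] B.

Inductive cluster_algebra (B : exchange_mx) : ambient -> Prop :=
| CA_cst c : cluster_algebra B (ambient_cst c)
| CA_var (ks : seq 'I_m) i :
    cluster_algebra B (cvar (foldl mutate (initial_seed B) ks) i)
| CA_frozen_inv (j : 'I_f) :
    cluster_algebra B (cvar (initial_seed B) (rshift m j))^-1
| CA_add y z :
    cluster_algebra B y -> cluster_algebra B z -> cluster_algebra B (y + z)
| CA_mul y z :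
    cluster_algebra B y -> cluster_algebra B z -> cluster_algebra B (y * z).

(* No mutable index may be isolated (a zero column of B).  For such an index
   the exchange relation reads x x' = 2, so that x is a unit although it is
   not frozen; the number of frozen variables would then not be determined by
   the algebra. *)
Definition valid_exchange_mx (B : exchange_mx) : Prop :=
  (usubmx B)^T = - usubmx B /\ forall k, col k B != 0.

End ClusterAlgebra.

Section ClusterStructure.
Variables (K : fieldType) (n : nat).

(* Psi restricts to an isomorphism of K-algebras from the cluster algebra of B
   onto the coordinate ring of the braid variety of b. *)
Definition cluster_iso (b : seq 'I_n) (m f : nat) (B : exchange_mx m f)
    (Psi : ambient K m f -> flag_seq K n (size b) -> K) : Prop :=
  let A := @cluster_algebra K m f B in
  let X := @braid_variety K n b in
  (forall y, A y -> regular_on X (Psi y)) /\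
  (forall c x, X x -> Psi (ambient_cst m f c) x = c) /\
  (forall y z x, A y -> A z -> X x -> Psi (y + z) x = Psi y x + Psi z x) /\
  (forall y z x, A y -> A z -> X x -> Psi (y * z) x = Psi y x * Psi z x) /\
  (forall y z, A y -> A z -> (forall x, X x -> Psi y x = Psi z x) -> y = z) /\
  (forall phi, regular_on X phi ->
     exists2 y, A y & forall x, X x -> Psi y x = phi x).

(* f is the number of frozen variables of a cluster structure on the
   coordinate ring of the braid variety of b. *)
Definition num_frozen (b : seq 'I_n) (f : nat) : Prop :=
  exists (m : nat) (B : exchange_mx m f),
    valid_exchange_mx B /\
    exists Psi : ambient K m f -> flag_seq K n (size b) -> K,
      cluster_iso B Psi.

End ClusterStructure.

(* Main.v *)
Require Import Defs.
From mathcomp Require Import all_boot all_order all_fingroup all_algebra.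
From mathcomp Require Import complex reals mpoly.
From mathcomp Require Import ring zify.
From HB Require Import structures.
From Stdlib Require Import Classical ClassicalEpsilon.

Set Implicit Arguments.
Unset Strict Implicit.
Unset Printing Implicit Defensive.
Import GRing.Theory Num.Theory.
Local Open Scope ring_scope.

(** Splicing. Let v be w^-1 w0, let p1 be a point of the braid variety X1 of
    a1 ++ b1 and p2 a point of the braid variety X2 of b2 ++ a2. The word a1 is
    reduced, so the flag of p1 that follows the letters of a1 lies in the Bruhat
    cell of v; in the same way a2 confines the flag of p2 that precedes its
    letters to a cell. Exactly one unipotent matrix c of the group attached to v
    moves the first flag, read through the permutation matrix of v^-1, to the
    standard flag and the second one, read through that of v^-1 w0, to the
    antistandard flag (is_glue_exists, is_glue_unique). The end of the moved p1
    is then the beginning of the moved p2, and together they form a point of the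
    braid variety X of b1 ++ b2 (splice_bv). The matrix c solves a linear system
    whose solution is unique, hence depends regularly on p1 and on p2
    (glued_regular, regular_left, regular_right). By LU decomposition the image
    of the splicing contains the points at which a regular function discr, not
    identically zero, does not vanish (discr_regular, discr_onto,
    discr_spliced).

    Counting. Let z_j, x_i, y_i be the frozen variables of X, X1, X2. The
    pull-back Z_j(p1, p2) of z_j is regular without zeros in each argument. For
    fixed p1 and o1 the ratio Z_j(p1, p2) / Z_j(o1, p2) is a unit on X2 whose
    values belong to the finitely generated group of the x_i(p1) / x_i(o1); a
    nonconstant unit takes every nonzero value, and the multiplicative group of a
    field of characteristic 0 is not finitely generated, so the ratio is
    constant (unit_ratio_cst). Hence Z_j is a constant times a Laurent monomial
    in the x_i and the y_i (unit_split). If there were more z_j than x_i and y_i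
    together, some nonzero integer vector would be orthogonal to all exponents,
    and the corresponding Laurent monomial in the z_j would be constant on the
    image of the splicing, hence on X, because the coordinate ring is a domain.
    But the frozen variables are algebraically independent.

    Units. Two facts about units come from the cluster structure: a unit is a
    scalar times a Laurent monomial in the frozen variables (upper_unit), and a
    nonconstant unit takes every nonzero value l, since otherwise its difference
    with l would be one more unit, which is impossible for a difference of two
    monomials (frozen_three). The first one rests on the Laurent phenomenon in
    the form of Berenstein, Fomin and Zelevinsky: when the columns of the
    exchange matrix are linearly independent, the elements that are Laurent
    polynomials in a cluster and in all adjacent ones remain so when the cluster
    is replaced by an adjacent one (exchange_step, upper_invariant); other
    matrices are reached by adding principal coefficients and setting them
    to 1 (laurent). A unit is then a monomial in the initial cluster and also in
    each adjacent one. If it involved the mutable variable x_k, the exchange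
    polynomial of x_k would be a unit among Laurent polynomials; but that
    polynomial has two terms, because column k of the exchange matrix is not
    zero. *)

(** * Subrings and Laurent polynomials in one variable *)

Section Subrings.
Variable F : fieldType.
Implicit Types (S R E T : F -> Prop) (p q : {poly F}) (x y f : F).

Definition subring S :=
  [/\ S 1, forall x y, S x -> S y -> S (x - y) & forall x y, S x -> S y -> S (x * y)].

Section Closure.
Variable S : F -> Prop.
Hypothesis hS : subring S.

Lemma sr1 : S 1. Proof. by case: hS. Qed.
Lemma srB x y : S x -> S y -> S (x - y). Proof. by case: hS => _ h _; apply: h. Qed.
Lemma srM x y : S x -> S y -> S (x * y). Proof. by case: hS => _ _ h; apply: h. Qed.
Lemma sr0 : S 0. Proof. by rewrite -(subrr 1); apply: srB; apply: sr1. Qed.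
Lemma srN x : S x -> S (- x). Proof. by move=> h; rewrite -sub0r; apply: srB => //; apply: sr0. Qed.
Lemma srD x y : S x -> S y -> S (x + y).
Proof. by move=> h1 h2; rewrite -[y]opprK; apply: srB => //; apply: srN. Qed.
Lemma srX x n : S x -> S (x ^+ n).
Proof. by move=> h; elim: n => [|n IH]; [apply: sr1 | rewrite exprS; apply: srM]. Qed.
Lemma sr_sum (I : Type) (r : seq I) (P : pred I) (g : I -> F) :
  (forall i, P i -> S (g i)) -> S (\sum_(i <- r | P i) g i).
Proof. by move=> h; elim/big_ind: _ => //; [apply: sr0 | apply: srD]. Qed.
Lemma sr_prod (I : Type) (r : seq I) (P : pred I) (g : I -> F) :
  (forall i, P i -> S (g i)) -> S (\prod_(i <- r | P i) g i).
Proof. by move=> h; elim/big_ind: _ => //; [apply: sr1 | apply: srM]. Qed.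
Lemma srXz x (n : int) : S x -> S x^-1 -> S (x ^ n).
Proof. by case: n => n h1 h2; rewrite ?NegzE -?exprnN -?exprVn; apply: srX. Qed.

End Closure.

Inductive rgen (G : F -> Prop) : F -> Prop :=
| rgen_in x of G x : rgen G x
| rgen_1 : rgen G 1
| rgen_B x y of rgen G x & rgen G y : rgen G (x - y)
| rgen_M x y of rgen G x & rgen G y : rgen G (x * y).

Lemma rgen_subring G : subring (rgen G).
Proof. by split; [apply: rgen_1 | apply: rgen_B | apply: rgen_M]. Qed.

Lemma rgen_min G S : subring S -> (forall x, G x -> S x) -> forall x, rgen G x -> S x.
Proof.
move=> hS h x; elim=> {x} [x /h //||x y _ h1 _ h2|x y _ h1 _ h2].
- exact: sr1.
- exact: srB.
- exact: srM.
Qed.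

Definition coefs_in S p := forall i, S p`_i.

Section Over.
Variable S : F -> Prop.
Hypothesis hS : subring S.

Lemma coefs_in0 : coefs_in S 0. Proof. by move=> i; rewrite coef0; apply: sr0. Qed.
Lemma coefs_inC x : S x -> coefs_in S x%:P.
Proof. by move=> h i; rewrite coefC; case: ifP => // _; apply: sr0. Qed.
Lemma coefs_inX : coefs_in S 'X.
Proof. by move=> i; rewrite coefX; case: (i == 1)%N; [apply: sr1 | apply: sr0]. Qed.
Lemma coefs_inD p q : coefs_in S p -> coefs_in S q -> coefs_in S (p + q).
Proof. by move=> h1 h2 i; rewrite coefD; apply: srD. Qed.
Lemma coefs_inB p q : coefs_in S p -> coefs_in S q -> coefs_in S (p - q).
Proof. by move=> h1 h2 i; rewrite coefB; apply: srB. Qed.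
Lemma coefs_inM p q : coefs_in S p -> coefs_in S q -> coefs_in S (p * q).
Proof. by move=> h1 h2 i; rewrite coefM; apply: sr_sum => // j _; apply: srM. Qed.
Lemma coefs_inXn n : coefs_in S 'X^n.
Proof. by move=> i; rewrite coefXn; case: (i == n)%N; [apply: sr1 | apply: sr0]. Qed.
Lemma coefs_inE p n : coefs_in S p -> coefs_in S (p ^+ n).
Proof.
move=> h; elim: n => [|n IH]; first by rewrite expr0; apply: coefs_inC; apply: sr1.
by rewrite exprS; apply: coefs_inM.
Qed.
Lemma coefs_inZ x p : S x -> coefs_in S p -> coefs_in S (x *: p).
Proof. by move=> h1 h2 i; rewrite coefZ; apply: srM. Qed.
Lemma coefs_in_poly n (g : nat -> F) : (forall i, (i < n)%N -> S (g i)) -> coefs_in S (\poly_(i < n) g i).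
Proof. by move=> h i; rewrite coef_poly; case: ltnP => [/h //|_]; apply: sr0. Qed.
Lemma coefs_in_horner p x : coefs_in S p -> S x -> S p.[x].
Proof.
by move=> h1 h2; rewrite horner_coef; apply: sr_sum => // i _; apply: srM => //; apply: srX.
Qed.

End Over.

Lemma coefs_in_mono S T p : (forall x, S x -> T x) -> coefs_in S p -> coefs_in T p.
Proof. by move=> h hp i; apply: h. Qed.

(** For x transcendental over S this is S[x, x^-1]. Clearing the pole turns
    questions about it into questions about polynomials. *)
Definition laur S x f := exists n p, coefs_in S p /\ f * x ^+ n = p.[x].
Definition transc S x := forall p, coefs_in S p -> p.[x] = 0 -> p = 0.

Lemma transc_mono S T x : (forall y, S y -> T y) -> transc T x -> transc S x.
Proof. by move=> h hT p hp; apply: hT; apply: coefs_in_mono hp. Qed.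

Lemma transc_inj S x p q : subring S -> transc S x -> coefs_in S p -> coefs_in S q ->
  p.[x] = q.[x] -> p = q.
Proof.
move=> hS hx hp hq e; apply/eqP; rewrite -subr_eq0; apply/eqP; apply: hx.
  exact: coefs_inB.
by rewrite hornerD hornerN e subrr.
Qed.

Lemma transc_neq0 S x : subring S -> transc S x -> x != 0.
Proof.
move=> hS hx; apply/eqP => x0.
have := hx 'X (coefs_inX hS); rewrite hornerX => /(_ x0) /eqP.
by rewrite polyX_eq0.
Qed.

Lemma laur_mono S T x f : (forall y, S y -> T y) -> laur S x f -> laur T x f.
Proof. by move=> h [n [p [hp e]]]; exists n, p; split=> //; apply: coefs_in_mono hp. Qed.

Lemma laur_over S x p f : coefs_in S p -> f = p.[x] -> laur S x f.
Proof. by move=> h ->; exists 0%N, p; rewrite expr0 mulr1. Qed.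

Section Laur.
Variables (S : F -> Prop) (x : F).
Hypotheses (hS : subring S) (x0 : x != 0).

Lemma laur_S f : S f -> laur S x f.
Proof. by move=> h; apply: (@laur_over _ _ f%:P); [apply: coefs_inC | rewrite hornerC]. Qed.
Lemma laur_x : laur S x x.
Proof. by apply: (@laur_over _ _ 'X); [apply: coefs_inX | rewrite hornerX]. Qed.
Lemma laur_xV : laur S x x^-1.
Proof.
exists 1%N, 1; rewrite hornerC expr1 mulVf //; split=> //; apply: (coefs_inC hS); exact: sr1.
Qed.
Lemma laur_subring : subring (laur S x).
Proof.
split; first by apply: laur_S; apply: sr1.
- move=> f g [n [p [hp ep]]] [m [q [hq fq]]].
  exists (n + m)%N, (p * 'X^m - q * 'X^n); split.
    by apply: coefs_inB => //; apply: coefs_inM => //; apply: coefs_inXn.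
  rewrite hornerD hornerN !hornerM !hornerXn -ep -fq exprD; ring.
- move=> f g [n [p [hp ep]]] [m [q [hq fq]]].
  exists (n + m)%N, (p * q); split; first exact: coefs_inM.
  rewrite hornerM -ep -fq exprD; ring.
Qed.

Lemma laur_min T : subring T -> (forall y, S y -> T y) -> T x -> T x^-1 ->
  forall f, laur S x f -> T f.
Proof.
move=> hT hST hx hxV f [n [p [hp e]]].
have -> : f = p.[x] * x^-1 ^+ n by rewrite -e exprVn mulfK // expf_neq0.
apply: srM => //; last exact: srX.
by apply: coefs_in_horner => //; apply: coefs_in_mono hp.
Qed.

End Laur.

(** Clears the pole at x of a polynomial in P / x, which is how expansions in x
    and in P / x get compared. *)
Lemma rev_horner q P x D : x != 0 -> (size q <= D.+1)%N ->
  q.[P / x] * x ^+ D = (\poly_(i < D.+1) (q`_(D - i) * P ^+ (D - i))).[x].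
Proof.
move=> x0 sq; rewrite horner_poly (horner_coef_wide _ sq) mulr_suml.
rewrite (reindex_inj rev_ord_inj) /=; apply: eq_bigr => i _.
rewrite subSS expr_div_n -!mulrA; congr (_ * (_ * _)).
have iD : (i <= D)%N by rewrite -ltnS.
have -> : x ^+ D = x ^+ (D - i) * x ^+ i by rewrite -exprD subnK.
by rewrite mulrA mulVf ?mul1r // expf_neq0.
Qed.

(** Reversing a polynomial turns a relation for P / x into one for x. *)
Lemma transc_div S x P : subring S -> S P -> P != 0 -> transc S x -> transc S (P / x).
Proof.
move=> hS hP P0 hx p hp e; have x0 := transc_neq0 hS hx.
have := rev_horner P x0 (leqnSn (size p)); rewrite e mul0r => /esym e1.
have e2 := hx _ (coefs_in_poly hS (fun i _ => srM hS (hp _) (srX hS _ hP))) e1.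
apply/polyP => i; rewrite coef0.
have [h|h] := leqP (size p) i; first by rewrite nth_default.
have := congr1 (fun u : {poly F} => u`_(size p - i)) e2.
rewrite coef_poly coef0 ltnS leq_subr subKn; last exact: ltnW.
by move=> /eqP; rewrite mulf_eq0 expf_eq0 (negbTE P0) andbF orbF => /eqP.
Qed.

(** In an element that is also Laurent in P / x, poles at x only come with
    powers of P: comparing the two expansions shows the coefficient of x^(i-n)
    to be divisible by P^(n-i). *)
Lemma laur_exchange_coef R x P f n p : subring R -> R P -> P != 0 -> transc R x ->
  coefs_in R p -> f * x ^+ n = p.[x] -> laur R (P / x) f ->
  forall i, (i < n)%N -> exists2 e, R e & p`_i = e * P ^+ (n - i).
Proof.
move=> hR RP P0 hx hp ep [l [q [hq fq]]] i lin; have x0 := transc_neq0 hR hx.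
exists q`_(l + n - i) => //.
have e1 := rev_horner P x0 (leqnSn (size q)); set r := \poly_(_ < _) _ in e1.
have hr : coefs_in R r by apply: coefs_in_poly => // j _; apply: srM => //; apply: srX.
have e2 : (P ^+ l)%:P * p * 'X^(size q) = r * 'X^(n + l).
  apply: (transc_inj hR hx).
  - by apply: coefs_inM; [|apply: coefs_inM => //; apply: coefs_inC => //; apply: srX |apply: coefs_inXn].
  - by apply: coefs_inM => //; apply: coefs_inXn.
  - rewrite !hornerM !hornerXn hornerC -ep -e1 -fq expr_div_n exprD.
    by field; rewrite expf_neq0.
have := congr1 (fun u : {poly F} => u`_(i + size q)) e2.
rewrite -mulrA coefCM !coefMXn ltnNge leq_addl addnK /=.
have PL0 : P ^+ l != 0 by rewrite expf_neq0.
case: ltnP => h /= e3; apply: (mulfI PL0); rewrite e3.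
  rewrite [q`_ _]nth_default ?mul0r ?mulr0 //.
  by move: h lin; clear; move: (size q) => s; lia.
rewrite coef_poly ifT; last by move: h lin; clear; move: (size q) => s; lia.
have -> : (size q - (i + size q - (n + l)) = l + n - i)%N.
  by move: h lin; clear; move: (size q) => s; lia.
rewrite mulrCA -exprD; congr (_ * _ ^+ _); lia.
Qed.

Definition adjoin2 R x y := rgen (fun z => [\/ R z, z = x | z = y]).

(** With coefficients that are divisible in this way, the polar terms become
    powers of P / x. *)
Lemma adjoin2_of_coefs R x P f n p : subring R -> x != 0 -> coefs_in R p -> f * x ^+ n = p.[x] ->
  (forall i, (i < n)%N -> exists2 e, R e & p`_i = e * P ^+ (n - i)) ->
  adjoin2 R x (P / x) f.
Proof.
move=> hR x0 hp ep h.
have -> : f = \sum_(i < size p) p`_i * x ^+ i / x ^+ n.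
  by rewrite -mulr_suml -horner_coef -ep mulfK // expf_neq0.
have hW := @rgen_subring (fun z => [\/ R z, z = x | z = P / x]).
have Wx : adjoin2 R x (P / x) x by apply: rgen_in; constructor 2.
have Wy : adjoin2 R x (P / x) (P / x) by apply: rgen_in; constructor 3.
apply: sr_sum => // -[i hi] _ /=.
have [lin|lni] := ltnP i n.
  have [e Re ->] := h _ lin.
  have -> : e * P ^+ (n - i) * x ^+ i / x ^+ n = e * (P / x) ^+ (n - i).
    have -> : x ^+ n = x ^+ (n - i) * x ^+ i by rewrite -exprD subnK // ltnW.
    rewrite expr_div_n; field; by rewrite !expf_neq0.
  by apply: (srM hW); [apply: rgen_in; constructor 1 | apply: srX].
have -> : p`_i * x ^+ i / x ^+ n = p`_i * x ^+ (i - n).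
  have -> : x ^+ i = x ^+ (i - n) * x ^+ n by rewrite -exprD subnK.
  by rewrite mulrA mulfK // expf_neq0.
by apply: (srM hW); [apply: rgen_in; constructor 1 | apply: srX].
Qed.

(** x is the product of P and the inverse of P / x. *)
Lemma adjoin2_laurV R x P f : subring R -> R P -> P != 0 -> x != 0 ->
  adjoin2 R x (P / x) f -> laur R (P / x) f.
Proof.
move=> hR RP P0 x0; have y0 : P / x != 0 by rewrite mulf_neq0 ?invr_eq0.
have hL := laur_subring x hR; have hL' := laur_subring (P / x) hR.
apply: rgen_min => // z [h|->|->]; [exact: laur_S | | exact: laur_x].
have ex : P * (P / x)^-1 = x by field; apply/andP.
by rewrite -[X in laur _ _ X]ex; apply: (srM hL'); [apply: laur_S | apply: laur_xV].
Qed.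

(** Gauss's lemma for a power, one factor Pk at a time. *)
Lemma coprime_exp S Pk Pj n g h : subring S -> S Pk -> Pk != 0 ->
  (forall g h, S g -> S h -> Pj * g = Pk * h -> exists2 h', S h' & g = Pk * h') ->
  S g -> S h -> Pj * g = h * Pk ^+ n -> exists2 h', S h' & g = h' * Pk ^+ n.
Proof.
move=> hS SPk Pk0 cop; elim: n g h => [|n IH] g h Sg Sh e.
  by exists g => //; rewrite expr0 mulr1.
have [h1 Sh1 e1] : exists2 h', S h' & g = Pk * h'.
  apply: (cop g (h * Pk ^+ n)) => //; first by apply: (srM hS) => //; apply: srX.
  by rewrite e exprS; ring.
have [|h2 Sh2 e2] := IH h1 h Sh1 Sh.
  by apply: (mulfI Pk0); move: e; rewrite e1 exprS => e; rewrite mulrCA e; ring.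
by exists h2 => //; rewrite e1 e2 exprS; ring.
Qed.

(** Being Laurent in Pk / x amounts to divisibility of coefficients by powers
    of Pk, and this is insensitive to a factor Pj that is prime to Pk. *)
Lemma laur_coprime_div S x Pk Pj m e :
  subring S -> S Pk -> S Pj -> Pk != 0 -> Pj != 0 -> transc S x ->
  (forall g h, S g -> S h -> Pj * g = Pk * h -> exists2 h', S h' & g = Pk * h') ->
  laur S x e -> laur S (Pk / x) (e * Pj ^+ m) -> laur S (Pk / x) e.
Proof.
move=> hS SPk SPj Pk0 Pj0 tx cop Le.
have x0 := transc_neq0 hS tx.
elim: m => [|m IH]; first by rewrite expr0 mulr1.
move=> h; apply: IH; move: h; set e' := e * Pj ^+ m.
have -> : e * Pj ^+ m.+1 = Pj * e' by rewrite exprS /e'; ring.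
have : laur S x e'.
  by apply: (srM (laur_subring x hS)) => //; apply: laur_S => //; apply: srX.
move: e' => {e Le} e [n [p [hp ep]]] h.
apply: adjoin2_laurV => //; apply: (adjoin2_of_coefs hS x0 hp ep) => i lin.
have ep' : (Pj * e) * x ^+ n = (Pj *: p).[x] by rewrite hornerZ -ep mulrA.
have [g Sg] := laur_exchange_coef hS SPk Pk0 tx (coefs_inZ hS SPj hp) ep' h lin.
by rewrite coefZ; apply: coprime_exp.
Qed.

(** Expansions in a transcendental element are unique, so the coefficients lie
    in every ring that allows an expansion. *)
Lemma laur_two R E T x f n p : subring R -> subring E -> subring T -> transc T x ->
  (forall z, R z -> T z) -> (forall z, E z -> T z) ->
  coefs_in R p -> f * x ^+ n = p.[x] -> laur E x f -> coefs_in E p.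
Proof.
move=> hR hE hT tx RT ET hp ep [n' [p' [hp' ep']]] i.
have e : p * 'X^n' = p' * 'X^n.
  apply: (transc_inj hT tx).
  - by apply: coefs_inM => //; [apply: coefs_in_mono hp | apply: coefs_inXn].
  - by apply: coefs_inM => //; [apply: coefs_in_mono hp' | apply: coefs_inXn].
  - by rewrite !hornerM !hornerXn -ep -ep'; ring.
have := congr1 (fun u : {poly F} => u`_(i + n')) e.
rewrite !coefMXn ltnNge leq_addl addnK /= => ->.
by case: ifP => // _; apply: sr0.
Qed.

(** Two variables whose exchange polynomials are coprime and involve neither of
    them. The polar coefficients of f at xj are divisible by powers of Pj, and
    coprimality lets the quotients inherit the Laurent expansion in Pk / xk. *)
Lemma exchange_coprime S T xk xj Pk Pj f :
  subring S -> subring T -> S Pk -> S Pj -> Pk != 0 -> Pj != 0 ->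
  transc S xk -> transc T xj ->
  (forall z, S z -> T z) -> T xk -> (forall z, T z -> T z^-1) ->
  (forall g h, S g -> S h -> Pj * g = Pk * h -> exists2 h', S h' & g = Pk * h') ->
  laur (laur S xk) xj f -> laur (laur S (Pk / xk)) xj f ->
  laur (laur S xk) (Pj / xj) f -> laur (laur S (Pk / xk)) (Pj / xj) f.
Proof.
move=> hS hT SPk SPj Pk0 Pj0 tk tj ST Txk TV cop [n [p [hp ep]]] Lk Lj.
have xk0 := transc_neq0 hS tk; have xj0 := transc_neq0 hT tj.
have hR := laur_subring xk hS; have hE := laur_subring (Pk / xk) hS.
have y0 : Pk / xk != 0 by rewrite mulf_neq0 ?invr_eq0.
have RT z : laur S xk z -> T z by apply: laur_min => //; apply: TV.
have Ty : T (Pk / xk) by apply: (srM hT); [apply: ST | apply: TV].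
have ET z : laur S (Pk / xk) z -> T z by apply: laur_min => //; apply: TV.
have hpE := laur_two hR hE hT tj RT ET hp ep Lk.
have tjR : transc (laur S xk) xj by apply: transc_mono tj.
apply: adjoin2_laurV => //; first exact: laur_S.
apply: (adjoin2_of_coefs hE xj0 hpE ep) => i lin.
have [e Re ee] := laur_exchange_coef hR (laur_S xk hS SPj) Pj0 tjR hp ep Lj lin.
exists e => //; apply: (laur_coprime_div (m := n - i) hS SPk SPj) => //.
by rewrite -ee.
Qed.

(** As x (Q / x) = Q is in E, mixed monomials contract. *)
Lemma adjoin2_split E x Q f : subring E -> E Q -> x != 0 -> adjoin2 E x (Q / x) f ->
  exists A B, [/\ coefs_in E A, coefs_in E B & f = A.[x] + B.[Q / x]].
Proof.
move=> hE EQ x0; set y := Q / x.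
have xy : x * y = Q by rewrite /y; field.
pose T f := exists A B, [/\ coefs_in E A, coefs_in E B & f = A.[x] + B.[y]].
have TB f1 f2 : T f1 -> T f2 -> T (f1 - f2).
  move=> [A [B [hA hB ->]]] [A' [B' [hA' hB' ->]]].
  exists (A - A'), (B - B'); split; try exact: coefs_inB.
  by rewrite !(hornerD, hornerN); ring.
have T0 : T 0 by exists 0, 0; rewrite !horner0 addr0; split=> //; apply: coefs_in0.
have TD f1 f2 : T f1 -> T f2 -> T (f1 + f2).
  by move=> h1 h2; have := TB _ _ h1 (TB _ _ T0 h2); rewrite sub0r opprK.
have TE c f1 : E c -> T f1 -> T (c * f1).
  move=> Ec [A [B [hA hB ->]]]; exists (c *: A), (c *: B).
  by split; [apply: coefs_inZ..|rewrite !hornerZ mulrDr].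
have shift B : coefs_in E B -> exists2 B', coefs_in E B' & B = B' * 'X + (B`_0)%:P.
  move=> hB; exists (\poly_(i < size B) B`_i.+1); first exact: coefs_in_poly.
  apply/polyP => -[|i]; rewrite coefD coefMX coefC /= ?add0r // addr0 coef_poly.
  by case: ltnP => // h; rewrite nth_default // ltnW.
have Tz A B : coefs_in E A -> coefs_in E B -> T (A.[x] + B.[y]) by move=> hA hB; exists A, B.
have Tx f1 : T f1 -> T (x * f1).
  move=> [A [B [hA hB ->]]]; have [B' hB' ->] := shift _ hB.
  have -> : x * (A.[x] + (B' * 'X + (B`_0)%:P).[y])
     = ('X * A + B`_0 *: 'X).[x] + (Q *: B').[y].
    rewrite !(hornerD, hornerM, hornerZ, hornerX, hornerC) -xy; ring.
  by apply: Tz; [apply: coefs_inD => //; [apply: coefs_inM => //; apply: coefs_inX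
    | apply: coefs_inZ => //; apply: coefs_inX] | apply: coefs_inZ].
have Ty f1 : T f1 -> T (y * f1).
  move=> [A [B [hA hB ->]]]; have [A' hA' ->] := shift _ hA.
  have -> : y * ((A' * 'X + (A`_0)%:P).[x] + B.[y])
     = (Q *: A').[x] + ('X * B + A`_0 *: 'X).[y].
    rewrite !(hornerD, hornerM, hornerZ, hornerX, hornerC) -xy; ring.
  by apply: Tz; [apply: coefs_inZ | apply: coefs_inD => //; [apply: coefs_inM => //; apply: coefs_inX
    | apply: coefs_inZ => //; apply: coefs_inX]].
pose M g := forall f1, T f1 -> T (g * f1).
have hM : subring M.
  split; first by move=> f1; rewrite mul1r.
  - by move=> a b ha hb f1 h; rewrite mulrBl; apply: TB; [apply: ha | apply: hb].
  - by move=> a b ha hb f1 h; rewrite -mulrA; apply/ha/hb.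
have T1 : T 1.
  by exists 1, 0; rewrite horner0 hornerC addr0; split=> //; [apply: (coefs_inC hE (sr1 hE)) | apply: coefs_in0].
move=> h; suff: M f by move=> /(_ _ T1); rewrite mulr1.
move: f h; apply: rgen_min => // z [Ez|->|->] // f1; exact: TE.
Qed.

(** The pole of f at x is removed one order at a time. Its leading coefficient
    is, up to the invertible constant term of D, that of f * D.[x], hence
    divisible by the right power of Q. *)
Lemma adjoin2_unit_cancel E x Q D f : subring E -> E Q -> transc E x ->
  coefs_in E D -> D`_0 != 0 -> E (D`_0)^-1 ->
  laur E x f -> adjoin2 E x (Q / x) (f * D.[x]) -> adjoin2 E x (Q / x) f.
Proof.
move=> hE EQ tx hD D0 ED0 [n [p [hp ep]]].
have x0 := transc_neq0 hE tx; set y := Q / x.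
have hW := @rgen_subring (fun z => [\/ E z, z = x | z = y]).
have WE z : E z -> adjoin2 E x y z by move=> h; apply: rgen_in; constructor 1.
have Wx : adjoin2 E x y x by apply: rgen_in; constructor 2.
have Wy : adjoin2 E x y y by apply: rgen_in; constructor 3.
have WP q : coefs_in E q -> adjoin2 E x y q.[x].
  by move=> hq; apply: (coefs_in_horner hW) => //; apply: coefs_in_mono hq.
elim: n f p hp ep => [|n IH] f p hp ep hf.
  by move: ep; rewrite expr0 mulr1 => ->; apply: WP.
have [A [B [hA hB e]]] := adjoin2_split hE EQ x0 hf.
have [b Eb ep0] : exists2 b, E b & p`_0 = b * Q ^+ n.+1.
  have sM : (size B <= (size B + n).+1)%N by lia.
  have e1 := rev_horner Q x0 sM; set r := \poly_(_ < _) _ in e1.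
  have hr : coefs_in E r by apply: coefs_in_poly => // j _; apply: srM => //; apply: srX.
  have e2 : p * D * 'X^(size B + n) = (A * 'X^(size B + n) + r) * 'X^(n.+1).
    apply: (transc_inj hE tx).
    - by do ![apply: coefs_inM => //]; apply: coefs_inXn.
    - by apply: coefs_inM; [|apply: coefs_inD => //; apply: coefs_inM => //; apply: coefs_inXn|apply: coefs_inXn].
    - by rewrite !(hornerM, hornerD) !hornerXn -e1 -ep -mulrDl -e; ring.
  have := congr1 (fun u : {poly F} => u`_(0 + (size B + n))) e2.
  rewrite !coefMXn ltnNge leq_addl addnK /= coef0M add0n.
  have [h|h] := ltnP (size B + n) n.+1.
    move/eqP; rewrite mulf_eq0 (negbTE D0) orbF => /eqP ->.
    by exists 0; rewrite ?mul0r //; apply: sr0.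
  rewrite coefD coefMXn; have -> : (size B + n - n.+1 < size B + n)%N by move: h; clear; move: (size B) => s; lia.
  rewrite add0r coef_poly ifT; last by move: h; clear; move: (size B) => s; lia.
  have -> : (size B + n - (size B + n - n.+1) = n.+1)%N by move: h; clear; move: (size B) => s; lia.
  move=> h1; exists (B`_n.+1 / D`_0); first exact: srM.
  by apply: (mulIf D0); rewrite h1; field.
have Wb : adjoin2 E x y (b * y ^+ n.+1) by apply: (srM hW); [exact: WE | exact: srX].
rewrite -[f](subrK (b * y ^+ n.+1)); apply: (srD hW) => //.
apply: (IH _ (\poly_(i < size p) p`_i.+1)).
- exact: coefs_in_poly.
- apply: (mulIf x0).
  have -> : (\poly_(i < size p) p`_i.+1).[x] * x = p.[x] - p`_0.
    rewrite -{2}[x]hornerX -hornerM -[p`_0](hornerC _ x) -hornerN -hornerD; congr (_.[x]).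
    apply/polyP => -[|i]; rewrite coefMX coefB coefC /= ?subrr // subr0 coef_poly.
    by case: ltnP => // h; rewrite nth_default // ltnW.
  by rewrite -ep ep0 /y -mulrA -exprSr mulrBl expr_div_n -!mulrA mulVf ?mulr1 ?expf_neq0.
- by rewrite mulrBl; apply: (srB hW) => //; apply: (srM hW) => //; apply: WP.
Qed.

End Subrings.

(** * Exchanging one of two variables *)

Section Exchange.
Variable F : fieldType.
Implicit Types (S R E T : F -> Prop) (p q : {poly F}) (x y f : F).

Lemma laur_adjoin2 R x P f : subring R -> R P -> P != 0 -> transc R x ->
  laur R x f -> laur R (P / x) f -> adjoin2 R x (P / x) f.
Proof.
move=> hR RP P0 tx [n [p [hp ep]]] Lf.
exact: (adjoin2_of_coefs hR (transc_neq0 hR tx) hp ep (laur_exchange_coef hR RP P0 tx hp ep Lf)).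
Qed.

Lemma transc_powz T x (a : int) r s : subring T -> transc T x -> T r -> T s ->
  r != 0 -> r * x ^ a = s -> a = 0.
Proof.
move=> hT tx Tr Ts r0; have x0 := transc_neq0 hT tx.
case: a => n e.
  have : r *: 'X^n - s%:P = 0.
    apply: tx; last by rewrite hornerD hornerN hornerZ hornerXn hornerC e subrr.
    by apply: coefs_inB => //; [apply: coefs_inZ => //; apply: coefs_inXn | apply: coefs_inC].
  move/(congr1 (fun u : {poly F} => u`_n)).
  rewrite coefB coefZ coefXn coefC coef0 eqxx mulr1; case: n e => // n _ /=.
  by rewrite subr0 => /eqP; rewrite (negbTE r0).
have : s *: 'X^(n.+1) - r%:P = 0.
  apply: tx.
    by apply: coefs_inB => //; [apply: coefs_inZ => //; apply: coefs_inXn | apply: coefs_inC].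
  rewrite hornerD hornerN hornerZ hornerXn hornerC -e NegzE -exprnN mulfVK ?subrr //.
  by rewrite expf_neq0.
move/(congr1 (fun u : {poly F} => u`_0)).
rewrite coefB coefZ coefXn coefC coef0 eqxx mulr0 sub0r => /eqP.
by rewrite oppr_eq0 (negbTE r0).
Qed.

(** Algebraic independence of x and y over S does not depend on their order: a
    relation is expanded in powers of y first, and then each coefficient is a
    relation for x. *)
Lemma transc_swap S T x y : subring S -> subring T -> (forall z, S z -> T z) -> T x ->
  transc T y -> transc S x -> transc (laur S y) x.
Proof.
move=> hS hT ST Tx ty tx p hp e; have y0 := transc_neq0 hT ty.
have [n hn] : exists n, forall i, exists q, coefs_in S q /\ p`_i * y ^+ n = q.[y].
  elim/poly_ind: p hp {e} => [|p c IH] hp.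
    exists 0%N => i; exists 0; split; first exact: coefs_in0.
    by rewrite coef0 mul0r horner0.
  have [|n hn] := IH; first by move=> i; have := hp i.+1; rewrite coefD coefMX coefC addr0.
  have := hp 0%N; rewrite coefD coefMX coefC /= add0r => -[m [q [hq eq]]].
  exists (n + m)%N => -[|i]; rewrite coefD coefMX coefC /= ?add0r ?addr0.
    exists (q * 'X^n); split; first by apply: coefs_inM => //; apply: coefs_inXn.
    by rewrite hornerM hornerXn -eq exprD; ring.
  have [q' [hq' eq']] := hn i; exists (q' * 'X^m).
  split; first by apply: coefs_inM => //; apply: coefs_inXn.
  by rewrite hornerM hornerXn -eq' exprD; ring.
have /fin_all_exists [Q hQ] : forall i : 'I_(size p), exists q, coefs_in S q /\ p`_(nat_of_ord i) * y ^+ n = q.[y].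
  by move=> i; apply: hn.
have R0 : \sum_(i < size p) x ^+ i *: Q i = 0.
  apply: ty.
    move=> a; rewrite coef_sum; apply: (sr_sum hT) => i _; rewrite coefZ.
    by apply: (srM hT); [apply: srX | apply/ST; have [] := hQ i].
  rewrite horner_sum; transitivity (p.[x] * y ^+ n); last by rewrite e mul0r.
  rewrite horner_coef mulr_suml; apply: eq_bigr => i _.
  by rewrite hornerZ -(hQ i).2 mulrA [x ^+ i * _]mulrC.
have Qa i a : (Q i)`_a = 0.
  have : \poly_(l < size p) (if insub l is Some l' then (Q l')`_a else 0) = 0.
    apply: tx.
      apply: coefs_in_poly => // l _; case: insubP => [l' _ _|_]; last exact: sr0.
      by have [] := hQ l'.
    rewrite horner_poly; transitivity ((\sum_(i < size p) x ^+ i *: Q i)`_a); last by rewrite R0 coef0.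
    rewrite coef_sum; apply: eq_bigr => l _.
    by rewrite valK coefZ mulrC.
  move/(congr1 (fun u : {poly F} => u`_i)).
  by rewrite coef0 coef_poly ltn_ord valK.
apply/polyP => i; rewrite coef0; case: (ltnP i (size p)) => h; last by rewrite nth_default.
have [_ ei] := hQ (Ordinal h); apply: (mulIf (expf_neq0 n y0)); rewrite mul0r ei.
by rewrite (_ : Q _ = 0) ?horner0 //; apply/polyP => a; rewrite Qa coef0.
Qed.

(** Division by 1 + c x^al, started at the lowest power of x, needs no
    denominators. *)
Lemma laur_cancel S x c N al g h : subring S -> transc S x -> S c -> S N -> N != 0 ->
  (0 < al)%N -> laur S x g -> laur S x h -> N * g = (1 + c * x ^+ al) * h ->
  exists2 w, laur S x w & g = (1 + c * x ^+ al) * w.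
Proof.
move=> hS tx Sc SN N0 al0 [n [p [hp ep]]] [n' [q [hq eq]]] e.
have x0 := transc_neq0 hS tx.
set u := 1 + c * x ^+ al in e *.
pose U : {poly F} := 1 + c *: 'X^al.
have hU : coefs_in S U.
  apply: coefs_inD => //; first by apply: (coefs_inC hS); apply: sr1.
  by apply: coefs_inZ => //; apply: coefs_inXn.
have Ux : U.[x] = u by rewrite hornerD hornerZ hornerXn hornerC.
have [s sE] : exists s : {poly F}, s = N^-1 *: (q * 'X^n) by eexists.
have es : p * 'X^n' = U * s.
  have : N *: (p * 'X^n') = U * (q * 'X^n).
    apply: (transc_inj hS tx).
    - by apply: coefs_inZ => //; apply: coefs_inM => //; apply: coefs_inXn.
    - by do ![apply: coefs_inM => //]; apply: coefs_inXn.
    - rewrite hornerZ !hornerM !hornerXn Ux -ep -eq.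
      by transitivity ((N * g) * (x ^+ n * x ^+ n')); [ring | rewrite e; ring].
  by move=> hq1; apply: (scalerI N0); rewrite hq1 sE -scalerAr scalerA divff // scale1r.
have hs : coefs_in S s.
  move=> i; elim/ltn_ind: i => i IH.
  have := congr1 (fun v : {poly F} => v`_i) es.
  rewrite mulrDl mul1r coefD -scalerAl coefZ ['X^al * s]mulrC [(s * _)`__]coefMXn => e1.
  have -> : s`_i = (p * 'X^n')`_i - c * (if (i < al)%N then 0 else s`_(i - al)).
    by rewrite e1; ring.
  apply: srB => //; first by apply: coefs_inM => //; apply: coefs_inXn.
  apply: srM => //; case: ltnP => hi; first exact: sr0.
  by apply: IH; rewrite -subn_gt0 subKn.
exists (h / N).
  exists (n + n')%N, s; split=> //.
  by rewrite sE hornerZ hornerM hornerXn -eq exprD; field.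
by apply: (mulfI N0); rewrite e; field.
Qed.

(** Two variables one of which occurs in the exchange polynomial of the other.
    The value N1 of Pk at xj = 0 is a unit, so that yk^b Pj / xj differs from
    c1 Q / xj by an element without pole at xj. Hence some f Pk^n is a
    polynomial in xj and Q / xj, and the power of Pk, whose constant term is
    invertible, can be cancelled. *)
Lemma exchange_linked S xk xj b N1 N2 A C Q c1 f :
  let Pk := N1 + N2 * xj ^+ b in let yk := Pk / xk in
  let Pj := A + C * xk ^+ b in
  subring S -> S N1 -> S N2 -> S A -> S C -> S c1 -> N1 != 0 -> S N1^-1 ->
  (0 < b)%N -> Pk != 0 -> Pj != 0 -> xk != 0 -> Q != 0 -> laur S yk Q ->
  A * yk ^+ b + C * N1 ^+ b = c1 * Q ->
  transc (laur S xk) xj -> transc (laur S yk) xj ->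
  laur (laur S xk) xj f -> laur (laur S yk) xj f ->
  laur (laur S xk) (Pj / xj) f -> laur (laur S yk) (Q / xj) f.
Proof.
move=> Pk yk Pj hS SN1 SN2 SA SC Sc1 N10 SN1V b0 Pk0 Pj0 xk0 Q0 EQ eQ tR tE L0 Lk Lj.
have yk0 : yk != 0 by rewrite mulf_neq0 ?invr_eq0.
have hR := laur_subring xk hS; have hE := laur_subring yk hS.
have xj0 := transc_neq0 hR tR.
have RS z : S z -> laur S xk z by apply: laur_S.
have ES z : S z -> laur S yk z by apply: laur_S.
have RPj : laur S xk Pj.
  by apply: (srD hR); [|apply: (srM hR); [|apply: (srX hR); apply: laur_x]] => //; apply: RS.
have fj := laur_adjoin2 hR RPj Pj0 tR L0 Lj.
apply: adjoin2_laurV => //.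
pose W := adjoin2 (laur S yk) xj (Q / xj).
have hW : subring W by apply: rgen_subring.
have WE z : laur S yk z -> W z by move=> h; apply: rgen_in; constructor 1.
have WS z : S z -> W z by move=> h; apply/WE/ES.
have Wx : W xj by apply: rgen_in; constructor 2.
have WQ : W (Q / xj) by apply: rgen_in; constructor 3.
have Wyk : W yk by apply/WE/laur_x.
have WykV : W yk^-1 by apply/WE/laur_xV.
have WPk : W Pk.
  by apply: (srD hW); [|apply: (srM hW); [|apply: (srX hW)]] => //; apply: WS.
have Wxk : W xk.
  have -> : xk = Pk * yk^-1 by rewrite /yk; field; rewrite xk0 Pk0.
  exact: (srM hW).
(* Pk and N1 agree modulo xj. *)
have [e We ee] : exists2 e, W e & Pk ^+ b = N1 ^+ b + xj * e.
  exists (N2 * xj ^+ b.-1 * (\sum_(i < b) Pk ^+ (b.-1 - i) * N1 ^+ i)).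
    apply: (srM hW); first by apply: (srM hW); [exact: WS | exact: srX].
    apply: (sr_sum hW) => i _; apply: (srM hW); first exact: srX.
    by apply: (srX hW); apply: WS.
  have := subrXX Pk N1 b; rewrite (_ : Pk - N1 = xj * (N2 * xj ^+ b.-1)); last first.
    by rewrite /Pk addrC addKr mulrCA -exprS prednK.
  move=> h; rewrite -[LHS](subrK (N1 ^+ b)) h addrC; congr (_ + _).
  by rewrite -!mulrA.
have Wyj : W (Pj / xj).
  have -> : Pj / xj = yk^-1 ^+ b * (c1 * (Q / xj) + C * e).
    have h1 : yk ^+ b * Pj = c1 * Q + C * (xj * e).
      have h2 : (yk * xk) ^+ b = Pk ^+ b by rewrite /yk divfK.
      have h3 : xj * e = (yk * xk) ^+ b - N1 ^+ b by rewrite h2 ee addrC addKr.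
      rewrite -eQ h3 [(yk * xk) ^+ b]exprMn /Pj; move: (yk ^+ b) (xk ^+ b) (N1 ^+ b) => u v w; ring.
    have yb0 : yk ^+ b != 0 by rewrite expf_neq0.
    apply: (mulfI yb0); rewrite [RHS]mulrA exprVn divff // mul1r [LHS](mulrA (yk ^+ b) Pj) h1.
    by field.
  apply: (srM hW); first exact: srX.
  by apply: (srD hW); apply: (srM hW) => //; apply: WS.
pose T g := exists n, W (g * Pk ^+ n).
have TW g : W g -> T g by move=> h; exists 0%N; rewrite expr0 mulr1.
have hT : subring T.
  split; first exact/TW/(sr1 hW).
  - move=> g h [n hn] [n' hn']; exists (n + n')%N.
    have -> : (g - h) * Pk ^+ (n + n') = (g * Pk ^+ n) * Pk ^+ n' - (h * Pk ^+ n') * Pk ^+ n.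
      by rewrite exprD; ring.
    by apply: (srB hW); apply: (srM hW) => //; apply: (srX hW).
  - move=> g h [n hn] [n' hn']; exists (n + n')%N.
    have -> : (g * h) * Pk ^+ (n + n') = (g * Pk ^+ n) * (h * Pk ^+ n').
      by rewrite exprD; ring.
    exact: (srM hW).
have [n hn] : T f.
  move: f fj {L0 Lk Lj}; apply: rgen_min => // z [Rz|->|->]; last 2 first.
  - exact: TW.
  - exact: TW.
  move: z Rz; apply: laur_min => //; first by move=> z Sz; apply/TW/WS.
    exact: TW.
  exists 1%N; rewrite expr1 (_ : _ * _ = yk) // /yk mulrC //.
pose D : {poly F} := (N1%:P + N2 *: 'X^b) ^+ n.
have hD : coefs_in (laur S yk) D.
  apply: coefs_inE => //; apply: coefs_inD => //; first by apply: coefs_inC => //; apply: ES.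
  by apply: coefs_inZ => //; [apply: ES | apply: coefs_inXn].
have D0 : D`_0 = N1 ^+ n.
  rewrite -horner_coef0 horner_exp hornerD hornerC hornerZ hornerXn.
  by rewrite expr0n eqn0Ngt b0 mulr0 addr0.
apply: (adjoin2_unit_cancel (D := D)) => //.
- by rewrite D0 expf_neq0.
- by rewrite D0 -exprVn; apply: (srX hE); apply: ES.
- by rewrite horner_exp hornerD hornerC hornerZ hornerXn.
Qed.

End Exchange.

(** * The fraction field of a polynomial ring *)

Lemma frac_ratio (D : idomainType) (x : {fraction D}) :
  x = tofrac (frac (generic_quotient.repr x)).1 / tofrac (frac (generic_quotient.repr x)).2.
Proof.
set r := generic_quotient.repr x; rewrite -[LHS]reprK -/r; have d0 := denom_ratioP r.
apply: (mulIf (x := tofrac (frac r).2)); first by rewrite tofrac_eq0.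
rewrite mulfVK ?tofrac_eq0 //.
unlock tofrac; rewrite -[LHS]FracField.pi_mul; apply/eqmodP => /=.
rewrite /FracField.equivf /FracField.mulf /=.
rewrite !numden_Ratio ?mulr1 ?oner_neq0 //; exact/eqP/mulrC.
Qed.

Lemma frac_repr (D : idomainType) (x : {fraction D}) :
  exists n d : D, d != 0 /\ x = tofrac n / tofrac d.
Proof.
exists (frac (generic_quotient.repr x)).1, (frac (generic_quotient.repr x)).2.
by split; [apply: denom_ratioP | apply: frac_ratio].
Qed.

Section FracLift.
Variables (D : idomainType) (F : fieldType) (phi : {rmorphism D -> F}).
Hypothesis phi_inj : forall p, phi p = 0 -> p = 0.

(** The proof of injectivity is an argument so that the morphism structure can
    be attached to the function. *)
Definition frac_lift of (forall p, phi p = 0 -> p = 0) :=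
  fun x : {fraction D} => phi (frac (generic_quotient.repr x)).1 / phi (frac (generic_quotient.repr x)).2.
Local Notation L := (frac_lift phi_inj).

Lemma phi_neq0 d : d != 0 -> phi d != 0.
Proof. by apply: contraNneq => /phi_inj ->. Qed.

Lemma frac_liftE n d : d != 0 -> L (tofrac n / tofrac d) = phi n / phi d.
Proof.
move=> d0; have := frac_ratio (tofrac n / tofrac d).
rewrite /frac_lift; set r := generic_quotient.repr _; have d1 := denom_ratioP r.
move/eqP; rewrite eqr_div ?tofrac_eq0 // -!tofracM tofrac_eq => /eqP e.
by apply/esym/eqP; rewrite eqr_div ?phi_neq0 // -!rmorphM e.
Qed.

Lemma frac_lift_tofrac p : L (tofrac p) = phi p.
Proof. by rewrite -[tofrac p]divr1 -tofrac1 frac_liftE ?oner_neq0 // rmorph1 divr1. Qed.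

Lemma frac_lift_zmod_morphism : zmod_morphism L.
Proof.
move=> x y; have [n [d [d0 ->]]] := frac_repr x; have [n' [d' [d0' ->]]] := frac_repr y.
rewrite -mulNr -tofracN addf_div ?tofrac_eq0 // -!tofracM -tofracD.
rewrite !frac_liftE ?mulf_neq0 // !(rmorphM, rmorphD, rmorphN) -addf_div ?phi_neq0 //.
by rewrite mulNr.
Qed.

Lemma frac_lift_monoid_morphism : monoid_morphism L.
Proof.
split; first by rewrite -tofrac1 frac_lift_tofrac rmorph1.
move=> x y; have [n [d [d0 ->]]] := frac_repr x; have [n' [d' [d0' ->]]] := frac_repr y.
rewrite mulf_div -!tofracM !frac_liftE ?mulf_neq0 // !rmorphM.
by rewrite mulf_div.
Qed.

HB.instance Definition _ := GRing.isZmodMorphism.Build _ _ L frac_lift_zmod_morphism.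
HB.instance Definition _ := GRing.isMonoidMorphism.Build _ _ L frac_lift_monoid_morphism.
End FracLift.

Section MpolyHom.
Variables (K : fieldType) (N : nat).
Notation P := {mpoly K[N]}.
Notation F := {fraction P}.

Lemma mpoly_hom_ext (S : nzRingType) (f g : {rmorphism P -> S}) :
  (forall c, f c%:MP = g c%:MP) -> (forall i, f 'X_i = g 'X_i) -> f =1 g.
Proof.
move=> hc hx; apply: mpolyind => [|c m p _ _ IH]; first by rewrite !rmorph0.
rewrite -mul_mpolyC !rmorphD !rmorphM IH hc; congr (_ * _ + _).
rewrite mpolyXE_id !rmorph_prod; apply: eq_bigr => i _.
by rewrite !rmorphXn hx.
Qed.

Definition cst (c : K) : F := tofrac c%:MP.
Definition var (i : 'I_N) : F := tofrac 'X_i.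

HB.instance Definition _ := GRing.RMorphism.copy cst (@tofrac P \o (@mpolyC N K)).

Lemma var_neq0 i : var i != 0.
Proof.
rewrite tofrac_eq0; apply/eqP => /(congr1 (meval (fun=> 1))).
by rewrite mevalXU meval0 => /eqP; rewrite oner_eq0.
Qed.

Lemma mmap_var : mmap cst var =1 @tofrac _.
Proof.
apply: mpoly_hom_ext => [c|i] /=; first by rewrite mmapC.
by rewrite mmapX mmap1U.
Qed.

(** Sets the variables outside J to 0, so that the polynomials in the variables
    of J are the fixed points. *)
Definition only (J : pred 'I_N) : P -> P :=
  mmap (@mpolyC N K) (fun i => if J i then 'X_i else 0).
HB.instance Definition _ J := GRing.RMorphism.copy (only J)
  (mmap (@mpolyC N K) (fun i => if J i then 'X_i else 0)).

Definition frac_in (J : pred 'I_N) (f : F) :=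
  exists c d, [/\ only J c = c, only J d = d, d != 0 & f = tofrac c / tofrac d].

Lemma frac_in_subring J : subring (frac_in J).
Proof.
split.
- by exists 1, 1; rewrite tofrac1 divr1; split; rewrite ?rmorph1 ?oner_neq0.
- move=> x y [c [d [hc hd d0 ->]]] [c' [d' [hc' hd' d0' ->]]].
  exists (c * d' - c' * d), (d * d'); split; rewrite ?mulf_neq0 //.
  - by rewrite rmorphB !rmorphM /= hc hd hc' hd'.
  - by rewrite rmorphM /= hd hd'.
  rewrite tofracB 3!tofracM.
  by rewrite -mulNr addf_div ?tofrac_eq0 // mulNr.
- move=> x y [c [d [hc hd d0 ->]]] [c' [d' [hc' hd' d0' ->]]].
  exists (c * c'), (d * d'); split; rewrite ?mulf_neq0 //.
  - by rewrite rmorphM /= hc hc'.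
  - by rewrite rmorphM /= hd hd'.
  by rewrite 2!tofracM mulf_div.
Qed.

Lemma frac_in_inv J f : frac_in J f -> frac_in J f^-1.
Proof.
move=> [c [d [hc hd d0 ->]]]; have [->|c0] := eqVneq c 0.
  rewrite rmorph0 mul0r invr0; exact: (sr0 (frac_in_subring J)).
by exists d, c; rewrite invf_div.
Qed.

Lemma frac_in_cst J c : frac_in J (cst c).
Proof. by exists c%:MP, 1; rewrite tofrac1 divr1 rmorph1 oner_neq0 /only mmapC. Qed.

Lemma frac_in_var (J : pred 'I_N) i : J i -> frac_in J (var i).
Proof. by move=> Ji; exists 'X_i, 1; rewrite tofrac1 divr1 rmorph1 oner_neq0 /only mmapX mmap1U Ji. Qed.

(** 'X_k becomes the variable of a univariate polynomial. *)
Definition split_at (k : 'I_N) : P -> {poly P} :=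
  mmap (polyC \o @mpolyC N K) (fun i => if i == k then 'X else ('X_i)%:P).
HB.instance Definition _ k := GRing.RMorphism.copy (split_at k)
  (mmap (polyC \o @mpolyC N K) (fun i => if i == k then 'X else ('X_i)%:P)).

Lemma split_at_only (J : pred 'I_N) k p : ~~ J k -> only J p = p -> split_at k p = p%:P.
Proof.
move=> Jk <-.
have h : split_at k \o only J =1 polyC \o only J.
  apply: mpoly_hom_ext => [c|i]; rewrite /= /only.
    by rewrite !mmapC /split_at mmapC.
  rewrite mmapX mmap1U; case: ifP => Ji; last by rewrite !rmorph0.
  rewrite /split_at mmapX mmap1U; case: eqP => // e.
  by rewrite -e Ji in Jk.
exact: h p.
Qed.

(** The induction multiplies coefficients of q by denominators, so these have
    to stay in the variables of J as well. *)
Lemma coefs_in_common_denom J (p : {poly F}) : coefs_in (frac_in J) p ->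
  exists (d : P) (q : {poly P}), [/\ d != 0, only J d = d, forall i, only J q`_i = q`_i &
    tofrac d *: p = map_poly (@tofrac _) q].
Proof.
elim/poly_ind: p => [|p c IH] h.
  exists 1, 0; rewrite oner_neq0 scaler0 rmorph0 rmorph1; split=> // i.
  by rewrite coef0 rmorph0.
have [|d [q [d0 hd hq e]]] := IH.
  by move=> i; have := h i.+1; rewrite coefD coefMX coefC /= addr0.
have := h 0%N; rewrite coefD coefMX coefC /= add0r => -[n [d' [hn hd' d0' ec]]].
exists (d * d'), (d' *: q * 'X + (n * d)%:P); split.
- by rewrite mulf_neq0.
- by rewrite rmorphM /= hd hd'.
- case=> [|i]; rewrite coefD coefMX coefC /= ?add0r ?addr0 ?coefZ rmorphM /=.
    by rewrite hd hn.
  by rewrite hd' hq.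
- have e' i : tofrac d * p`_i = tofrac q`_i.
    by have := congr1 (fun u : {poly F} => u`_i) e; rewrite coefZ coef_map.
  apply/polyP => -[|i]; rewrite coefZ coef_map /= !(coefD, coefMX, coefC) /=.
    rewrite !add0r ec 2!tofracM -mulrA [tofrac d' * _]mulrC mulfVK ?tofrac_eq0 // mulrC //.
  by rewrite !addr0 coefZ 2!tofracM -e' -mulrA mulrCA.
Qed.

(** Once denominators are cleared, splitting off 'X_k turns a relation for it
    into the vanishing of a univariate polynomial. *)
Lemma var_transc (J : pred 'I_N) k : ~~ J k -> transc (frac_in J) (var k).
Proof.
move=> Jk p hp e; have [d [q [d0 hd hq eq]]] := coefs_in_common_denom hp.
have : (map_poly (@tofrac _) q).[var k] = 0 by rewrite -eq hornerZ e mulr0.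
rewrite horner_map /= => /eqP; rewrite tofrac_eq0 => /eqP e1.
have q0 : q = 0.
  rewrite -(rmorph0 (split_at k)) -e1 horner_coef rmorph_sum /= -{1}(coefK q) poly_def.
  apply: eq_bigr => i _; rewrite rmorphM rmorphXn /= (split_at_only Jk (hq i)).
  by rewrite /split_at mmapX mmap1U eqxx mul_polyC.
have : tofrac d *: p = 0 by rewrite eq q0 rmorph0.
by move/eqP; rewrite scaler_eq0 tofrac_eq0 (negbTE d0) => /eqP.
Qed.

(** The Laurent polynomials in those members of the cluster g that J
    selects. *)
Definition gen (g : 'I_N -> F) (J : pred 'I_N) : F -> Prop :=
  rgen (fun y => (exists c, y = cst c) \/ (exists2 i, J i & y = g i \/ y = (g i)^-1)).

Lemma gen_subring g J : subring (gen g J). Proof. exact: rgen_subring. Qed.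

Lemma gen_cst g J c : gen g J (cst c).
Proof. by apply: rgen_in; left; exists c. Qed.
Lemma gen_g g (J : pred 'I_N) i : J i -> gen g J (g i).
Proof. by move=> Ji; apply: rgen_in; right; exists i => //; left. Qed.
Lemma gen_gV g (J : pred 'I_N) i : J i -> gen g J (g i)^-1.
Proof. by move=> Ji; apply: rgen_in; right; exists i => //; right. Qed.

Lemma gen_min g (J : pred 'I_N) S : subring S -> (forall c, S (cst c)) ->
  (forall i, J i -> S (g i)) -> (forall i, J i -> S (g i)^-1) -> forall f, gen g J f -> S f.
Proof.
move=> hS hc h1 h2; apply: rgen_min => // y [[c ->]|[i Ji [->|->]]] //.
  exact: h1.
exact: h2.
Qed.

Lemma gen_mono g g' (J J' : pred 'I_N) : (forall i, J i -> J' i) ->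
  (forall i, J i -> g i = g' i) -> forall f, gen g J f -> gen g' J' f.
Proof.
move=> hJ hg; apply: gen_min => [|c|i Ji|i Ji]; first exact: gen_subring.
- exact: gen_cst.
- by rewrite hg //; apply/gen_g/hJ.
- by rewrite hg //; apply/gen_gV/hJ.
Qed.

Lemma gen_prodz g (J : pred 'I_N) (Q : pred 'I_N) (e : 'I_N -> int) :
  (forall i, Q i -> J i \/ e i = 0) -> gen g J (\prod_(i | Q i) g i ^ e i).
Proof.
move=> h; apply: (sr_prod (gen_subring g J)) => i /h [Ji|->]; last first.
  rewrite expr0z; exact: (sr1 (gen_subring _ _)).
by apply: (srXz (gen_subring g J)); [apply: gen_g | apply: gen_gV].
Qed.

Lemma gen_frac_in J f : gen var J f -> frac_in J f.
Proof.
apply: gen_min; [exact: frac_in_subring | exact: frac_in_cst | exact: frac_in_var |].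
by move=> i Ji; apply/frac_in_inv/frac_in_var.
Qed.

(** Singles out one variable, so that results on one variable apply. *)
Lemma gen_laur g (J J' : pred 'I_N) k f : g k != 0 -> J' k ->
  (forall i, J i -> J' i) -> (forall i, J' i -> i = k \/ J i) ->
  gen g J' f <-> laur (gen g J) (g k) f.
Proof.
move=> gk0 J'k JJ' J'J; have hS := gen_subring g J; have hS' := gen_subring g J'.
have hL := laur_subring (g k) hS.
split; last first.
  apply: laur_min => //; first by apply: gen_mono.
  - exact: gen_g.
  - exact: gen_gV.
move: f; apply: gen_min => // [c|i /J'J [->|Ji]|i /J'J [->|Ji]].
- by apply: laur_S => //; apply: gen_cst.
- exact: laur_x.
- by apply: laur_S => //; apply: gen_g.
- exact: laur_xV.
- by apply: laur_S => //; apply: gen_gV.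
Qed.

End MpolyHom.
Arguments frac_in_subring {K N}.

(** * Laurent monomials and exchange polynomials *)

Lemma pospart_split (z : int) : pospart z = z + pospart (- z).
Proof. rewrite /pospart; lia. Qed.

Lemma pospart_nat (n : nat) : pospart n%:Z = n%:Z.
Proof. rewrite /pospart; lia. Qed.

Lemma pospart_natN (n : nat) : pospart (- n%:Z) = 0.
Proof. rewrite /pospart; lia. Qed.

Section Monomials.
Variables (K : fieldType) (N : nat).
Notation F := {fraction {mpoly K[N]}}.
Notation var := (@var K N).
Implicit Types (e u v : 'I_N -> int) (J : pred 'I_N).

Definition mono e : F := \prod_l var l ^ e l.

Lemma eq_mono e e' : e =1 e' -> mono e = mono e'.
Proof. by move=> h; apply: eq_bigr => l _; rewrite h. Qed.

Lemma mono_neq0 e : mono e != 0.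
Proof. by apply/prodf_neq0 => l _; rewrite expfz_neq0 // var_neq0. Qed.

Lemma monoD e e' : mono (fun l => e l + e' l) = mono e * mono e'.
Proof. by rewrite -big_split; apply: eq_bigr => l _; rewrite expfzDr // var_neq0. Qed.

Lemma mono0 e : (forall l, e l = 0) -> mono e = 1.
Proof. by move=> h; rewrite /mono big1 // => l _; rewrite h expr0z. Qed.

Lemma monoN e : mono (fun l => - e l) = (mono e)^-1.
Proof.
apply: (mulfI (mono_neq0 e)); rewrite divff ?mono_neq0 // -monoD mono0 // => l.
exact: subrr.
Qed.

Lemma monoXz e (n : int) : mono e ^ n = mono (fun l => e l * n).
Proof.
rewrite /mono; elim/big_rec2: _ => [|l x y _ <-]; first by rewrite exp1rz.
by rewrite expfzMl exprz_exp.
Qed.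

Lemma mono_gen J e : (forall l, J l \/ e l = 0) -> gen var J (mono e).
Proof. by move=> h; apply: gen_prodz => l _. Qed.

Definition drop_at k e := fun l => if l == k then 0 else e l.

Lemma mono_split k e : mono e = mono (drop_at k e) * var k ^ e k.
Proof.
rewrite /mono (bigD1 k) //= [in RHS](bigD1 k) //= /drop_at eqxx expr0z mul1r mulrC.
by congr (_ * _); apply: eq_bigr => l /negbTE ->.
Qed.

Definition others k : pred 'I_N := fun l => l != k.

Lemma mono_frac_in k e s : frac_in (others k) s -> mono e = s -> e k = 0.
Proof.
move=> hs; rewrite (mono_split k) => es.
apply: (@transc_powz _ (frac_in (others k)) (var k) (e k) (mono (drop_at k e)) s) => //.
- exact: frac_in_subring.
- by apply: var_transc; rewrite /others eqxx.
- by apply/gen_frac_in/mono_gen => l; rewrite /drop_at /others; case: eqP; [right|left].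
- exact: mono_neq0.
Qed.

(** The right-hand side of the exchange relation for a column e of an exchange
    matrix, before division. *)
Definition expol e := mono (fun l => pospart (e l)) + mono (fun l => pospart (- e l)).

Lemma expolE e : expol e = mono (fun l => pospart (- e l)) * (1 + mono e).
Proof.
rewrite /expol mulrDr mulr1 addrC -monoD; congr (_ + _); apply: eq_mono => l.
by rewrite pospart_split addrC.
Qed.

Lemma expolN e : expol (fun l => - e l) = expol e.
Proof. by rewrite /expol addrC; congr (_ + _); apply: eq_mono => l; rewrite ?opprK. Qed.

Lemma expol_gen J e : (forall l, J l \/ e l = 0) -> gen var J (expol e).
Proof.
move=> h; apply: (srD (gen_subring _ _)); apply: mono_gen => l;
  by case: (h l) => [|->]; [left | right].
Qed.

Lemma frac_in_N1 J : frac_in J (-1 : F).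
Proof. exact: (srN (frac_in_subring J) (sr1 (frac_in_subring J))). Qed.

(** For e = 0 the value is 2, whence the condition on the characteristic. *)
Lemma expol_neq0 e : (2%:R : K) != 0 -> expol e != 0.
Proof.
move=> char2; rewrite expolE mulf_neq0 ?mono_neq0 //.
case: (pickP (fun l => e l != 0)) => [i|h]; last first.
  rewrite mono0 => [|l]; last by apply/eqP; have := h l => /negbFE.
  rewrite -[1 + 1]/(2%:R) -(rmorph_nat (@cst K N)) fmorph_eq0 //.
apply: contraNneq => h; apply/eqP.
apply: (@mono_frac_in _ _ (-1)); first exact: frac_in_N1.
by apply: (addrI 1); rewrite h subrr.
Qed.

(** Up to monomials the two polynomials are 1 + U and 1 + V. Modulo both of
    them the monomials U and V are -1, and so is every even power 1;
    eliminating a variable i between U^2 and V^2 yields a monomial w free of i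
    such that 1 + U divides (w - 1) g. By independence w <> 1, and since w - 1
    does not involve i it can be cancelled. *)
Lemma expol_coprime J u v g h :
  (forall l, J l \/ u l = 0) -> (forall l, J l \/ v l = 0) ->
  (forall a b : int, (forall l, a * u l + b * v l = 0) -> a = 0 /\ b = 0) ->
  gen var J g -> gen var J h -> expol v * g = expol u * h ->
  exists2 h', gen var J h' & g = expol u * h'.
Proof.
move=> hu hv ind Sg Sh e; set S := gen var J.
have hS : subring S by apply: gen_subring.
wlog [i ui] : u hu ind e / exists i, 0 < u i.
  move=> W; case: (pickP (fun i => 0 < u i)) => [i ui|h1]; first by apply: (W u) => //; exists i.
  case: (pickP (fun i => 0 < - u i)) => [i ui|h2].
    rewrite -(expolN u); apply: (W (fun l => - u l)) => //.
    - by move=> l; case: (hu l) => [|->]; [left | right].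
    - move=> a b h'; have [|a0 b0] := ind (- a) b.
        by move=> l; rewrite -[RHS](h' l); ring.
      by split=> //; apply/eqP; rewrite -oppr_eq0 a0.
    - by rewrite expolN.
    - by exists i.
  have [|h3 _] := ind 1 0; last by [].
  by move=> l; move: (h1 l) (h2 l) => /=; lia.
pose U := mono u; pose V := mono v; pose al := `|u i|%N.
have al0 : (0 < al)%N by rewrite /al; lia.
have ual : u i = al%:Z by rewrite /al; lia.
have SU : S U by apply: mono_gen.
have SUV : S U^-1.
  by rewrite -monoN; apply: mono_gen => l; case: (hu l) => [|->]; [left|right].
have SV : S V by apply: mono_gen.
have Smn w : (forall l, J l \/ w l = 0) -> S (mono (fun l => pospart (w l))).
  by move=> hw; apply: mono_gen => l; case: (hw l) => [|->]; [left|right].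
have Smm w : (forall l, J l \/ w l = 0) -> S (mono (fun l => pospart (- w l)))^-1.
  by move=> hw; rewrite -monoN; apply: mono_gen => l; case: (hw l) => [|->]; [left|right].
have Sm w : (forall l, J l \/ w l = 0) -> S (mono (fun l => pospart (- w l))).
  by move=> hw; apply: mono_gen => l; case: (hw l) => [|->]; [left|right].
pose D z := exists2 w, S w & z = (1 + U) * w.
have DD a b : D a -> D b -> D (a + b).
  by move=> [w Sw ->] [w' Sw' ->]; exists (w + w'); [exact: srD | rewrite mulrDr].
have DM a b : S a -> D b -> D (a * b).
  by move=> Sa [w Sw ->]; exists (a * w); [exact: srM | rewrite mulrCA].
have D1 : D ((1 + V) * g).
  exists ((mono (fun l => pospart (- v l)))^-1 * (mono (fun l => pospart (- u l)) * h)).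
    by apply: (srM hS); [exact: Smm | apply: (srM hS) => //; exact: Sm].
  apply: (mulfI (mono_neq0 (fun l => pospart (- v l)))).
  rewrite mulrA -expolE e expolE [RHS]mulrCA mulVKf ?mono_neq0 //.
  by rewrite -!mulrA mulrCA.
have geomX (z : F) n : exists2 s, forall T, subring T -> T z -> T s &
    z ^+ (2 * n) - 1 = (1 + z) * s.
  exists ((z - 1) * \sum_(i < n) (z ^+ 2) ^+ i).
    move=> T hT Tz; apply: (srM hT); first by apply: (srB hT) => //; apply: sr1.
    by apply: (sr_sum hT) => i' _; do 2![apply: (srX hT)].
  by rewrite exprM subrX1 subr_sqr_1 [(z - 1) * (z + 1)]mulrC [z + 1]addrC mulrA.
(* The exponents 2 v_i and 2 u_i make the variable i drop out of V^(2 u_i) /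
   U^(2 v_i), and are even because U and V are -1 and not 1. *)
have D2 : D ((V ^+ (2 * al) - 1) * g).
  have [s Ss ->] := geomX V al.
  by rewrite [_ * s]mulrC -mulrA; apply: DM => //; apply: Ss.
have D3 : D (U ^ (2 * v i) - 1).
  case: (v i) => n.
    by have [s Ss es] := geomX U n; exists s; [apply: Ss | rewrite -es].
  have [s Ss es] := geomX U n.+1.
  have -> : U ^ (2 * Negz n) = (U ^+ (2 * n.+1))^-1 by rewrite NegzE mulrN -exprnN.
  exists (- (s * U^-1 ^+ (2 * n.+1))).
    by apply: (srN hS); apply: (srM hS); [exact: Ss | exact: srX].
  rewrite mulrN mulrA -es mulrBl mul1r exprVn divff ?opprB //.
  by rewrite expf_neq0 // mono_neq0.
pose w l := v l * (2 * al)%N%:Z - u l * (2 * v i).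
have Vw : V ^+ (2 * al) = mono w * U ^ (2 * v i).
  rewrite /V -[_ ^+ _]/(_ ^ (2 * al)%N%:Z) !monoXz -monoD; apply: eq_mono => l.
  by rewrite /w subrK.
have Sw : gen var J (mono w).
  apply: mono_gen => l; rewrite /w; case: (hu l) => [|->]; first by left.
  by case: (hv l) => [|->]; [left|right]; rewrite // !mul0r.
have wi : w i = 0 by rewrite /w ual; lia.
have D4 : D ((mono w - 1) * g).
  have -> : (mono w - 1) * g = (V ^+ (2 * al) - 1) * g - (mono w * g) * (U ^ (2 * v i) - 1).
    rewrite Vw; have rid (R : comNzRingType) (x y z : R) :
      (x - 1) * z = (x * y - 1) * z - (x * z) * (y - 1) by ring.
    exact: rid.
  apply: DD => //; rewrite -mulNr; apply: DM => //.
  by apply: (srN hS); apply: (srM hS).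
(* It remains to divide by w - 1, which does not involve the variable i. *)
have [h' Sh' e'] := D4.
pose J' l := J l && (l != i).
have Ji : J i by case: (hu i) => // ui0; move: ui; rewrite ui0.
have hS' : subring (gen var J') by apply: gen_subring.
have toL z : gen var J z -> laur (gen var J') (var i) z.
  move=> hz; apply/(gen_laur (g := var) (J := J') (J' := J) (k := i)) => //.
  - exact: var_neq0.
  - by move=> l /andP [].
  - by move=> l Jl; rewrite /J'; case: (eqVneq l i) => [->|]; [left | right; rewrite Jl].
pose c := mono (drop_at i u).
have EU : 1 + U = 1 + c * var i ^+ al by rewrite /U (mono_split i) ual.
have N0 : mono w - 1 != 0.
  rewrite subr_eq0; apply/eqP => ew.
  have w0 l : w l = 0.
    apply: (@mono_frac_in l _ 1) => //; exact: (sr1 (frac_in_subring _)).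
  have [|] := ind (2 * v i) (- (2 * al)%N%:Z).
    by move=> l; have := w0 l; rewrite /w; lia.
  by move=> _ /eqP; rewrite oppr_eq0; lia.
have [||||x Lx ex] := @laur_cancel _ (gen var J') (var i) c (mono w - 1) al g h' hS' _ _ _ N0 al0 (toL _ Sg) (toL _ Sh') _.
- by apply: (transc_mono (@gen_frac_in _ _ J')); apply: var_transc; rewrite /J' eqxx andbF.
- apply: mono_gen => l; rewrite /J' /drop_at; case: eqP => _ /=; first by right.
  by rewrite andbT.
- apply: (srB hS'); last exact: sr1.
  apply: mono_gen => l; rewrite /J'; case: (eqVneq l i) => [->|_]; first by right.
  rewrite andbT /w; case: (hu l) => [|->]; first by left.
  by case: (hv l) => [|->]; [left|right]; rewrite // !mul0r.
- by rewrite -EU.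
exists ((mono (fun l => pospart (- u l)))^-1 * x).
  apply: (srM hS); first exact: Smm.
  apply: (laur_min (var_neq0 _ i) hS _ _ _ Lx) => [z||]; [|exact: gen_g|exact: gen_gV].
  by apply: gen_mono => // l /andP [].
rewrite expolE [mono (fun l => pospart _) * _]mulrC -mulrA mulVKf ?mono_neq0 //.
by rewrite ex -EU.
Qed.

End Monomials.
Arguments mono {K N}.
Arguments expol {K N}.

(** * Two mutations and Laurent expansions *)

Section Step.
Variables (K : fieldType) (N : nat).
Hypothesis char2 : (2%:R : K) != 0.
Notation F := {fraction {mpoly K[N]}}.
Notation var := (@var K N).
Implicit Types (e u v : 'I_N -> int) (J : pred 'I_N) (g : 'I_N -> F).

Definition upd g k (y : F) : 'I_N -> F := fun i => if i == k then y else g i.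

Lemma gen2 g k j f : k != j -> g k != 0 -> g j != 0 ->
  let J := [pred l | (l != k) && (l != j)] in
  (forall l, J l -> g l = var l) ->
  gen g predT f <-> laur (laur (gen var J) (g k)) (g j) f.
Proof.
move=> kj gk gj J hg.
have h1 z : gen g J z <-> gen var J z.
  by split; apply: gen_mono => // l Jl; rewrite hg.
have h2 z : gen g (others j) z <-> laur (gen var J) (g k) z.
  have E := @gen_laur K N g J (others j) k z gk kj.
  apply: (iff_trans (E _ _)); first by move=> l /andP [].
    by move=> l lj; rewrite /J /=; case: (eqVneq l k); [left | right].
  by split; apply: laur_mono => z' /h1.
have E := @gen_laur K N g (others j) predT j f gj isT.
apply: (iff_trans (E _ _)) => //.
  by move=> l _; rewrite /others; case: (eqVneq l j); [left | right].
by split; apply: laur_mono => z' /h2.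
Qed.

(** Column j of an exchange matrix after mutation at k, where u and v are its
    columns k and j. *)
Definition mutcol k u v : 'I_N -> int := fun l =>
  if l == k then - v l
  else v l + (pospart (u l) * pospart (v k) - pospart (- u l) * pospart (- v k)).

Definition xprod g e : F := \prod_l g l ^ e l.

(** The exchange polynomial of the mutated column, in the cluster where y has
    replaced the variable k. *)
Definition mutpol k u v (y : F) : F :=
  xprod (upd var k y) (fun l => pospart (mutcol k u v l))
  + xprod (upd var k y) (fun l => pospart (- mutcol k u v l)).

Lemma xprod_upd k y e : xprod (upd var k y) e = mono (drop_at k e) * y ^ e k.
Proof.
rewrite /xprod /mono (bigD1 k) //= [in RHS](bigD1 k) //= /drop_at /upd !eqxx expr0z mul1r mulrC.
by congr (_ * _); apply: eq_bigr => l /negbTE ->.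
Qed.

(** Changing the signs of both columns changes no exchange polynomial, which
    saves the case u j < 0. *)
Lemma mutpolN k u v y : mutpol k (fun l => - u l) (fun l => - v l) y = mutpol k u v y.
Proof.
rewrite /mutpol addrC; congr (_ + _); apply: eq_bigr => l _; congr (_ ^ _);
  rewrite /mutcol; case: ifP => _; rewrite ?opprK //; congr pospart; ring.
Qed.

Section Two.
Variables (k j : 'I_N) (u v : 'I_N -> int).
Hypotheses (kj : k != j) (uk : u k = 0) (vj : v j = 0).
Let xk := var k.
Let xj := var j.
Let yk := expol u / xk.
Let J := [pred l | (l != k) && (l != j)].

Let hS : subring (gen var J). Proof. exact: gen_subring. Qed.

Let STj z : gen var J z -> frac_in (others j) z.
Proof. by move=> h; apply: gen_frac_in; apply: gen_mono h => // l /andP []. Qed.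

Let Tj_xk : frac_in (others j) xk.
Proof. exact: frac_in_var. Qed.

Let tk : transc (gen var J) xk.
Proof. by apply: (transc_mono (@gen_frac_in _ _ J)); apply: var_transc; rewrite /J /= eqxx. Qed.

Let tj : transc (frac_in (others j)) xj.
Proof. by apply: var_transc; rewrite /others eqxx. Qed.

Let xk0 : xk != 0 := var_neq0 K k.
Let xj0 : xj != 0 := var_neq0 K j.
Let P0 e : expol e != 0 := expol_neq0 e char2.

Let yk0 : yk != 0. Proof. exact: (mulf_neq0 (P0 u) (invr_neq0 xk0)). Qed.
Let yj0 : expol v / xj != 0. Proof. exact: (mulf_neq0 (P0 v) (invr_neq0 xj0)). Qed.

Let gJ e : e k = 0 -> e j = 0 -> forall l, J l \/ e l = 0.
Proof.
move=> ek ej l; rewrite /J /=; case: (eqVneq l k) => [->|lk]; first by right.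
by case: (eqVneq l j) => [->|lj]; [right | left].
Qed.

(** Restates membership in the three rings, one for each cluster, as iterated
    expansions in the two variables k and j. *)
Lemma exchange_expansions f yq :
  gen var predT f -> gen (upd var k yk) predT f -> gen (upd var j (expol v / xj)) predT f ->
  yq != 0 ->
  (laur (laur (gen var J) xk) xj f -> laur (laur (gen var J) yk) xj f ->
   laur (laur (gen var J) xk) (expol v / xj) f -> laur (laur (gen var J) yk) yq f) ->
  gen (upd (upd var k yk) j yq) predT f.
Proof.
have jk : (j == k) = false by rewrite eq_sym (negbTE kj).
move=> h1 h2 h3 yq0 H.
have {}h1 : laur (laur (gen var J) xk) xj f.
  exact: (proj1 (@gen2 var k j f kj xk0 xj0 (fun _ _ => erefl)) h1).
have {}h2 : laur (laur (gen var J) yk) xj f.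
  have := @gen2 (upd var k yk) k j f kj; rewrite /upd eqxx jk => /(_ yk0 xj0) E.
  by apply: (proj1 (E _) h2) => l /andP [/negbTE -> _].
have {}h3 : laur (laur (gen var J) xk) (expol v / xj) f.
  have := @gen2 (upd var j (expol v / xj)) k j f kj.
  rewrite /upd eqxx (negbTE kj) => /(_ xk0 yj0) E.
  by apply: (proj1 (E _) h3) => l /andP [_ /negbTE ->].
have {}H := H h1 h2 h3.
have := @gen2 (upd (upd var k yk) j yq) k j f kj.
rewrite /upd !eqxx (negbTE kj) => /(_ yk0 yq0) E.
by apply: (proj2 (E _) H) => l /andP [/negbTE -> /negbTE ->].
Qed.

(** When neither variable occurs in the exchange polynomial of the other,
    mutation at k leaves the exchange polynomial of j unchanged. *)
Lemma exchange_zero f : u j = 0 -> v k = 0 ->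
  (forall a b : int, (forall l, a * u l + b * v l = 0) -> a = 0 /\ b = 0) ->
  gen var predT f -> gen (upd var k yk) predT f -> gen (upd var j (expol v / xj)) predT f ->
  gen (upd (upd var k yk) j (mutpol k u v yk / xj)) predT f.
Proof.
move=> uj vk ind h1 h2 h3.
have hQ : mutpol k u v yk = expol v.
  rewrite /mutpol !xprod_upd /mutcol eqxx vk oppr0 !expr0z !mulr1.
  by congr (_ + _); apply: eq_mono => l; rewrite /drop_at; case: eqP => [->|_];
     rewrite ?vk // !mulr0 subrr addr0.
rewrite hQ; apply: exchange_expansions => //.
have hu : forall l, J l \/ u l = 0 by apply: gJ.
have hv : forall l, J l \/ v l = 0 by apply: gJ.
exact: (exchange_coprime hS (frac_in_subring (others j)) (expol_gen _ hu) (expol_gen _ hv)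
  (P0 u) (P0 v) tk tj STj Tj_xk (@frac_in_inv _ _ _) (fun x y => @expol_coprime _ _ _ _ _ x y hu hv ind)).
Qed.

(** When k and j are linked by b arrows, both exchange polynomials have exactly
    one term containing the other variable, to the power b. *)
Lemma exchange_pos (b : nat) f : (0 < b)%N -> u j = b%:Z -> v k = - b%:Z ->
  gen var predT f -> gen (upd var k yk) predT f -> gen (upd var j (expol v / xj)) predT f ->
  gen (upd (upd var k yk) j (mutpol k u v yk / xj)) predT f.
Proof.
move=> b0 uj vk h1 h2 h3; set Q := mutpol _ _ _ _.
pose n1 l := pospart (- u l).
pose n2 := drop_at j (fun l => pospart (u l)).
pose a l := pospart (v l).
pose c := drop_at k (fun l => pospart (- v l)).
pose q1 := drop_at k (fun l => pospart (mutcol k u v l)).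
pose q2 := drop_at k (fun l => pospart (- mutcol k u v l)).
have jk : (j == k) = false by rewrite eq_sym (negbTE kj).
have p0 : pospart 0 = 0 by [].
have mj : mutcol k u v j = - (b%:Z * 0) by rewrite /mutcol jk vj uj vk pospart_natN; ring.
pose Sm e := @mono_gen K N J e.
have hn1 : gen var J (mono n1) by apply/Sm/gJ; rewrite /n1 ?uk ?uj ?pospart_natN.
have hn2 : gen var J (mono n2).
  by apply/Sm/gJ; rewrite /n2 /drop_at ?eqxx ?(negbTE kj) ?uk.
have ha : gen var J (mono a) by apply/Sm/gJ; rewrite /a ?vj ?vk ?pospart_natN.
have hc : gen var J (mono c).
  by apply/Sm/gJ; rewrite /c /drop_at ?eqxx // jk vj.
have hq1 : gen var J (mono q1).
  by apply/Sm/gJ; rewrite /q1 /drop_at ?eqxx // jk mj mulr0.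
have hq2 : gen var J (mono q2).
  by apply/Sm/gJ; rewrite /q2 /drop_at ?eqxx // jk mj mulr0.
have hq2V : gen var J (mono q2)^-1.
  by rewrite -monoN; apply/Sm/gJ; rewrite /q2 /drop_at ?eqxx ?oppr0 // jk mj mulr0.
have hn1V : gen var J (mono n1)^-1.
  by rewrite -monoN; apply/Sm/gJ; rewrite /n1 ?uk ?uj ?pospart_natN.
have ePk : expol u = mono n1 + mono n2 * xj ^+ b.
  rewrite /expol addrC; congr (_ + _); rewrite (mono_split _ j) /= uj pospart_nat //.
have ePj : expol v = mono a + mono c * xk ^+ b.
  by rewrite /expol; congr (_ + _); rewrite (mono_split _ k) /= vk opprK pospart_nat.
have eQ : Q = mono q1 * yk ^+ b + mono q2.
  have mk : mutcol k u v k = b%:Z by rewrite /mutcol eqxx vk opprK.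
  by rewrite /Q /mutpol !xprod_upd mk pospart_nat pospart_natN expr0z mulr1.
pose c1 : F := mono c * mono n1 ^+ b * (mono q2)^-1.
have hc1 : gen var J c1 by apply: (srM hS) => //; apply: (srM hS) => //; apply: srX.
(* Up to a monomial, the mutated exchange polynomial Q is yk^b Pj with Pk
   replaced by its value at xj = 0. *)
have key : mono a * yk ^+ b + mono c * mono n1 ^+ b = c1 * Q.
  have e1 : mono c * mono n1 ^+ b * mono q1 = mono a * mono q2 :> F.
    have -> : mono n1 ^+ b = mono (fun l => n1 l * b%:Z) :> F by rewrite -monoXz.
    rewrite -!monoD; apply: eq_mono => l.
    rewrite /c /n1 /q1 /q2 /a /drop_at /mutcol; case: eqP => [->|_].
      by rewrite uk vk pospart_natN oppr0 p0 mul0r.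
    rewrite vk opprK pospart_natN pospart_nat; rewrite /pospart; lia.
  rewrite eQ mulrDr; congr (_ + _); last by rewrite /c1 mulfVK ?mono_neq0.
  rewrite /c1 mulrA; congr (_ * _); apply: (mulIf (mono_neq0 _ q2)).
  by rewrite mulrAC mulfVK ?mono_neq0.
have Sfree z : gen var J z -> frac_in (others k) z.
  by move=> h; apply: gen_frac_in; apply: gen_mono h => // l /andP [].
have tyk : transc (frac_in (others k)) yk.
  have Tu : frac_in (others k) (expol u : F).
    by apply/gen_frac_in/expol_gen => l; rewrite /others; case: eqP => [->|_]; [right|left].
  have tvk : transc (frac_in (others k)) xk by apply: var_transc; rewrite /others eqxx.
  exact: (transc_div (frac_in_subring _) Tu (P0 u) tvk).
have tE : transc (laur (gen var J) yk) xj.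
  apply: (transc_swap hS (frac_in_subring (others k)) Sfree _ tyk).
    by apply: frac_in_var; rewrite /others eq_sym.
  exact: (transc_mono STj tj).
have tR : transc (laur (gen var J) xk) xj.
  apply: (transc_mono _ tj); apply: (laur_min xk0 (frac_in_subring _) STj Tj_xk).
  exact: frac_in_inv.
have hE : subring (laur (gen var J) yk) := laur_subring yk hS.
have EQ : laur (gen var J) yk Q.
  rewrite eQ; apply: (srD hE); last exact: laur_S.
  by apply: (srM hE); [apply: laur_S | apply: (srX hE); apply: laur_x].
have Q0 : Q != 0.
  apply/eqP => Q0; move: key; rewrite Q0 mulr0 => /eqP; rewrite addr_eq0 => /eqP e.
  have Ts : gen var J (- (mono c * mono n1 ^+ b)).
    by apply: (srN hS); apply: (srM hS) => //; apply: srX.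
  have [b00] := @transc_powz _ _ yk b%:Z (mono a) _ hS (transc_mono Sfree tyk) ha Ts (mono_neq0 _ _) e.
  by rewrite b00 in b0.
have Pk0 : mono n1 + mono n2 * xj ^+ b != 0 by rewrite -ePk; apply: P0.
have Pj0 : mono a + mono c * xk ^+ b != 0 by rewrite -ePj; apply: P0.
apply: (exchange_expansions h1 h2 h3 (mulf_neq0 Q0 (invr_neq0 xj0))) => L0 Lk Lj.
have := @exchange_linked _ (gen var J) xk xj b (mono n1) (mono n2) (mono a) (mono c) Q c1 f.
rewrite /= -ePk -ePj => H.
exact: (H hS hn1 hn2 ha hc hc1 (mono_neq0 _ _) hn1V b0 (P0 u) (P0 v) xk0 Q0 EQ key tR tE L0 Lk Lj).
Qed.

End Two.

(** The heart of the Laurent phenomenon: what is Laurent in a cluster and in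
    its neighbours in directions k and j is still so two mutations away,
    whether or not k and j are linked. *)
Theorem exchange_step k j u v f : k != j -> u k = 0 -> v j = 0 -> v k = - u j ->
  (forall a b : int, (forall l, a * u l + b * v l = 0) -> a = 0 /\ b = 0) ->
  gen var predT f -> gen (upd var k (expol u / var k)) predT f ->
  gen (upd var j (expol v / var j)) predT f ->
  gen (upd (upd var k (expol u / var k)) j
        (mutpol k u v (expol u / var k) / var j)) predT f.
Proof.
move=> kj uk vj vk ind h1 h2 h3.
case: (ltrgtP (u j) 0) => uj.
- have [b eb] : exists b : nat, u j = - b%:Z by exists `|u j|%N; lia.
  rewrite -(mutpolN k u v) -(expolN _ u); rewrite -(expolN _ u) in h2.
  rewrite -(expolN _ v) in h3.
  apply: (@exchange_pos k j (fun l => - u l) (fun l => - v l) kj _ _ b) h1 h2 h3; lia.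
- have [b eb] : exists b : nat, u j = b%:Z by exists `|u j|%N; lia.
  apply: (@exchange_pos k j u v kj uk vj b) h1 h2 h3; lia.
- by apply: (exchange_zero kj uk vj uj _ ind h1 h2 h3); rewrite vk uj oppr0.
Qed.

End Step.

(** * Substitution of a variable and mutation of matrices *)

Section Substitution.
Variables (K : fieldType) (N : nat) (k : 'I_N).
Notation F := {fraction {mpoly K[N]}}.
Notation var := (@var K N).
Variable y : F.
Hypothesis ty : transc (frac_in (others k)) y.

Definition subst_poly : {mpoly K[N]} -> F := mmap (@cst K N) (upd var k y).
HB.instance Definition _ := GRing.RMorphism.copy subst_poly (mmap (@cst K N) (upd var k y)).

(** The substitution of y for the variable k is made in two stages, through
    univariate polynomials, because transcendence of y is a statement about
    these. *)
Definition unival : {mpoly K[N]} -> {poly F} :=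
  mmap (polyC \o @cst K N) (fun i => if i == k then 'X else (var i)%:P).
HB.instance Definition _ := GRing.RMorphism.copy unival
  (mmap (polyC \o @cst K N) (fun i => if i == k then 'X else (var i)%:P)).

Let univalX i : unival 'X_i = if i == k then 'X else (var i)%:P.
Proof. by rewrite /unival mmapX mmap1U. Qed.
Let univalC c : unival c%:MP = (cst N c)%:P.
Proof. by rewrite /unival mmapC. Qed.

Let unival_in p : coefs_in (frac_in (others k)) (unival p).
Proof.
have hS := frac_in_subring (K := K) (others k).
elim/mpolyind: p => [|c m p _ _ IH]; first by rewrite rmorph0; apply: (coefs_in0 hS).
rewrite -mul_mpolyC rmorphD rmorphM; apply: (coefs_inD hS); last exact: IH.
apply: (coefs_inM hS).
  rewrite [X in coefs_in _ X]univalC; apply: (coefs_inC hS); exact: frac_in_cst.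
rewrite mpolyXE_id rmorph_prod /=.
elim/big_ind: _ => [|p1 p2|i _]; first exact: (coefs_inC hS (sr1 hS)).
  exact: (coefs_inM hS).
rewrite rmorphXn; apply: (coefs_inE hS); rewrite [X in coefs_in _ X]univalX.
case: eqP => [_|/eqP ik]; first exact: (coefs_inX hS).
by apply: (coefs_inC hS); apply: frac_in_var.
Qed.

Let unival_eval (z : F) : horner_eval z \o unival =1 mmap (@cst K N) (upd var k z).
Proof.
apply: mpoly_hom_ext => [c|i]; rewrite /= /horner_eval.
  by rewrite univalC hornerC mmapC.
by rewrite univalX mmapX mmap1U /upd; case: eqP; rewrite ?hornerX ?hornerC.
Qed.

Lemma subst_inj p : subst_poly p = 0 -> p = 0.
Proof.
rewrite -[subst_poly p](unival_eval y p) /= /horner_eval => /(ty (unival_in p)) e.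
have /esym := unival_eval (var k) p; rewrite /= /horner_eval e horner0.
have -> : mmap (@cst K N) (upd var k (var k)) p = tofrac p.
  rewrite -mmap_var /mmap; apply: eq_bigr => m _; congr (_ * _).
  by apply: mmap1_eq => i; rewrite /upd; case: eqP => [->|].
by move/eqP; rewrite tofrac_eq0 => /eqP.
Qed.

Definition subst : F -> F := frac_lift subst_inj.
HB.instance Definition _ := GRing.RMorphism.copy subst (frac_lift subst_inj).

Lemma subst_cst c : subst (cst N c) = cst N c.
Proof. by rewrite /subst frac_lift_tofrac /= /subst_poly mmapC. Qed.

Lemma subst_var i : subst (var i) = upd var k y i.
Proof. by rewrite /subst frac_lift_tofrac /= /subst_poly mmapX mmap1U. Qed.

End Substitution.

Lemma gen_map (K : fieldType) N (phi : {rmorphism {fraction {mpoly K[N]}} -> {fraction {mpoly K[N]}}})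
    (g g' : 'I_N -> {fraction {mpoly K[N]}}) (J : pred 'I_N) f :
  (forall c, phi (cst N c) = cst N c) -> (forall i, phi (g i) = g' i) ->
  gen g J f -> gen g' J (phi f).
Proof.
move=> hc hg.
have hS : subring (fun z => gen g' J (phi z)).
  have h := gen_subring g' J; split.
  - by rewrite rmorph1; apply: (sr1 h).
  - by move=> x y hx hy; rewrite rmorphB; apply: (srB h).
  - by move=> x y hx hy; rewrite rmorphM; apply: (srM h).
apply: (gen_min hS) => [c|i Ji|i Ji].
- by rewrite hc; apply: gen_cst.
- by rewrite hg; apply: gen_g.
- by rewrite fmorphV hg; apply: gen_gV.
Qed.

Section Mutation.
Variables (m f : nat).
Implicit Types (B : exchange_mx m f) (k j : 'I_m).

Definition skew_principal B := forall i j, B (lshift f i) j = - B (lshift f j) i.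
Definition indep_cols B := forall c : 'I_m -> int,
  (forall l, \sum_j B l j * c j = 0) -> forall j, c j = 0.

Lemma skew_diag B k : skew_principal B -> B (lshift f k) k = 0.
Proof. by move=> /(_ k k) h; lia. Qed.

Lemma mutate_mx_skew B k : skew_principal B -> skew_principal (mutate_mx k B).
Proof.
move=> hB i j; rewrite !mxE !(inj_eq (@lshift_inj _ _)).
have h1 := hB i j; have h2 := hB i k; have h3 := hB j k.
case: (eqVneq i k) => [ei|_]; case: (eqVneq j k) => [ej|_] //=.
- by rewrite h1.
- by rewrite h1.
- by rewrite h1.
rewrite h1 h2 h3 !opprK; ring.
Qed.

Lemma mutate_mxK B k : skew_principal B -> mutate_mx k (mutate_mx k B) = B.
Proof.
move=> hB; apply/matrixP => i j; rewrite !mxE !eqxx /= !orbT.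
case: (eqVneq i (lshift f k)) => [ei|_]; case: (eqVneq j k) => [ej|_] //=; rewrite ?opprK //.
by ring.
Qed.

(** A relation between the mutated columns is one between the original columns,
    with another coefficient at k only. *)
Lemma mutate_mx_indep B k : skew_principal B -> indep_cols B -> indep_cols (mutate_mx k B).
Proof.
move=> hB ind c hc.
have Bkk := skew_diag k hB.
pose c' j := if j == k then - c k + \sum_(i | i != k) pospart (B (lshift f k) i) * c i else c j.
have hk : \sum_(j | j != k) B (lshift f k) j * c j = 0.
  have := hc (lshift f k); rewrite (bigD1 k) //= !mxE eqxx /= Bkk oppr0 mul0r add0r.
  move=> h; apply/eqP; rewrite -oppr_eq0 -sumrN -[X in _ == X]h; apply/eqP; apply: eq_bigr => j _.
  by rewrite mxE eqxx mulNr.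
have hc' l : \sum_j B l j * c' j = 0.
  have e : \sum_(j | j != k) B l j * c' j = \sum_(j | j != k) B l j * c j.
    by apply: eq_bigr => j /negbTE jk; rewrite /c' jk.
  rewrite (bigD1 k) //= e {e} /c' eqxx.
  case: (eqVneq l (lshift f k)) => [->|lk]; first by rewrite Bkk mul0r add0r hk.
  have := hc l; rewrite (bigD1 k) //= mxE (negbTE lk) eqxx /=.
  under eq_bigr => j jk do rewrite mxE (negbTE lk) (negbTE jk) /=.
  rewrite (eq_bigr (fun j => B l j * c j + B l k * (pospart (B (lshift f k) j) * c j)
     + pospart (- B l k) * (B (lshift f k) j * c j))); last first.
    move=> j jk; rewrite (pospart_split (B l k)) (pospart_split (B (lshift f k) j)); ring.
  rewrite !big_split /= -!mulr_sumr hk mulr0 addr0 => h; rewrite -[RHS]h; ring.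
move=> j; case: (eqVneq j k) => [->|jk]; last first.
  by have := ind c' hc' j; rewrite /c' (negbTE jk).
have := ind c' hc' k; rewrite /c' eqxx big1 ?addr0; first by move=> h; lia.
by move=> i ik; have := ind c' hc' i; rewrite /c' (negbTE ik) => ->; rewrite mulr0.
Qed.

Lemma indep_cols2 B k j : k != j -> indep_cols B ->
  forall a b : int, (forall l, a * B l k + b * B l j = 0) -> a = 0 /\ b = 0.
Proof.
move=> kj ind a b h.
have H := ind (fun i => if i == k then a else if i == j then b else 0).
have jk : (j == k) = false by rewrite eq_sym (negbTE kj).
split.
  rewrite -[RHS](H _ k) ?eqxx // => l.
  rewrite (bigD1 k) //= eqxx (bigD1 j) /= ?jk // eqxx big1 ?addr0.
    by rewrite -[RHS](h l); ring.
  by move=> i /andP [/negbTE -> /negbTE ->]; rewrite mulr0.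
rewrite -[RHS](H _ j) ?jk ?eqxx // => l.
rewrite (bigD1 k) //= eqxx (bigD1 j) /= ?jk // eqxx big1 ?addr0.
  by rewrite -[RHS](h l); ring.
by move=> i /andP [/negbTE -> /negbTE ->]; rewrite mulr0.
Qed.

End Mutation.

(** * Upper bounds *)

Section Seeds.
Variables (K : fieldType) (m f : nat).
Hypothesis char2 : (2%:R : K) != 0.
Notation F := (ambient K m f).
Notation var := (@var K (m + f)).
Notation lk k := (lshift f k).
Implicit Types (B : exchange_mx m f) (k j : 'I_m) (S : seed K m f).

Definition col_fun B k : 'I_(m + f) -> int := fun l => B l k.
Definition exch B k : F := expol (col_fun B k) / var (lk k).

Lemma initial_var B i : cvar (initial_seed K B) i = var i.
Proof. by rewrite ffunE. Qed.

Lemma mutate_initial B k i :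
  cvar (mutate (initial_seed K B) k) i = upd var (lk k) (exch B k) i.
Proof.
have e (s : 'I_(m + f) -> int) : \prod_l cvar (initial_seed K B) l ^ s l = mono s :> F.
  by apply: eq_bigr => l _; rewrite initial_var.
rewrite ffunE /upd; case: eqP => [->|_]; last by rewrite initial_var.
by rewrite /= 2!e initial_var.
Qed.

Lemma expol_col_neq0 B k : expol (col_fun B k) != 0 :> F.
Proof. exact: expol_neq0. Qed.

Lemma expol_col_gen B k : skew_principal B -> gen var (others (lk k)) (expol (col_fun B k)).
Proof.
move=> hB; apply: expol_gen => l; rewrite /others.
by case: eqP => [->|_]; [right; apply: skew_diag | left].
Qed.

Lemma exch_transc B k : skew_principal B -> transc (frac_in (others (lk k))) (exch B k).
Proof.
move=> hB.
have h : transc (frac_in (others (lk k))) (var (lk k)).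
  by apply: var_transc; rewrite /others eqxx.
exact: (transc_div (frac_in_subring _) (gen_frac_in (expol_col_gen k hB)) (expol_col_neq0 B k) h).
Qed.

(** Carries the initial cluster of the mutated matrix to the cluster obtained
    from B by mutation at k. Every seed thereby becomes an initial one. *)
Definition theta B k (hB : skew_principal B) : {rmorphism F -> F} := subst (@exch_transc B k hB).

Lemma theta_cst B k (hB : skew_principal B) c : theta k hB (cst _ c) = cst _ c.
Proof. exact: subst_cst. Qed.

Lemma theta_initial B B' k (hB : skew_principal B) i :
  theta k hB (cvar (initial_seed K B') i) = cvar (mutate (initial_seed K B) k) i.
Proof. by rewrite initial_var mutate_initial; apply: subst_var. Qed.

Lemma mutate_map (phi : {rmorphism F -> F}) S S' k : emx S = emx S' ->
  (forall i, phi (cvar S i) = cvar S' i) ->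
  forall i, phi (cvar (mutate S k) i) = cvar (mutate S' k) i.
Proof.
move=> e h i; rewrite !ffunE; case: eqP => // _.
rewrite fmorph_div h rmorphD !rmorph_prod e; congr ((_ + _) / _);
  by apply: eq_bigr => l _; rewrite fmorphXz h.
Qed.

Lemma mutations_map (phi : {rmorphism F -> F}) ks S S' : emx S = emx S' ->
  (forall i, phi (cvar S i) = cvar S' i) ->
  forall i, phi (cvar (foldl (@mutate K m f) S ks) i) = cvar (foldl (@mutate K m f) S' ks) i.
Proof.
elim: ks S S' => [//|k ks IH] S S' e h i /=.
by apply: IH; [rewrite /= e | apply: mutate_map].
Qed.

Lemma theta_mutations B k (hB : skew_principal B) ks i :
  theta k hB (cvar (foldl (@mutate K m f) (initial_seed K (mutate_mx k B)) ks) i) =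
  cvar (foldl (@mutate K m f) (initial_seed K B) (k :: ks)) i.
Proof. by apply: mutations_map => // l; apply: theta_initial. Qed.

Lemma cvar_neq0 B ks i : skew_principal B ->
  cvar (foldl (@mutate K m f) (initial_seed K B) ks) i != 0.
Proof.
elim: ks B => [|k ks IH] B hB; first by rewrite [foldl _ _ _]/(initial_seed K B) initial_var; exact: (var_neq0 K i).
by rewrite -(theta_mutations k hB) fmorph_eq0; apply: IH; apply: mutate_mx_skew.
Qed.

Lemma mutate2 B k i : skew_principal B ->
  cvar (mutate (mutate (initial_seed K B) k) k) i = var i.
Proof.
move=> hB; have Bkk := skew_diag k hB.
rewrite ffunE; case: eqP => [->|/eqP ik]; last first.
  by rewrite mutate_initial /upd (negbTE ik).
have e (s : int -> int) : (s 0 = 0) ->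
   \prod_l cvar (mutate (initial_seed K B) k) l ^ s (B l k) = \prod_l var l ^ s (B l k).
  move=> s0; apply: eq_bigr => l _; rewrite mutate_initial /upd; case: eqP => // ->.
  by rewrite Bkk s0 !expr0z.
rewrite mutate_initial /upd eqxx /=.
have -> : \prod_l cvar (mutate (initial_seed K B) k) l ^ pospart (mutate_mx k B l k)
   + \prod_l cvar (mutate (initial_seed K B) k) l ^ pospart (- mutate_mx k B l k)
   = expol (col_fun B k).
  rewrite addrC; congr (_ + _).
    rewrite -[RHS](e pospart) //; apply: eq_bigr => l _; congr (_ ^ pospart _).
    by rewrite mxE eqxx orbT opprK.
  rewrite -[RHS](e (fun z => pospart (- z))) //; apply: eq_bigr => l _; congr (_ ^ pospart _).
  by rewrite mxE eqxx orbT.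
rewrite /exch invfM invrK mulrA divff ?mul1r //; exact: expol_col_neq0.
Qed.

(** The upper bound of Berenstein, Fomin and Zelevinsky. *)
Definition upper B (z : F) :=
  gen var predT z /\ forall k, gen (cvar (mutate (initial_seed K B) k)) predT z.

Lemma upper_subring B : subring (upper B).
Proof.
have h1 := gen_subring var predT.
have h2 k := gen_subring (cvar (mutate (initial_seed K B) k)) predT.
split.
- by split=> [|k]; [apply: (sr1 h1) | apply: (sr1 (h2 k))].
- by move=> x y [x1 x2] [y1 y2]; split=> [|k]; [apply: (srB h1) | apply: (srB (h2 k))].
- by move=> x y [x1 x2] [y1 y2]; split=> [|k]; [apply: (srM h1) | apply: (srM (h2 k))].
Qed.

(** In the direction k mutation is an involution and the two clusters are
    interchanged; in a direction j other than k this is exchange_step for the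
    mutated matrix. *)
Lemma upper_invariant B k (hB : skew_principal B) z : indep_cols B ->
  upper (mutate_mx k B) z -> upper B (theta k hB z).
Proof.
move=> ind [z0 zz]; have hB' := mutate_mx_skew k hB.
have ind' := @mutate_mx_indep _ _ B k hB ind.
set B' := mutate_mx k B in ind' z0 zz hB'.
have th := theta_cst k hB.
have thv i : theta k hB (var i) = cvar (mutate (initial_seed K B) k) i.
  by rewrite -(theta_initial B' k hB) initial_var.
split=> [|j].
  apply: gen_map th _ (zz k) => i; rewrite -[RHS](mutate2 k _ hB).
  exact: (theta_mutations k hB [:: k]).
case: (eqVneq j k) => [->|jk]; first exact: gen_map th thv z0.
have lkj : lk k != lk j by rewrite (inj_eq (@lshift_inj _ _)) eq_sym.
(* In the coordinates of the mutated matrix, the cluster of B adjacent in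
   direction j is two mutations away. *)
have hst : gen (cvar (mutate (mutate (initial_seed K B') k) j)) predT z.
  have ext k' : gen (cvar (mutate (initial_seed K B') k')) predT z ->
      gen (upd var (lk k') (exch B' k')) predT z.
    by apply: gen_mono => // i _; rewrite mutate_initial.
  have := @exchange_step K (m + f) char2 (lk k) (lk j) (col_fun B' k) (col_fun B' j) z lkj
    (skew_diag k hB') (skew_diag j hB') (hB' k j) (indep_cols2 _ ind') z0
    (ext _ (zz k)) (ext _ (zz j)).
  rewrite eq_sym in jk => /(_ jk).
  apply: gen_mono => // i _; rewrite ffunE /upd.
  case: eqP => [->|_]; last by rewrite mutate_initial.
  rewrite mutate_initial /upd [lk j == lk k]eq_sym (negbTE lkj); congr (_ / _).
  have em l : mutcol (lk k) (col_fun B' k) (col_fun B' j) l = mutate_mx k B' l j.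
    by rewrite mxE [j == k]eq_sym (negbTE jk) orbF.
  rewrite /mutpol /xprod; congr (_ + _); apply: eq_bigr => l _;
    by rewrite mutate_initial em.
apply: gen_map th _ hst => i.
rewrite (theta_mutations k hB [:: k; j]) /=.
rewrite -[RHS](mutate_map (phi := idfun) (S := mutate (mutate (initial_seed K B) k) k)) //=.
- by rewrite mutate_mxK.
- by move=> l; rewrite mutate2 // initial_var.
Qed.

Lemma upper_var B i : skew_principal B -> upper B (var i).
Proof.
move=> hB; split=> [|k]; first exact: gen_g.
set g := cvar _.
case: (eqVneq i (lk k)) => [->|ik]; last first.
  by rewrite (_ : var i = g i) /g; [apply: gen_g | rewrite mutate_initial /upd (negbTE ik)].
have hg := gen_subring g predT.
have -> : var (lk k) = expol (col_fun B k) * (g (lk k))^-1.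
  rewrite /g mutate_initial /upd eqxx /exch invf_div mulrCA divff ?mulr1 //.
  exact: expol_col_neq0.
apply: (srM hg); last exact: gen_gV.
apply: gen_mono (expol_col_gen k hB) => // l; rewrite /others /g mutate_initial /upd.
by move/negbTE ->.
Qed.

(** Induction on the sequence of mutations, the first of which moves the base
    point of the upper bound. *)
Lemma laurent_indep ks B i : skew_principal B -> indep_cols B ->
  upper B (cvar (foldl (@mutate K m f) (initial_seed K B) ks) i).
Proof.
elim: ks B => [|k ks IH] B hB ind; first by rewrite [foldl _ _ _]/(initial_seed K B) initial_var; exact: (@upper_var B i hB).
rewrite -(theta_mutations k hB); apply: upper_invariant => //; apply: IH.
  exact: mutate_mx_skew.
exact: mutate_mx_indep.
Qed.

End Seeds.

(** * Principal coefficients and the Laurent phenomenon *)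

Section PartialHom.
Variables (D D' : idomainType) (phi : {rmorphism D -> D'}).

(** The extension of phi to the fractions whose denominator it does not kill, a
    relation because it is partial. *)
Definition spec (a : {fraction D}) (b : {fraction D'}) :=
  exists p q, [/\ phi q != 0, a * tofrac q = tofrac p & b * tofrac (phi q) = tofrac (phi p)].

Lemma spec_tofrac p : spec (tofrac p) (tofrac (phi p)).
Proof. by exists p, 1; rewrite rmorph1 oner_neq0 !tofrac1 !mulr1. Qed.

Lemma spec_tofracE p b : b = tofrac (phi p) -> spec (tofrac p) b.
Proof. by move=> ->; apply: spec_tofrac. Qed.

Lemma spec1 : spec 1 1.
Proof. by rewrite -{1}tofrac1; apply: spec_tofracE; rewrite rmorph1 tofrac1. Qed.

Lemma spec_fun a b b' : spec a b -> spec a b' -> b = b'.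
Proof.
move=> [p [q [q0 ea eb]]] [p' [q' [q0' ea' eb']]].
have h : tofrac p * tofrac q' = tofrac p' * tofrac q.
  by rewrite -ea -ea' mulrAC.
have h' : tofrac (phi p) * tofrac (phi q') = tofrac (phi p') * tofrac (phi q).
  move: h; rewrite -!tofracM => /eqP; rewrite tofrac_eq => /eqP h.
  by rewrite -!rmorphM h.
apply: (mulIf (x := tofrac (phi q))); first by rewrite tofrac_eq0.
apply: (mulIf (x := tofrac (phi q'))); first by rewrite tofrac_eq0.
by rewrite eb h' -eb' mulrAC.
Qed.

Lemma specB a b a' b' : spec a b -> spec a' b' -> spec (a - a') (b - b').
Proof.
move=> [p [q [q0 ea eb]]] [p' [q' [q0' ea' eb']]].
exists (p * q' - p' * q), (q * q'); split.
- by rewrite rmorphM mulf_neq0.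
- by rewrite tofracB 3!tofracM -ea -ea' mulrBl !mulrA [a' * tofrac q * _]mulrAC.
- rewrite (rmorphB phi) 3!(rmorphM phi) tofracB 3!tofracM -eb -eb' mulrBl !mulrA.
  by rewrite [b' * tofrac _ * _]mulrAC.
Qed.

Lemma specM a b a' b' : spec a b -> spec a' b' -> spec (a * a') (b * b').
Proof.
move=> [p [q [q0 ea eb]]] [p' [q' [q0' ea' eb']]].
exists (p * p'), (q * q'); split.
- by rewrite rmorphM mulf_neq0.
- by rewrite 2!tofracM -ea -ea' mulrACA.
- by rewrite 2!(rmorphM phi) 2!tofracM -eb -eb' mulrACA.
Qed.

Lemma spec0 : spec 0 0.
Proof. by have := specB spec1 spec1; rewrite !subrr. Qed.

Lemma specD a b a' b' : spec a b -> spec a' b' -> spec (a + a') (b + b').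
Proof.
move=> h h'; have := specB h (specB spec0 h').
by rewrite !sub0r !opprK.
Qed.

Lemma specV a b : b != 0 -> spec a b -> spec a^-1 b^-1.
Proof.
move=> b0 [p [q [q0 ea eb]]].
have p0 : phi p != 0.
  by rewrite -(tofrac_eq0 (phi p)) -eb mulf_neq0 // tofrac_eq0.
have p0' : tofrac p != 0 by rewrite tofrac_eq0; apply: contraNneq p0 => ->; rewrite rmorph0.
have a0 : a != 0.
  by apply: contraNneq p0' => a0; rewrite -ea a0 mul0r.
exists q, p; split=> //.
- by rewrite -ea mulrA mulVf // mul1r.
- by rewrite -eb mulrA mulVf // mul1r.
Qed.

Lemma spec_div a b a' b' : b' != 0 -> spec a b -> spec a' b' -> spec (a / a') (b / b').
Proof. by move=> b0 h h'; apply: specM => //; apply: specV. Qed.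

Lemma spec_pos a b (z : int) : spec a b -> spec (a ^ pospart z) (b ^ pospart z).
Proof.
move=> h; have -> : pospart z = `|pospart z|%N%:Z by rewrite /pospart; lia.
elim: `|_|%N => [|n IH]; first by rewrite !expr0z; apply: spec1.
by rewrite -!exprnP !exprS; apply: specM.
Qed.

Lemma spec_prod (I : Type) (r : seq I) (P : pred I) a b :
  (forall i, P i -> spec (a i) (b i)) -> spec (\prod_(i <- r | P i) a i) (\prod_(i <- r | P i) b i).
Proof. by move=> h; elim/big_rec2: _ => [|i x y Pi IH]; [apply: spec1 | apply: specM; [apply: h|]]. Qed.

Lemma spec_prod1 (I : Type) (r : seq I) (P : pred I) a :
  (forall i, P i -> spec (a i) 1) -> spec (\prod_(i <- r | P i) a i) 1.
Proof. by move=> h; have := spec_prod (b := fun=> 1) r h; rewrite big1_eq. Qed.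

End PartialHom.

Definition msubst (K : fieldType) (N N' : nat) (h : 'I_N' -> {mpoly K[N]}) :
  {mpoly K[N']} -> {mpoly K[N]} := mmap (@mpolyC N K) h.
HB.instance Definition _ K N N' h :=
  GRing.RMorphism.copy (@msubst K N N' h) (mmap (@mpolyC N K) h).

Section PrincipalCoefficients.
Variables (K : fieldType) (m f : nat).
Hypothesis char2 : (2%:R : K) != 0.
Implicit Types (B : exchange_mx m f) (k j : 'I_m).

(** One more frozen variable for each mutable one. The identity block makes the
    columns independent. *)
Definition principal B : exchange_mx m (f + m) := col_mx (usubmx B) (col_mx (dsubmx B) 1%:M).

Definition old (i : 'I_(m + f)) : 'I_(m + (f + m)) :=
  match split i with inl j => lshift (f + m) j | inr j => rshift m (lshift m j) end.
Definition new (i : 'I_m) : 'I_(m + (f + m)) := rshift m (rshift f i).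

Definition extends (B' : exchange_mx m (f + m)) B := forall i j, B' (old i) j = B i j.

Lemma old_l k : old (lshift f k) = lshift (f + m) k.
Proof. by rewrite /old (unsplitK (inl _)). Qed.
Lemma old_r (j : 'I_f) : old (rshift m j) = rshift m (lshift m j).
Proof. by rewrite /old (unsplitK (inr _)). Qed.

Lemma old_eq_l i k : (old i == lshift (f + m) k) = (i == lshift f k).
Proof.
rewrite -(splitK i); case: (split i) => j /=.
  by rewrite old_l !(inj_eq (@lshift_inj _ _)).
by rewrite old_r !eq_rlshift.
Qed.

Lemma principal_extends B : extends (principal B) B.
Proof.
move=> i j; rewrite -(splitK i); case: (split i) => l /=.
  by rewrite old_l col_mxEu mxE.
by rewrite old_r col_mxEd col_mxEu mxE.
Qed.

Lemma principal_skew B : skew_principal B -> skew_principal (principal B).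
Proof. by move=> hB i j; rewrite -!old_l !principal_extends. Qed.

Lemma principal_indep B : indep_cols (principal B).
Proof.
move=> c hc j; have := hc (new j); rewrite (bigD1 j) //= big1 ?addr0; last first.
  by move=> i ij; rewrite !col_mxEd mxE eq_sym (negbTE ij) mul0r.
by rewrite !col_mxEd mxE eqxx mul1r.
Qed.

Lemma mutate_extends (B' : exchange_mx m (f + m)) B k : extends B' B -> extends (mutate_mx k B') (mutate_mx k B).
Proof. by move=> h i j; rewrite !mxE old_eq_l -!old_l !h. Qed.

(** The additional variables specialise to 1. *)
Definition forget_var (i : 'I_(m + (f + m))) : {mpoly K[m + f]} :=
  match split i with
  | inl j => 'X_(lshift f j)
  | inr j => match split j with inl l => 'X_(rshift m l) | inr _ => 1 end
  end.
Definition forget : {mpoly K[m + (f + m)]} -> {mpoly K[m + f]} :=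
  msubst forget_var.
HB.instance Definition _ := GRing.RMorphism.copy forget (msubst forget_var).

Lemma forget_cst c : forget c%:MP = c%:MP.
Proof. by rewrite /forget /msubst mmapC. Qed.
Lemma forget_old i : forget 'X_(old i) = 'X_i.
Proof.
rewrite /forget /msubst mmapX mmap1U /forget_var -[in RHS](splitK i).
rewrite -{1}(splitK i); case: (split i) => j /=.
  by rewrite old_l (unsplitK (inl _)).
by rewrite old_r (unsplitK (inr _)) (unsplitK (inl _)).
Qed.
Lemma forget_new i : forget 'X_(new i) = 1.
Proof. by rewrite /forget /msubst mmapX mmap1U /forget_var /new (unsplitK (inr _)) (unsplitK (inr _)). Qed.

Definition spec_seed (S' : seed K m (f + m)) (S : seed K m f) :=
  [/\ extends (emx S') (emx S), forall i, spec forget (cvar S' (old i)) (cvar S i) &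
      forall i, spec forget (cvar S' (new i)) 1].

Lemma spec_initial B : spec_seed (initial_seed K (principal B)) (initial_seed K B).
Proof.
split=> [|i|i]; first exact: principal_extends.
  by rewrite !ffunE; apply: spec_tofracE; rewrite /= forget_old.
by rewrite ffunE; apply: spec_tofracE; rewrite /= forget_new tofrac1.
Qed.

Lemma spec_pos1 (a : ambient K m (f + m)) (z : int) : spec forget a 1 -> spec forget (a ^ pospart z) 1.
Proof. by move/(spec_pos z); rewrite exp1rz. Qed.

Lemma spec_monomial S' S k (s : int -> int) : spec_seed S' S ->
  spec forget (\prod_l cvar S' l ^ pospart (s (emx S' l k)))
              (\prod_l cvar S l ^ pospart (s (emx S l k))).
Proof.
move=> [e ho hn]; rewrite !big_split_ord /=.
rewrite -[X in spec _ _ (_ * X)]mulr1.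
apply: specM; last apply: specM.
- by apply: spec_prod => i _; rewrite -old_l e; apply/spec_pos/ho.
- by apply: spec_prod => i _; rewrite -old_r e; apply/spec_pos/ho.
- by apply: spec_prod1 => i _; apply/spec_pos1/hn.
Qed.

Lemma spec_mutate S' S k : cvar S (lshift f k) != 0 -> spec_seed S' S ->
  spec_seed (mutate S' k) (mutate S k).
Proof.
move=> x0 h; have [e ho hn] := h; split=> [|i|i].
- exact: mutate_extends.
- rewrite !ffunE old_eq_l; case: eqP => [->|_]; last exact: ho.
  apply: spec_div.
  + exact: x0.
  + by apply: specD; [apply: (spec_monomial k id h) | apply: (spec_monomial k -%R h)].
  + exact: ho.
- rewrite ffunE; have -> : (new i == lshift (f + m) k) = false by rewrite /new eq_rlshift.
  exact: hn.
Qed.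

Lemma spec_mutations ks B : skew_principal B ->
  spec_seed (foldl (@mutate K m (f + m)) (initial_seed K (principal B)) ks)
            (foldl (@mutate K m f) (initial_seed K B) ks).
Proof.
move=> hB; elim/last_ind: ks => [|ks k IH]; first exact: spec_initial.
by rewrite !foldl_rcons; apply: spec_mutate => //; apply: cvar_neq0.
Qed.

(** A Laurent expansion specialises term by term since no cluster variable
    specialises to 0. *)
Lemma spec_gen S' S z : (forall i, cvar S i != 0) -> spec_seed S' S ->
  gen (cvar S') predT z -> exists2 y, gen (cvar S) predT y & spec forget z y.
Proof.
move=> S0 [_ ho hn].
have hg := gen_subring (cvar S) predT.
have cases i : (exists l, i = old l) \/ (exists l, i = new l).
  rewrite -(splitK i); case: (split i) => j /=.
    by left; exists (lshift f j); rewrite old_l.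
  rewrite -(splitK j); case: (split j) => l /=; last by right; exists l.
  by left; exists (rshift m l); rewrite old_r.
pose T z := exists2 y, gen (cvar S) predT y & spec forget z y.
apply: (gen_min (S := T)) => [|c|i _|i _].
- split.
  + by exists 1; [apply: (sr1 hg) | apply: spec1].
  + move=> x y [x' gx sx] [y' gy sy].
    by exists (x' - y'); [apply: (srB hg) | apply: specB].
  + move=> x y [x' gx sx] [y' gy sy].
    by exists (x' * y'); [apply: (srM hg) | apply: specM].
- exists (cst _ c); first exact: gen_cst.
  by apply: spec_tofracE; rewrite /= forget_cst.
- case: (cases i) => [[l ->]|[l ->]]; first by exists (cvar S l); [apply: gen_g | apply: ho].
  by exists 1; [apply: (sr1 hg) | apply: hn].
- case: (cases i) => [[l ->]|[l ->]].
    by exists (cvar S l)^-1; [apply: gen_gV | apply: specV].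
  exists 1; first exact: (sr1 hg).
  by rewrite -[X in spec _ _ X]invr1; apply: specV; rewrite ?oner_neq0.
Qed.

(** With principal coefficients the columns are independent; setting the
    additional variables to 1 then recovers the cluster variables of B together
    with their expansions. *)
Theorem laurent B ks i : skew_principal B ->
  upper B (cvar (foldl (@mutate K m f) (initial_seed K B) ks) i).
Proof.
move=> hB; have hB' := principal_skew hB.
have [_ h _] := spec_mutations ks hB.
have [l1 l2] := laurent_indep char2 ks (old i) hB' (@principal_indep B).
split=> [|k].
  have n0 l : cvar (initial_seed K B) l != 0 by exact: (cvar_neq0 char2 [::] l hB).
  have g0 : gen (cvar (initial_seed K (principal B))) predT
      (cvar (foldl (@mutate K m (f + m)) (initial_seed K (principal B)) ks) (old i)).
    by apply: gen_mono l1 => // l _; rewrite initial_var.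
  have [y gy sy] := spec_gen n0 (spec_initial B) g0.
  rewrite -(spec_fun sy (h i)); apply: gen_mono gy => // l _.
  by rewrite initial_var.
have n0 l : cvar (mutate (initial_seed K B) k) l != 0 by exact: (cvar_neq0 char2 [:: k] l hB).
have [y gy sy] := spec_gen n0 (spec_mutations [:: k] hB) (l2 k).
by rewrite -(spec_fun sy (h i)).
Qed.

Theorem cluster_algebra_upper B z : skew_principal B -> cluster_algebra B z -> @upper K m f B z.
Proof.
move=> hB; have hU := @upper_subring K m f B.
elim=> {z} [c|ks i|j|y z _ hy _ hz|y z _ hy _ hz].
- by split=> [|k]; apply: gen_cst.
- exact: laurent.
- rewrite initial_var; split=> [|k]; first exact: gen_gV.
  rewrite (_ : @var K _ (rshift m j) = cvar (mutate (initial_seed K B) k) (rshift m j)).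
    exact: gen_gV.
  by rewrite mutate_initial /upd eq_rlshift.
- exact: (srD hU).
- exact: (srM hU).
Qed.

End PrincipalCoefficients.

(** * Units of cluster algebras *)

Section LaurentUnits.
Variable F : fieldType.
Implicit Types (S R T : F -> Prop) (p q : {poly F}) (x y f : F).

(** The exponents 0 and a are distinct, so the left-hand side has two terms and
    the right-hand side at most one. *)
Lemma three_terms T x r s (a b : int) : subring T -> transc T x -> T r -> T s ->
  r != 0 -> a != 0 -> 1 + r * x ^ a = s * x ^ b -> False.
Proof.
move=> hT tx Tr Ts r0 a0 e; have x0 := transc_neq0 hT tx.
pose n := (`|a| + `|b|)%N.
have [na ena] : exists na : nat, na%:Z = n%:Z + a by exists (absz (n%:Z + a)); rewrite /n; lia.
have [nb enb] : exists nb : nat, nb%:Z = n%:Z + b by exists (absz (n%:Z + b)); rewrite /n; lia.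
have E : 'X^n + r *: 'X^na - s *: 'X^nb = 0.
  apply: tx.
    by apply: coefs_inB => //; first apply: coefs_inD => //; first exact: coefs_inXn;
       apply: coefs_inZ => //; apply: coefs_inXn.
  rewrite !(hornerD, hornerN, hornerZ, hornerXn) -[x ^+ na]/(x ^ na%:Z) -[x ^+ nb]/(x ^ nb%:Z).
  rewrite ena enb !expfzDr // mulrCA [s * _]mulrCA -e -[x ^+ n]/(x ^ n%:Z).
  by move: (x ^ n%:Z) (x ^ a) => u v; ring.
have c1 := congr1 (fun u : {poly F} => u`_n) E.
have c2 := congr1 (fun u : {poly F} => u`_na) E.
rewrite /= coefB coefD !coefZ !coefXn coef0 eqxx in c1.
rewrite /= coefB coefD !coefZ !coefXn coef0 eqxx in c2.
have nna : (n == na) = false by apply/negbTE; lia.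
rewrite nna mulr0 addr0 in c1; rewrite eq_sym nna add0r mulr1 in c2.
case: (eqVneq n nb) c1 c2 => [<-|_].
  by rewrite eq_sym nna mulr0 subr0 => _ /eqP; rewrite (negbTE r0).
by rewrite mulr0 subr0 => /eqP; rewrite oner_eq0.
Qed.

(** 'X is prime. *)
Lemma mul_eq_Xn p q n : p * q = 'X^n -> exists k c, [/\ (k <= n)%N, c != 0 & p = c *: 'X^k].
Proof.
move=> e; have : p %| ('X - 0%:P) ^+ n by rewrite subr0 -e dvdp_mulr.
move/dvdp_exp_XsubCP => [k kn]; rewrite subr0 => /eqpP [[c1 c2] /= /andP [c10 c20] h].
exists k, (c1^-1 * c2); split=> //; first by rewrite mulf_neq0 ?invr_eq0.
by rewrite -scalerA -h scalerA mulVf // scale1r.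
Qed.

(** Clearing the poles makes f and g divisors of a power of the variable. *)
Lemma laur_unit R x f g : subring R -> transc R x -> laur R x f -> laur R x g -> f * g = 1 ->
  exists r s (a : int), [/\ R r, R s, r * s = 1 & f = r * x ^ a].
Proof.
move=> hR tx [n [p [hp ep]]] [n' [q [hq eq]]] fg; have x0 := transc_neq0 hR tx.
have e : p * q = 'X^(n + n').
  apply: (transc_inj hR tx); [exact: coefs_inM | exact: coefs_inXn |].
  by rewrite hornerM hornerXn -ep -eq mulrACA fg mul1r exprD.
have [k [c [kn c0 ec]]] := mul_eq_Xn e.
have e' : q * p = 'X^(n' + n) by rewrite mulrC e addnC.
have [k' [c' [_ c0' ec']]] := mul_eq_Xn e'.
have := e; rewrite ec ec' -scalerAl -scalerAr scalerA -exprD => /(congr1 (fun u : {poly F} => u`_(k + k'))) /=.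
rewrite coefZ !coefXn eqxx mulr1 => cc.
have cc1 : c * c' = 1.
  move: cc; case: eqP => _ //= h; move: (mulf_neq0 c0 c0'); by rewrite h eqxx.
exists c, c', (k%:Z - n%:Z); split=> //.
- by have := hp k; rewrite ec coefZ coefXn eqxx mulr1.
- by have := hq k'; rewrite ec' coefZ coefXn eqxx mulr1.
- apply: (mulIf (expf_neq0 n x0)); rewrite ep ec hornerZ hornerXn -mulrA; congr (_ * _).
  by rewrite expfzDr // -exprnN mulfVK // expf_neq0.
Qed.

Lemma exchange_exponents (r r' x z y : F) (a b : int) : x != 0 ->
  z = r * x ^ b -> z = r' * (y / x) ^ a -> r * x ^ (b + a) = r' * y ^ a.
Proof.
move=> x0 h; rewrite h expfzDr // mulrA => ->; rewrite expfzMl exprz_inv -!mulrA.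
by rewrite -expfzDr // addNr expr0z mulr1.
Qed.

Lemma expz_unit (P s s' : F) (a : int) : P != 0 -> P ^ a = s -> s * s' = 1 -> P ^ (- a) = s'.
Proof.
move=> P0 <- h; apply: (mulfI (x := P ^ a)); first by rewrite expfz_neq0.
by rewrite h -expfzDr // subrr expr0z.
Qed.

Lemma mul_inverses (s s' r ri : F) : r * ri = 1 -> s' * s = 1 -> (s * r) * (ri * s') = 1.
Proof. by move=> h h'; rewrite -mulrA (mulrA r) h mul1r mulrC. Qed.

Lemma expz_cases (P : F) (a : int) : P != 0 -> a != 0 ->
  exists n, P ^+ n.+1 * P ^ (- a) = 1 \/ P ^+ n.+1 * P ^ a = 1.
Proof.
move=> P0; case: a => [[|n]|n] // _; exists n.
  by left; rewrite -exprnN divff // expf_neq0.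
by right; rewrite NegzE -exprnN divff // expf_neq0.
Qed.

End LaurentUnits.

Section MonomialUnits.
Variables (K : fieldType) (N : nat).
Notation F := {fraction {mpoly K[N]}}.
Notation var := (@var K N).

Lemma gen_pred0 (J : pred 'I_N) (z : F) : J =1 pred0 -> gen var J z -> exists c, z = cst N c.
Proof.
move=> J0; apply: (gen_min (S := fun z => exists c, z = cst N c)) => [|c|i|i].
- split; first by exists 1; rewrite rmorph1.
  + by move=> x y [c ->] [d ->]; exists (c - d); rewrite rmorphB.
  + by move=> x y [c ->] [d ->]; exists (c * d); rewrite rmorphM.
- by exists c.
- by rewrite J0.
- by rewrite J0.
Qed.

Lemma mono_mulz e i (a : int) :
  mono e * var i ^ a = mono (fun l => e l + (if l == i then a else 0)) :> F.
Proof.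
rewrite monoD; congr (_ * _); rewrite (mono_split K i) eqxx mono0 ?mul1r // => l.
by rewrite /drop_at; case: eqP.
Qed.

(** Induction on the number of variables. *)
Lemma gen_unit (J : pred 'I_N) (z z' : F) : gen var J z -> gen var J z' -> z * z' = 1 ->
  exists c e, z = cst N c * mono e.
Proof.
have [n] := ubnP #|J|; elim: n J z z' => // n IH J z z' hn gz gz' zz.
case: (pickP J) => [i Ji|J0]; last first.
  have [c ->] := gen_pred0 J0 gz; exists c, (fun=> 0).
  by rewrite mono0 ?mulr1.
pose J' l := J l && (l != i).
have hS : subring (gen var J') by apply: gen_subring.
have tx : transc (gen var J') (var i).
  by apply: (transc_mono (@gen_frac_in _ _ J')); apply: var_transc; rewrite /J' eqxx andbF.
have toL y : gen var J y -> laur (gen var J') (var i) y.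
  apply: (proj1 (gen_laur (J := J') (J' := J) y (var_neq0 K i) Ji _ _)).
    by move=> l /andP [].
  by move=> l Jl; rewrite /J'; case: (eqVneq l i) => [->|]; [left | right; rewrite Jl].
have [r [s [a [gr gs rs ez]]]] := laur_unit hS tx (toL _ gz) (toL _ gz') zz.
have [|c [e er]] := IH J' r s _ gr gs rs.
  rewrite -ltnS; apply: leq_trans hn; rewrite ltnS; apply: proper_card; apply/properP; split.
    by apply/subsetP => l /andP [].
  by exists i => //; rewrite unfold_in /J' /= eqxx andbF.
exists c, (fun l => e l + (if l == i then a else 0)).
by rewrite ez er -mulrA mono_mulz.
Qed.

Lemma cst_neq0 (c : K) : c != 0 -> cst N c != 0.
Proof. by rewrite fmorph_eq0. Qed.

Lemma three_monomials (c d : K) (e e' : 'I_N -> int) i : c != 0 -> e i != 0 ->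
  1 + cst N c * mono e = cst N d * mono e' -> False.
Proof.
move=> c0 ei; rewrite (mono_split K i) [in RHS](mono_split K i) !mulrA => h.
have Td (a : K) e1 : frac_in (others i) (cst N a * mono (drop_at i e1) : F).
  apply: (srM (frac_in_subring _)); first exact: frac_in_cst.
  by apply/gen_frac_in/mono_gen => l; rewrite /drop_at /others; case: eqP; [right|left].
have tx : transc (frac_in (others i)) (var i) by apply: var_transc; rewrite /others eqxx.
exact: (three_terms (frac_in_subring _) tx (Td c e) (Td d e')
  (mulf_neq0 (cst_neq0 c0) (mono_neq0 K _)) ei h).
Qed.

(** An exchange polynomial with a nonzero exponent has two terms, whereas the
    units among Laurent polynomials are monomials. *)
Lemma expol_nonunit (J : pred 'I_N) e i (z : F) : e i != 0 ->
  gen var J (expol e : F) -> gen var J z -> expol e * z = 1 -> False.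
Proof.
move=> ei g1 g2 h; have [c [e' ec]] := gen_unit g1 g2 h.
apply: (@three_monomials 1 c e (fun l => - pospart (- e l) + e' l) i (oner_neq0 _) ei).
rewrite rmorph1 mul1r monoD monoN mulrCA -ec expolE mulKf //; exact: mono_neq0.
Qed.

End MonomialUnits.

Section UpperUnits.
Variables (K : fieldType) (m f : nat).
Hypothesis char2 : (2%:R : K) != 0.
Notation F := (ambient K m f).
Notation var := (@var K (m + f)).
Implicit Types (B : exchange_mx m f).

Definition frozen_mono (e : 'I_f -> int) : F := \prod_j var (rshift m j) ^ e j.

Lemma mono_frozen (e : 'I_(m + f) -> int) : (forall k, e (lshift f k) = 0) ->
  mono e = frozen_mono (fun j => e (rshift m j)).
Proof.
by move=> h; rewrite /mono big_split_ord /= big1 ?mul1r // => k _; rewrite h expr0z.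
Qed.

(** As a unit among Laurent polynomials z is a monomial both in the initial
    cluster and in the one adjacent at k. Comparing the two expressions, a
    nonzero exponent of x_k would make a power of the exchange polynomial a
    unit. *)
Lemma upper_unit B (z z' : F) : skew_principal B -> (forall k, col k B != 0) ->
  upper B z -> upper B z' -> z * z' = 1 ->
  exists c e, z = cst (m + f) c * frozen_mono e.
Proof.
move=> hB nzB [z0 zz] [z0' zz'] zz1.
have [c [e ez]] := gen_unit z0 z0' zz1.
exists c, (fun j => e (rshift m j)); rewrite ez mono_frozen // => k; apply/eqP.
apply: contraT => ek; exfalso.
set k' := lshift f k in ek; set x := var k'; set P : F := expol (col_fun B k).
pose R := gen var (others k').
have hR : subring R by apply: gen_subring.
have tx : transc R x.
  by apply: (transc_mono (@gen_frac_in _ _ _)); apply: var_transc; rewrite /others eqxx.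
have x0 : x != 0 by exact: (var_neq0 K k').
have RP : R P by apply: expol_col_gen.
have P0 : P != 0 by exact: expol_col_neq0.
have ty : transc R (P / x) by exact: (transc_div hR RP P0 tx).
have y0 : P / x != 0 by exact: (mulf_neq0 P0 (invr_neq0 x0)).
have toL v : gen (cvar (mutate (initial_seed K B) k)) predT v -> laur R (P / x) v.
  move=> gv; have gv' : gen (upd var k' (P / x)) predT v.
    by apply: gen_mono gv => // i _; rewrite mutate_initial.
  have u0 : upd var k' (P / x) k' != 0 by rewrite /upd eqxx.
  have := proj1 (gen_laur (J := others k') (J' := predT) v u0 isT _ _) gv'.
  rewrite {2}/upd eqxx => H; apply: laur_mono (H _ _) => //.
    by apply: gen_mono => // l; rewrite /others /upd => /negbTE ->.
  by move=> l _; rewrite /others; case: (eqVneq l k'); [left|right].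
have [r' [s' [a [Rr' Rs' rs' ez']]]] := laur_unit hR ty (toL _ (zz k)) (toL _ (zz' k)) zz1.
have c0 : c != 0.
  apply: contraNneq (oner_neq0 F) => c0.
  by rewrite -zz1 ez c0 rmorph0 !mul0r.
pose r : F := cst _ c * mono (drop_at k' e).
pose ri : F := cst _ c^-1 * mono (fun l => - drop_at k' e l).
have Jd : forall l, others k' l \/ drop_at k' e l = 0.
  by move=> l; rewrite /drop_at /others; case: eqP; [right|left].
have Rr : R r by apply: (srM hR); [apply: gen_cst | apply: mono_gen].
have Rri : R ri.
  apply: (srM hR); first exact: gen_cst.
  by apply: mono_gen => l; case: (Jd l) => [|->]; [left|right].
have rri : r * ri = 1.
  have cc : cst (m + f) c * cst (m + f) c^-1 = 1.
    by rewrite fmorphV; exact: (divff (cst_neq0 _ c0)).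
  rewrite /r /ri mulrACA cc mul1r monoN; exact: (divff (mono_neq0 K _)).
have r0 : r != 0 by apply: contraNneq (oner_neq0 F) => r0; rewrite -rri r0 mul0r.
have ez2 : z = r * x ^ (e k') by rewrite ez (mono_split K k') mulrA.
have [l ul] : exists l, col_fun B k l != 0.
  have /matrix0Pn [l [j]] := nzB k; rewrite mxE => h; exists l; exact: h.
have key : r * x ^ (e k' + a) = r' * P ^ a.
  exact: (exchange_exponents x0 ez2 ez').
have Tx : transc (frac_in (others k')) x by apply: var_transc; rewrite /others eqxx.
have RT v : R v -> frac_in (others k') v by apply: gen_frac_in.
have hT := frac_in_subring (K := K) (others k').
have TPa : frac_in (others k') (r' * P ^ a).
  apply: (srM hT (RT _ Rr')); apply: (srXz hT); first exact: RT.
  by apply: frac_in_inv; apply: RT.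
have ea : e k' + a = 0 := transc_powz hT Tx (RT _ Rr) TPa r0 key.
have a0 : a != 0 by apply: contraNneq ek => a0; rewrite -ea a0 addr0.
rewrite ea expr0z mulr1 in key.
have Pa : P ^ a = s' * r by rewrite key mulrA [s' * r']mulrC rs' mul1r.
have Pa' : P ^ (- a) = ri * r' := expz_unit P0 Pa (mul_inverses rri rs').
have fin w n : R w -> P ^+ n.+1 * w = 1 -> False.
  move=> Rw Pw; apply: (@expol_nonunit K _ (others k') (col_fun B k) l (P ^+ n * w) ul RP).
    by apply: (srM hR) => //; apply: srX.
  by rewrite mulrA -exprS.
have [n [h|h]] := expz_cases P0 a0.
  by rewrite Pa' in h; apply: (fin _ n _ h); apply: (srM hR).
by rewrite Pa in h; apply: (fin _ n _ h); apply: (srM hR).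
Qed.

Lemma frozen_mono_ext (e : 'I_f -> int) :
  frozen_mono e = mono (fun i => if split i is inr j then e j else 0).
Proof.
rewrite mono_frozen => [|k]; last by rewrite (unsplitK (inl _)).
by apply: eq_bigr => j _; rewrite (unsplitK (inr _)).
Qed.

Lemma frozen_mono_cst (e : 'I_f -> int) c : frozen_mono e = cst (m + f) c -> forall j, e j = 0.
Proof.
move=> h j; have h' := @mono_frac_in K (m + f) (rshift m j)
  (fun i => if split i is inr j then e j else 0) (cst (m + f) c) (frac_in_cst _ _).
by rewrite -frozen_mono_ext (unsplitK (inr _)) in h'; apply: h'.
Qed.

(** The difference of a nonconstant unit and a nonzero constant is not a
    unit. *)
Lemma frozen_three (e e' : 'I_f -> int) j (c d l : K) : c != 0 -> l != 0 -> e j != 0 ->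
  cst (m + f) c * frozen_mono e - cst (m + f) l = cst (m + f) d * frozen_mono e' -> False.
Proof.
move=> c0 l0 ej h.
pose ext (e : 'I_f -> int) := fun i : 'I_(m + f) => if split i is inr j then e j else 0.
apply: (@three_monomials K (m + f) (- (c / l)) (- (d / l)) (ext e) (ext e') (rshift m j)).
- by rewrite oppr_eq0 mulf_neq0 ?invr_eq0.
- by rewrite /ext (unsplitK (inr _)).
have l0' := cst_neq0 (m + f) l0.
rewrite -!frozen_mono_ext; apply: (mulfI l0').
rewrite !rmorphN !fmorph_div !mulNr mulrBr mulrN mulr1 [in RHS]mulrA [in LHS]mulrA.
rewrite [_ * (_ / _)]mulrC divfK // [_ * (_ / _)]mulrC divfK // -h opprB //.
Qed.

End UpperUnits.

(** * Triangular matrices and permutation matrices *)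

Section Triangular.
Variables (K : fieldType) (n : nat).
Notation M := 'M[K]_n.+1.
Implicit Types (A B : M) (u w : 'S_n.+1).

(** Triangular for the order of the indices given by u, which is upper
    triangular for u = 1 and lower triangular for the longest element. *)
Definition ptri u A := forall i j, (u j < u i)%N -> A i j = 0.
Definition uptri A := ptri 1%g A.
Definition unip A := forall i, A i i = 1.

Lemma uptriP A : uptri A <-> forall i j : 'I_n.+1, (j < i)%N -> A i j = 0.
Proof. by split=> h i j ij; apply: h; move: ij; rewrite !perm1. Qed.

Lemma ptri1 u : ptri u 1%:M.
Proof. by move=> i j ij; rewrite mxE; case: eqP => // e; rewrite e ltnn in ij. Qed.

Lemma ptriM u A B : ptri u A -> ptri u B -> ptri u (A *m B).
Proof.
move=> hA hB i j ij; rewrite mxE big1 // => k _.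
case: (ltnP (u k) (u i)) => h; first by rewrite hA ?mul0r.
by rewrite hB ?mulr0 // (leq_trans ij).
Qed.

Lemma ptri_diagM u A B i : ptri u A -> ptri u B -> (A *m B) i i = A i i * B i i.
Proof.
move=> hA hB; rewrite mxE (bigD1 i) //= big1 ?addr0 // => k ki.
case: (ltngtP (u k) (u i)) => h; first by rewrite hA ?mul0r.
  by rewrite hB ?mulr0.
by move: ki; rewrite (perm_inj (val_inj h)) eqxx.
Qed.

Lemma unipM u A B : ptri u A -> ptri u B -> unip A -> unip B -> unip (A *m B).
Proof. by move=> hA hB h1 h2 i; rewrite (ptri_diagM _ hA hB) h1 h2 mulr1. Qed.

(** The columns are e_(w 0), e_(w 1) and so on, as in the definition of
    coordinate flags. *)
Definition pm w : M := perm_mx w^-1.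

Lemma pmE w a i : pm w a i = (a == w i)%:R.
Proof. by rewrite /pm !mxE -(inj_eq (@perm_inj _ w)) permKV. Qed.

Lemma pm_unit w : pm w \in unitmx. Proof. exact: unitmx_perm. Qed.

Lemma pm1 : pm 1 = 1%:M. Proof. by rewrite /pm invg1 perm_mx1. Qed.

Lemma pmM u w : pm (comp_perm u w) = pm u *m pm w.
Proof. by rewrite /pm /comp_perm invMg perm_mxM. Qed.

Lemma pmVK w : pm w^-1 *m pm w = 1%:M.
Proof. by rewrite -pmM /comp_perm mulgV pm1. Qed.

Lemma pmKV w : pm w *m pm w^-1 = 1%:M.
Proof. by rewrite -pmM /comp_perm mulVg pm1. Qed.

Lemma pm_mull w A a j : (pm w *m A) (w a) j = A a j.
Proof.
rewrite mxE (bigD1 a) //= pmE eqxx mul1r big1 ?addr0 // => k ka.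
by rewrite pmE (inj_eq (@perm_inj _ w)) eq_sym (negbTE ka) mul0r.
Qed.

Lemma pm_mulr w A i j : (A *m pm w) i j = A i (w j).
Proof.
rewrite mxE (bigD1 (w j)) //= pmE eqxx mulr1 big1 ?addr0 // => k kj.
by rewrite pmE (negbTE kj) mulr0.
Qed.

Lemma pm_conj w A a b : (pm w *m A *m pm w^-1) (w a) (w b) = A a b.
Proof. by rewrite pm_mulr permK pm_mull. Qed.

Lemma ptri_conj w u A : ptri u A -> ptri (w^-1 * u)%g (pm w *m A *m pm w^-1).
Proof.
move=> hA i j; rewrite !permM => h.
by rewrite -(permKV w i) -(permKV w j) pm_conj; apply: hA.
Qed.

Lemma ptri_conjV w u A : ptri u A -> ptri (w * u)%g (pm w^-1 *m A *m pm w).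
Proof. by move=> hA; have := ptri_conj (w := (w^-1)%g) hA; rewrite invgK. Qed.

Lemma unip_conj w A : unip A -> unip (pm w *m A *m pm w^-1).
Proof. by move=> hA i; rewrite -(permKV w i) pm_conj. Qed.

Lemma unip_conjV w A : unip A -> unip (pm w^-1 *m A *m pm w).
Proof. by move=> hA; have := unip_conj (w^-1)%g hA; rewrite invgK. Qed.

Lemma uptri_det A : uptri A -> \det A = \prod_i A i i.
Proof.
move=> /uptriP hA; rewrite -det_tr det_trig; first by apply: eq_bigr => i _; rewrite mxE.
by apply/is_trig_mxP => i j ij; rewrite mxE; apply: hA.
Qed.

Lemma ptri_unit u A : ptri u A -> (A \in unitmx) = [forall i, A i i != 0].
Proof.
move=> hA; have hB := ptri_conj (w := u) hA; rewrite mulVg in hB.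
have -> : (A \in unitmx) = (pm u *m A *m pm u^-1 \in unitmx).
  by rewrite !unitmx_mul !pm_unit andbT.
rewrite unitmxE (uptri_det hB) unitfE; apply/prodf_neq0/forallP => h i.
  by have := h (u i) isT; rewrite pm_conj.
by move=> _; rewrite -(permKV u i) pm_conj; apply: h.
Qed.

Lemma ptri_diag u A i : ptri u A -> A \in unitmx -> A i i != 0.
Proof. by move=> hA; rewrite (ptri_unit hA) => /forallP. Qed.

Lemma unip_unit u A : ptri u A -> unip A -> A \in unitmx.
Proof. by move=> hA h1; rewrite (ptri_unit hA); apply/forallP => i; rewrite h1 oner_neq0. Qed.

(** Induction along the order of the indices, as in back substitution. *)
Lemma ptriV u A : ptri u A -> A \in unitmx -> ptri u (invmx A).
Proof.
move=> hA uA i j; have [m] := ubnP (u j); elim: m j => // m IH j; rewrite ltnS => jm ji.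
have : (invmx A *m A) i j = 0.
  by rewrite mulVmx // mxE; case: eqP => // e; rewrite e ltnn in ji.
rewrite mxE (bigD1 j) //= big1 ?addr0.
  by move/eqP; rewrite mulf_eq0 (negbTE (ptri_diag j hA uA)) orbF => /eqP.
move=> k kj; case: (ltngtP (u k) (u j)) => h.
- by rewrite IH ?mul0r //; [apply: leq_trans jm | apply: ltn_trans ji].
- by rewrite hA ?mulr0.
- by move: kj; rewrite (perm_inj (val_inj h)) eqxx.
Qed.

Lemma unipV u A : ptri u A -> unip A -> unip (invmx A).
Proof.
move=> hA h1 i; have uA := unip_unit hA h1.
have := ptri_diagM i (ptriV hA uA) hA; rewrite mulVmx // h1 mulr1 => <-.
by rewrite mxE eqxx.
Qed.

Lemma uptri_cancel A B : uptri (A *m B) -> uptri B -> B \in unitmx -> uptri A.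
Proof. by move=> hAB hB uB; rewrite -(mulmxK uB A); apply: ptriM => //; apply: ptriV. Qed.

Lemma longestE i : longest n i = rev_ord i. Proof. by rewrite permE. Qed.
Lemma longestK : (longest n)^-1%g = longest n.
Proof.
apply: (mulgI (longest n)); rewrite mulgV; apply/permP => i.
by rewrite permM !longestE perm1 rev_ordK.
Qed.

(** An entry off the diagonal is below it for one of the two orders. *)
Lemma ptri_opposite A : uptri A -> ptri (longest n) A -> forall i j, i != j -> A i j = 0.
Proof.
move=> /uptriP h1 h2 i j ij; case: (ltngtP i j) => h.
- by apply: h2; rewrite !longestE /=; have := ltn_ord i; have := ltn_ord j; lia.
- exact: h1.
- by move: ij; rewrite (val_inj h) eqxx.
Qed.

Lemma uptri_split A : uptri A -> A \in unitmx ->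
  exists N D, [/\ uptri N, unip N, forall u, ptri u D, D \in unitmx & A = N *m D].
Proof.
move=> hA uA; pose D : M := diag_mx (\row_i A i i).
have hD u : ptri u D.
  by move=> i j ij; rewrite !mxE; case: eqP => // e; rewrite e ltnn in ij.
have Dii i : D i i = A i i by rewrite !mxE eqxx.
have uD : D \in unitmx.
  rewrite (ptri_unit (hD 1%g)); apply/forallP => i; rewrite Dii; exact: (ptri_diag i hA uA).
have hN : uptri (A *m invmx D) by apply: ptriM => //; apply: ptriV.
exists (A *m invmx D), D; split=> //; last by rewrite mulmxKV.
move=> i; have := ptri_diagM i hN (hD 1%g); rewrite mulmxKV // Dii.
by move/esym/(canRL (mulfK (ptri_diag i hA uA))) ->; rewrite divff // (ptri_diag i hA uA).
Qed.

End Triangular.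
Arguments pm {K n}.

(** * Flags as cosets of the triangular group *)

Section Flags.
Variables (K : fieldType) (n : nat).
Notation M := 'M[K]_n.+1.
Notation V := 'cV[K]_n.+1.
Implicit Types (A B G : M) (u w : 'S_n.+1) (F : flag K n).
Notation fl := (@flag_of_mx K n).

Lemma fl_mem A (j : 'I_n.+2) (v : V) : A \in unitmx ->
  (v \in fl A j) = [forall i : 'I_n.+1, (j <= i)%N ==> ((invmx A *m v) i 0 == 0)].
Proof.
move=> uA; rewrite ffunE; set X := [seq _ | _ <- _ & _].
have hX (i : 'I_n.+1) : (i < j)%N -> col i A \in X.
  by move=> ij; apply/mapP; exists i => //; rewrite mem_filter ij mem_enum.
apply/idP/forallP => [hv i|h].
  apply/implyP => ji; apply/eqP.
  rewrite (coord_span (X := in_tuple X) hv) mulmx_sumr summxE big1 // => k _.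
  have /mapP [i' ] : X`_k \in X by apply: mem_nth.
  rewrite mem_filter => /andP [ij _] ->.
  rewrite -scalemxAr mxE colE mulmxA mulVmx // mul1mx mxE andbT.
  by case: eqP => [e|_]; rewrite ?mulr0 //; move: ij; rewrite -e ltnNge ji.
have -> : v = \sum_i (invmx A *m v) i 0 *: col i A.
  rewrite -{1}[v](mulKVmx uA); apply/colP => a; rewrite mxE summxE.
  by apply: eq_bigr => i _; rewrite !mxE mulrC.
apply: memv_suml => i _; case: (ltnP i j) => ij.
  by apply/memvZ/memv_span/hX.
by have := h i; rewrite ij => /eqP ->; rewrite scale0r mem0v.
Qed.

Lemma fl_memP A (j : 'I_n.+2) (v : V) : A \in unitmx ->
  reflect (forall i : 'I_n.+1, (j <= i)%N -> (invmx A *m v) i 0 = 0) (v \in fl A j).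
Proof.
move=> uA; rewrite fl_mem //; apply: (iffP forallP) => h i.
  by move=> ij; have := h i; rewrite ij => /eqP.
by apply/implyP => /h ->.
Qed.

(** The flag variety is GL / B. *)
Lemma fl_eq A B : A \in unitmx -> B \in unitmx -> fl A = fl B <-> uptri (invmx A *m B).
Proof.
move=> uA uB; split=> [e|hU].
  apply/uptriP => i j ji; have hj : (j.+1 < n.+2)%N by rewrite ltnS ltn_ord.
  have : col j B \in fl B (inord j.+1).
    apply/fl_memP => // k; rewrite inordK // => jk.
    rewrite colE mulmxA mulVmx // mul1mx mxE; case: eqP => // e'.
    by rewrite e' ltnn in jk.
  rewrite -e => /(fl_memP _ _ uA) /(_ i); rewrite inordK // => /(_ ji).
  by rewrite colE mulmxA -colE mxE.
have half A' B' : A' \in unitmx -> B' \in unitmx -> uptri (invmx A' *m B') ->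
    forall j v, v \in fl B' j -> v \in fl A' j.
  move=> uA' uB' /uptriP h j v /(fl_memP _ _ uB') hv; apply/fl_memP => // i ji.
  have -> : invmx A' *m v = (invmx A' *m B') *m (invmx B' *m v).
    by rewrite -mulmxA mulKVmx.
  rewrite mxE big1 // => k _; case: (ltnP k i) => ki; first by rewrite h ?mul0r.
  by rewrite hv ?mulr0 // (leq_trans ji).
have hU' : uptri (invmx B *m A).
  have uU : invmx A *m B \in unitmx by rewrite unitmx_mul unitmx_inv uA.
  rewrite (_ : invmx B *m A = invmx (invmx A *m B)); first exact: ptriV.
  by apply: (row_free_inj (A := invmx A *m B)); rewrite ?row_free_unit //
     mulVmx // mulmxA mulmxK // mulVmx.
by apply/ffunP => j; apply/vspaceP => v; apply/idP/idP; apply: half.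
Qed.

Lemma fl_mulU A U : A \in unitmx -> uptri U -> U \in unitmx -> fl (A *m U) = fl A.
Proof.
move=> uA hU uU; apply/esym/fl_eq => //; first by rewrite unitmx_mul uA.
by rewrite mulKmx.
Qed.

Lemma fl_complete A : A \in unitmx -> complete_flag (fl A).
Proof.
move=> uA; split=> [j|i j ij]; last first.
  apply/subvP => v /(fl_memP _ _ uA) h; apply/fl_memP => // k jk; apply: h.
  exact: leq_trans jk.
rewrite ffunE; set s := [seq i <- _ | _].
have fs : free [seq col i A | i : 'I_n.+1 <- s].
  have us : uniq s by rewrite filter_uniq // enum_uniq.
  apply/(@freeP _ _ _ (map_tuple (fun i : 'I_n.+1 => col i A) (in_tuple s))) => k hk i.
  have si := ltn_ord i.
  have := congr1 (mulmx (invmx A)) hk; rewrite mulmx0 mulmx_sumr.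
  move/(congr1 (fun v : V => v (nth ord0 s i) 0)); rewrite summxE mxE.
  rewrite (bigD1 i) //= big1 ?addr0.
    rewrite -scalemxAr mxE (nth_map ord0) // colE mulmxA mulVmx // mul1mx mxE !eqxx.
    by rewrite mulr1.
  move=> l li; have sl := ltn_ord l.
  rewrite -scalemxAr mxE (nth_map ord0) // colE mulmxA mulVmx // mul1mx mxE.
  by rewrite nth_uniq // eq_sym (inj_eq val_inj) (negbTE li) mulr0.
rewrite (eqP fs) size_map size_filter.
rewrite -(count_map val (fun i => (i < j)%N)) val_enum_ord -size_filter.
have -> : [seq i <- iota 0 n.+1 | (i < j)%N] = iota 0 j.
  have := ltn_ord j; rewrite ltnS; move: (nat_of_ord j) => k kn.
  have [d ->] : exists d, n.+1 = (k + d)%N by exists (n.+1 - k)%N; rewrite subnKC.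
  rewrite iotaD filter_cat add0n.
  rewrite (@eq_in_filter _ _ predT) ?filter_predT; last first.
    by move=> x; rewrite mem_iota add0n.
  rewrite (@eq_in_filter _ _ pred0) ?filter_pred0 ?cats0 // => x.
  by rewrite mem_iota => /andP [h _]; rewrite ltnNge h.
by rewrite size_iota.
Qed.

Lemma coord_flagE w : coord_flag K w = fl (pm w).
Proof.
apply/ffunP => j; rewrite !ffunE; congr (<<_>>%VS).
apply: eq_map => i; apply/colP => a.
by rewrite [LHS]mxE [RHS]mxE pmE eqxx andbT.
Qed.

Lemma std_flagE : std_flag K n = fl 1%:M.
Proof. by rewrite /std_flag coord_flagE pm1. Qed.

Lemma ant_flagE : ant_flag K n = fl (pm (longest n)).
Proof. exact: coord_flagE. Qed.

Definition mxact G F : flag K n := act_flag (linfun (mulmx G : V -> V)) F.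

Lemma mxact_fl G A : mxact G (fl A) = fl (G *m A).
Proof.
apply/ffunP => j; rewrite !ffunE limg_span -map_comp; congr (<<_>>%VS).
by apply: eq_map => i; rewrite /= lfunE /= !colE mulmxA.
Qed.

Lemma mxactM G H F : mxact G (mxact H F) = mxact (G *m H) F.
Proof.
apply/ffunP => j; rewrite !ffunE -limg_comp; congr (_ @: _)%VS.
by apply/lfunP => v; rewrite comp_lfunE !lfunE /= mulmxA.
Qed.

Lemma mxact1 F : mxact 1%:M F = F.
Proof.
apply/ffunP => j; rewrite !ffunE -[RHS](lim1g); congr (_ @: _)%VS.
by apply/lfunP => v; rewrite !lfunE /= mul1mx.
Qed.

Lemma act_flag_mx (g : 'End(V)) : lker g = 0%VS ->
  exists2 G, G \in unitmx & forall F, act_flag g F = mxact G F.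
Proof.
move=> g0.
have mxP (h : 'End(V)) : exists H, forall v, h v = H *m v.
  exists (\matrix_(i, j) h (delta_mx j 0) i 0) => v.
  apply/colP => i; rewrite mxE [in LHS](matrix_sum_delta v) linear_sum summxE.
  apply: eq_bigr => j _; rewrite big_ord1 linearZ /= !mxE mulrC.
  by [].
have [G hG] := mxP g; have [H hH] := mxP (g^-1)%VF.
have HG : H *m G = 1%:M.
  apply/matrixP => i j; have := congr1 (fun v : V => v i 0) (lker0_lfunK (introT eqP g0) (delta_mx j 0)).
  by rewrite hG hH mulmxA -colE !mxE eqxx andbT.
exists G; first by have [] := mulmx1_unit HG.
move=> F; apply/ffunP => j; rewrite !ffunE; congr (_ @: _)%VS.
by apply/lfunP => v; rewrite lfunE /= hG.
Qed.

(** The relative position is the double coset with respect to B, written in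
    terms of frames. *)
Lemma relpos_elim w A F : A \in unitmx -> relpos w (fl A) F ->
  exists U, [/\ uptri U, U \in unitmx & F = fl (A *m U *m pm w)].
Proof.
move=> uA [g [g0 gA gF]]; have [G uG hG] := act_flag_mx g0.
move: gA gF; rewrite !hG mxact_fl std_flagE coord_flagE => gA gF.
have uGA : G *m A \in unitmx by rewrite unitmx_mul uG.
have hU : uptri (invmx (G *m A)).
  by have := proj1 (fl_eq uGA (unitmx1 _ _)) gA; rewrite mulmx1.
exists (invmx (G *m A)); split=> //; first by rewrite unitmx_inv.
have -> : A *m invmx (G *m A) = invmx G.
  by apply: (can_inj (mulKmx uG)); rewrite mulmxA mulmxV // mulmxV.
by rewrite -mxact_fl -gF mxactM mulVmx // mxact1.
Qed.

Lemma relpos_intro w A U U' : A \in unitmx -> uptri U -> U \in unitmx ->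
  uptri U' -> U' \in unitmx -> relpos w (fl A) (fl (A *m U *m pm w *m U')).
Proof.
move=> uA hU uU hU' uU'; have uAU : A *m U \in unitmx by rewrite unitmx_mul uA.
exists (linfun (mulmx (invmx (A *m U)) : V -> V)).
rewrite -/(mxact _ _) -/(mxact _ _) !mxact_fl std_flagE coord_flagE; split.
- apply/eqP/lker0P => x y; rewrite !lfunE /= => /(congr1 (mulmx (A *m U))).
  by rewrite !mulmxA mulmxV // !mul1mx.
- rewrite -(fl_mulU _ hU uU) ?unitmx_mul ?unitmx_inv ?uAU // -mulmxA mulVmx //.
- by rewrite -(mulmxA (A *m U)) mulKmx // fl_mulU // pm_unit.
Qed.

End Flags.

(** * Reduced words and Bruhat cells *)

Section Words.
Variable n : nat.
Implicit Types (a b c : seq 'I_n) (i j : 'I_n) (u w : 'S_n.+1).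

Definition lo i : 'I_n.+1 := widen_ord (leqnSn n) i.
Definition hi i : 'I_n.+1 := lift ord0 i.

Lemma lohi i : (lo i < hi i)%N.
Proof. by rewrite /lo /hi /= /bump /= add1n. Qed.

Lemma simple_loE i : simple_transp i (lo i) = hi i. Proof. exact: tpermL. Qed.
Lemma simple_hiE i : simple_transp i (hi i) = lo i. Proof. exact: tpermR. Qed.

(** A simple transposition reverses the order of a single pair. *)
Lemma simple_swap i (x y : 'I_n.+1) : (x < y)%N ->
  (simple_transp i y < simple_transp i x)%N -> x = lo i /\ y = hi i.
Proof.
have h : nat_of_ord (hi i) = (nat_of_ord (lo i)).+1 by rewrite /hi /lo /= /bump /= add1n.
have eqv (z t : 'I_n.+1) : z <> t -> nat_of_ord z <> nat_of_ord t by move=> zt /val_inj.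
rewrite /simple_transp -/(lo i) -/(hi i).
case: (tpermP (lo i) (hi i) x) => [->|->|/eqv x1 /eqv x2];
case: (tpermP (lo i) (hi i) y) => [->|->|/eqv y1 /eqv y2] => // xy yx.
all: by exfalso; lia.
Qed.

Lemma comp_permA u v w : comp_perm u (comp_perm v w) = comp_perm (comp_perm u v) w.
Proof. by rewrite /comp_perm mulgA. Qed.

Lemma word_perm_cat a b : word_perm (a ++ b) = comp_perm (word_perm a) (word_perm b).
Proof.
elim: a => [|i a IH] /=; first by rewrite /comp_perm mulg1.
by rewrite IH comp_permA.
Qed.

(** The letter to be deleted is the one at which the images of the two
    neighbouring indices change their order. *)
Lemma exchange_condition b i : (word_perm b (hi i) < word_perm b (lo i))%N ->
  exists2 c, (size c < size b)%N & word_perm c = comp_perm (word_perm b) (simple_transp i).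
Proof.
elim: b => [|j b IH] /=; first by rewrite !perm1; have := lohi i; lia.
set u := word_perm b in IH *; rewrite {1 2}/comp_perm !permM => h.
case: (ltnP (u (hi i)) (u (lo i))) => h1.
  have [c sc ec] := IH h1; exists (j :: c) => //=.
  by rewrite ec comp_permA.
have h2 : (u (lo i) < u (hi i))%N.
  rewrite ltn_neqAle h1 andbT; apply/eqP => /val_inj /perm_inj e.
  by have := lohi i; rewrite e ltnn.
have [e1 e2] := simple_swap h2 h; exists b => //.
have ej : simple_transp j = (u^-1 * (simple_transp i * u))%g.
  by rewrite /simple_transp -/(lo i) -/(hi i) -/(lo j) -/(hi j) -e1 -e2 -conjgE tpermJ.
by rewrite -/u /comp_perm ej !mulgA mulgK tperm2 mul1g.
Qed.

(** Every letter increases the length of the prefix before it. Reducedness is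
    used in this form. *)
Definition ascending a := forall b i c, a = b ++ i :: c ->
  (word_perm b (lo i) < word_perm b (hi i))%N.

Lemma reduced_ascending a u : reduced_word a u -> ascending a.
Proof.
move=> [ea mina] b i c eabc; rewrite ltnNge leq_eqVlt; apply/negP => /orP [/eqP e|h].
  by have := lohi i; rewrite (perm_inj (val_inj e)) ltnn.
have [d sd ed] := exchange_condition h.
have := mina (d ++ c); rewrite word_perm_cat ed -comp_permA -ea eabc word_perm_cat => /(_ erefl).
by rewrite !size_cat /=; lia.
Qed.

Lemma ascending_rcons a i : ascending (rcons a i) -> ascending a.
Proof. by move=> h b j c e; apply: (h b j (rcons c i)); rewrite e rcons_cat. Qed.

End Words.

Section Bruhat.
Variables (K : fieldType) (n : nat).
Notation M := 'M[K]_n.+1.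
Implicit Types (A B U : M) (i : 'I_n) (a b : seq 'I_n) (u w : 'S_n.+1).

Definition borel U := uptri U /\ U \in unitmx.

Lemma borel1 : borel 1%:M. Proof. by split; [apply: ptri1 | apply: unitmx1]. Qed.
Lemma borelM U U' : borel U -> borel U' -> borel (U *m U').
Proof. by move=> [h1 h2] [h3 h4]; split; [apply: ptriM | rewrite unitmx_mul h2]. Qed.
Lemma borelV U : borel U -> borel (invmx U).
Proof. by move=> [h1 h2]; split; [apply: ptriV | rewrite unitmx_inv]. Qed.
Lemma borel_unip U : uptri U -> unip U -> borel U.
Proof. by move=> h1 h2; split=> //; apply: unip_unit h1 h2. Qed.

(** The one-parameter group of the simple root i. *)
Definition xm i (t : K) : M := 1%:M + t *: delta_mx (lo i) (hi i).

Lemma xm_uptri i t : uptri (xm i t).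
Proof.
apply/uptriP => a b ba; rewrite !mxE; case: eqP => [e|_]; first by rewrite e ltnn in ba.
case: eqP => [e|_]; last by rewrite mulr0 addr0.
case: eqP => [e'|_]; last by rewrite mulr0 addr0.
by move: ba; rewrite e e'; have := lohi i; lia.
Qed.

Lemma xm_unip i t : unip (xm i t).
Proof.
move=> a; rewrite !mxE eqxx; case: eqP => [->|_]; last by rewrite mulr0 addr0.
case: eqP => [e|_]; last by rewrite mulr0 addr0.
by have := lohi i; rewrite e ltnn.
Qed.

Lemma xmD i t t' : xm i t *m xm i t' = xm i (t + t').
Proof.
rewrite /xm mulmxDl mul1mx mulmxDr mulmx1 -scalemxAl -scalemxAr mul_delta_mx_0.
  by rewrite !scaler0 addr0 scalerDl addrA addrAC -!addrA; congr (_ + _); rewrite addrC.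
by apply/eqP => e; have := lohi i; rewrite e ltnn.
Qed.

Lemma xm_mulE i t A (a b : 'I_n.+1) : (xm i t *m A) a b = A a b + (if a == lo i then t * A (hi i) b else 0).
Proof.
rewrite /xm mulmxDl mul1mx -scalemxAl !mxE; congr (_ + _).
rewrite (bigD1 (hi i)) //= !mxE eqxx andbT big1 ?addr0.
  by case: eqP => _; rewrite ?mul1r // mul0r mulr0.
by move=> k /negbTE kh; rewrite !mxE kh andbF mul0r.
Qed.

Notation s i := (@simple_transp n i).

(** The flags adjacent to a given one in direction i form an affine line with
    coordinate t. *)
Lemma borel_simple i U : borel U ->
  exists t U', borel U' /\ U *m pm (s i) = xm i t *m pm (s i) *m U'.
Proof.
move=> [hU uU]; pose t := U (lo i) (hi i) / U (hi i) (hi i).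
have d0 : U (hi i) (hi i) != 0 by apply: (ptri_diag _ hU uU).
pose U1 := xm i (- t) *m U.
have hU1 : uptri U1 by apply: ptriM => //; apply: xm_uptri.
have U1lh : U1 (lo i) (hi i) = 0 by rewrite xm_mulE eqxx /t mulNr divfK // subrr.
have uX t' : xm i t' \in unitmx by apply: unip_unit (xm_uptri i t') (xm_unip i t').
have e : U *m pm (s i) = xm i t *m pm (s i) *m (pm (s i)^-1 *m U1 *m pm (s i)).
  rewrite /U1 !mulmxA -(mulmxA (xm i t)) pmKV mulmx1 xmD addrN.
  by rewrite {1}/xm scale0r addr0 mul1mx.
exists t, (pm (s i)^-1 *m U1 *m pm (s i)); split=> //; split; last first.
  by rewrite !unitmx_mul !pm_unit uX uU.
apply/uptriP => a b ba; have := pm_conj (s i)^-1 U1 (s i a) (s i b).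
rewrite invgK !permK => ->.
case: (ltngtP (s i b) (s i a)) => h.
- by move/uptriP: hU1; apply.
- have [-> ->] := simple_swap ba h.
  by rewrite simple_loE simple_hiE.
- by move: ba; rewrite (perm_inj (val_inj h)) ltnn.
Qed.

Definition step i A B := exists U U', [/\ borel U, borel U' & B = A *m U *m pm (s i) *m U'].

(** Beyond the end of b the value of onth makes the condition void. *)
Definition chain b (m : nat -> M) := forall j i, onth b j = Some i -> step i (m j) (m j.+1).

Lemma chain_catl a b m : chain (a ++ b) m -> chain a m.
Proof. by move=> h j i e; apply: h; rewrite onth_cat; case: ltnP => // sj; rewrite onth_default in e. Qed.

Lemma chain_catr a b m : chain (a ++ b) m -> chain b (fun j => m (size a + j)%N).
Proof.
move=> h j i e; rewrite addnS; apply: h; rewrite onth_cat ltnNge leq_addr /=.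
by rewrite addKn.
Qed.

Lemma ascending_conj u i t : (u (lo i) < u (hi i))%N ->
  uptri (pm u *m xm i t *m pm u^-1) /\ unip (pm u *m xm i t *m pm u^-1).
Proof.
move=> h; split; last by apply: unip_conj; apply: xm_unip.
apply/uptriP => a b; rewrite -(permKV u a) -(permKV u b).
move: (u^-1%g a) (u^-1%g b) => a' b' ba; rewrite pm_conj !mxE.
case: eqP => [e|_]; first by rewrite e ltnn in ba.
case: eqP => [e|_]; last by rewrite mulr0 addr0.
case: eqP => [e'|_]; last by rewrite mulr0 addr0.
by move: ba; rewrite e e'; lia.
Qed.

(** Each step contributes a factor x_i(t), and conjugation by the prefix moves
    it to the left as an upper triangular factor, because the word is
    ascending. *)
Lemma chain_bruhat a m : ascending a -> chain a m ->
  exists U U', [/\ borel U, borel U' & m (size a) = m 0%N *m U *m pm (word_perm a) *m U'].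
Proof.
elim/last_ind: a => [|a i IH] ha hm.
  by exists 1%:M, 1%:M; rewrite /= pm1 !mulmx1; split=> //; apply: borel1.
have [|U [U' [hU hU' e]]] := IH (ascending_rcons ha).
  by apply: (@chain_catl a [:: i]); rewrite cats1.
have [|V [V' [hV hV' e']]] := hm (size a) i.
  by rewrite -cats1 onth_cat ltnn subnn.
rewrite size_rcons e' e -cats1 word_perm_cat /=.
have [t [U1 [hU1 e1]]] := borel_simple i (borelM hU' hV).
have hasc : (word_perm a (lo i) < word_perm a (hi i))%N.
  by apply: (ha a i [::]); rewrite cats1.
have [y1 y2] := ascending_conj t hasc; set y := _ *m _ *m _ in y1 y2.
exists (U *m y), (U1 *m V'); split; try by apply: borelM => //; apply: borel_unip.
rewrite pmM; have -> : comp_perm (s i) 1 = s i by rewrite /comp_perm mul1g.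
rewrite -!mulmxA; congr (_ *m (_ *m _)).
rewrite [U' *m _]mulmxA [(_ *m V) *m _]mulmxA e1 /y -!mulmxA; congr (_ *m (_ *m _)).
by rewrite [RHS]mulmxA pmVK mul1mx.
Qed.

(** A leading principal submatrix, completed by an identity block so that all
    of them have the same type. *)
Definition corner (k : nat) A : M := \matrix_(a, b)
  if ((a < k) && (b < k))%N then A a b else (a == b)%:R.

(** Row k of 1 - L solves a linear system with matrix the corner k. The last
    clause keeps L in the unipotent groups to which A belongs. *)
Lemma LU A : (forall k : 'I_n.+1, corner k A \in unitmx) ->
  exists L, [/\ ptri (longest n) L, unip L, uptri (L *m A) &
    forall u, ptri u A -> ptri u L].
Proof.
move=> hA.
pose r (k : 'I_n.+1) : 'rV[K]_n.+1 := \row_b if (b < k)%N then A k b else 0.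
pose y k := r k *m invmx (corner k A).
have ey (k b : 'I_n.+1) : \sum_a y k 0 a * corner k A a b = r k 0 b.
  by have := mulmxKV (hA k) (r k) => /(congr1 (fun v : 'rV__ => v 0 b)); rewrite mxE.
have y0 (k b : 'I_n.+1) : (k <= b)%N -> y k 0 b = 0.
  move=> kb; have rk : r k 0 b = 0 by rewrite mxE ltnNge kb.
  have cb c : corner k A c b = (c == b)%:R by rewrite mxE [(b < k)%N]ltnNge kb andbF.
  have := ey k b; rewrite rk (bigD1 b) //= cb eqxx mulr1 big1 ?addr0 // => c cb'.
  by rewrite cb (negbTE cb') mulr0.
exists (\matrix_(k, b) ((k == b)%:R - y k 0 b)); split.
- move=> k b; rewrite !longestE /= => h; rewrite mxE y0; last by lia.
  by rewrite subr0; case: eqP => // e; rewrite e ltnn in h.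
- by move=> k; rewrite mxE eqxx y0 // subr0.
- apply/uptriP => k b bk; rewrite mxE.
  under eq_bigr do rewrite mxE mulrBl.
  rewrite sumrB (bigD1 k) //= eqxx mul1r big1 ?addr0; last first.
    by move=> a ak; rewrite eq_sym (negbTE ak) mul0r.
  apply/eqP; rewrite subr_eq0; apply/eqP; have rk : r k 0 b = A k b by rewrite mxE bk.
  rewrite -rk -ey.
  apply: eq_bigr => a _; case: (ltnP a k) => ak; last by rewrite y0 ?mul0r.
  have ca : corner k A a b = A a b by rewrite mxE ak bk.
  by rewrite ca.
move=> u hu k b bk; rewrite mxE; case: eqP => [e|_]; first by rewrite e ltnn in bk.
have hc : ptri u (corner k A).
  move=> a d ad; rewrite mxE; case: ifP => _; first exact: hu.
  by case: eqP => // e; rewrite e ltnn in ad.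
rewrite sub0r /y mxE big1 ?oppr0 // => a _; rewrite mxE.
case: ifP => ak; last by rewrite mul0r.
case: (ltnP (u a) (u k)) => h; first by rewrite hu ?mul0r.
by rewrite (ptriV hc (hA k)) ?mulr0 // (leq_trans bk).
Qed.

Lemma corner_unip u k A : ptri u A -> unip A -> corner k A \in unitmx.
Proof.
move=> hA h1; apply: (@unip_unit _ _ u).
  move=> a d ad; rewrite mxE; case: ifP => _; first exact: hA.
  by case: eqP => // e; rewrite e ltnn in ad.
by move=> a; rewrite mxE eqxx h1; case: ifP.
Qed.

(** Corners multiply when the left factor is lower and the right factor upper
    triangular. *)
Lemma corner_LU k L U : ptri (longest n) L -> unip L -> borel U -> corner k (L *m U) \in unitmx.
Proof.
move=> hL h1 [hU uU].
pose L' : M := \matrix_(a, b) if ((a < k) && (b < k))%N then L a b else (a == b)%:R.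
have hLl (a b : 'I_n.+1) : (a < b)%N -> L a b = 0.
  by move=> ab; apply: hL; rewrite !longestE /=; have := ltn_ord a; have := ltn_ord b; lia.
have -> : corner k (L *m U) = corner k L *m corner k U.
  apply/matrixP => a b; rewrite !mxE.
  case: (ltnP a k) => ak /=; last first.
    rewrite (bigD1 a) //= big1 ?addr0; last first.
      by move=> c ca; rewrite mxE ltnNge ak /= eq_sym (negbTE ca) mul0r.
    by rewrite !mxE !(ltnNge a) ak /= eqxx mul1r.
  case: (ltnP b k) => bk /=; last first.
    rewrite (bigD1 b) //= big1 ?addr0; last first.
      by move=> c cb; rewrite [X in _ * X]mxE [(b < k)%N]ltnNge bk andbF (negbTE cb) mulr0.
    by rewrite !mxE !(ltnNge b) bk !andbF eqxx mulr1.
  apply: eq_bigr => c _; rewrite !mxE ak bk /= andbT; case: (ltnP c k) => ck //.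
  by rewrite hLl ?mul0r ?(leq_trans ak) //; case: eqP => [e|_]; rewrite ?mul0r //; move: ak; rewrite e ltnNge ck.
rewrite unitmx_mul (corner_unip k hL h1) /=.
have hc : uptri (corner k U).
  move=> a d ad; rewrite mxE; case: ifP => _; first exact: hU.
  by case: eqP => // e; rewrite e ltnn in ad.
rewrite (ptri_unit hc); apply/forallP => a; rewrite mxE eqxx; case: ifP => _.
  exact: (ptri_diag a hU uU).
exact: oner_neq0.
Qed.

End Bruhat.

(** * Splicing points of braid varieties *)

Section Points.
Variables (K : fieldType) (n : nat).
Notation M := 'M[K]_n.+1.
Notation w0 := (longest n).
Notation fl := (@flag_of_mx K n).
Implicit Types (A B U : M) (b : seq 'I_n) (m : nat -> M).

(** Natural numbers as indices avoid casts between the lengths of the words. *)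
Definition at_ r (x : flag_seq K n r) (k : nat) : flag K n := x (inord k).

(** Choosing frames for the flags of a point turns the braid variety into a
    condition on matrices. *)
Definition framed b m :=
  [/\ forall j, m j \in unitmx, borel (m 0%N), borel (pm w0^-1 *m m (size b)) & chain b m].

Lemma step_relpos i A B : A \in unitmx -> step i A B ->
  relpos (simple_transp i) (fl A) (fl B).
Proof. by move=> uA [U [U' [[h1 h2] [h3 h4] ->]]]; apply: relpos_intro. Qed.

Lemma relpos_step i A B : A \in unitmx -> B \in unitmx ->
  relpos (simple_transp i) (fl A) (fl B) -> step i A B.
Proof.
move=> uA uB /(relpos_elim uA) [U [hU uU e]].
have uAU : A *m U *m pm (simple_transp i) \in unitmx.
  by rewrite !unitmx_mul uA uU pm_unit.
exists U, (invmx (A *m U *m pm (simple_transp i)) *m B); split=> //.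
  split; last by rewrite unitmx_mul unitmx_inv uAU.
  by apply/fl_eq => //; rewrite e.
by rewrite mulKVmx.
Qed.

Lemma step_mull i A B G : step i A B -> step i (G *m A) (G *m B).
Proof. by move=> [U [U' [hU hU' ->]]]; exists U, U'; rewrite !mulmxA. Qed.

Lemma step_borel i A B U : borel U -> step i (A *m U) B -> step i A B.
Proof.
move=> hU [U1 [U' [h1 h2 ->]]]; exists (U *m U1), U'; rewrite !mulmxA; split=> //.
exact: borelM.
Qed.

Lemma step_borelr i A B U : borel U -> step i A B -> step i A (B *m U).
Proof.
move=> hU [U1 [U' [h1 h2 ->]]]; exists U1, (U' *m U); rewrite !mulmxA; split=> //.
exact: borelM.
Qed.

Lemma fl_std A : A \in unitmx -> fl A = std_flag K n <-> borel A.
Proof.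
move=> uA; rewrite std_flagE; split=> [/esym/(fl_eq (unitmx1 _ _) uA)|[h _]].
  by rewrite invmx1 mul1mx.
by apply/esym/fl_eq; rewrite ?unitmx1 // invmx1 mul1mx.
Qed.

Lemma invmx_pm w : invmx (pm w) = pm w^-1 :> M.
Proof.
apply: (row_free_inj (A := pm w)); rewrite ?row_free_unit ?pm_unit //.
by rewrite mulVmx ?pm_unit // pmVK.
Qed.

Lemma fl_ant A : A \in unitmx -> fl A = ant_flag K n <-> borel (pm w0^-1 *m A).
Proof.
move=> uA; rewrite ant_flagE; split=> [/esym/(fl_eq (pm_unit _ _) uA)|[h _]].
  by rewrite invmx_pm => h; split=> //; rewrite unitmx_mul pm_unit.
by apply/esym/fl_eq; rewrite ?pm_unit // invmx_pm.
Qed.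

Lemma framed_bv b m : framed b m -> braid_variety [ffun j : 'I_(size b).+1 => fl (m j)].
Proof.
move=> [um m0 mr hm]; split.
- by move=> j; rewrite ffunE; apply: fl_complete.
- by rewrite ffunE; apply/fl_std.
- by rewrite ffunE; apply/fl_ant.
- move=> j; rewrite !ffunE /=; apply: step_relpos => //; apply: hm.
  by have /tnth_onth := erefl (tnth (in_tuple b) j).
Qed.

Lemma frames_chain b (x : flag_seq K n (size b)) m : braid_variety x ->
  (forall j, m j \in unitmx) -> (forall j, (j <= size b)%N -> at_ x j = fl (m j)) -> framed b m.
Proof.
move=> [_ x0 xr xs] um hx; split=> //.
- apply/fl_std => //; rewrite -hx // /at_ -x0; congr (x _).
  by apply: val_inj; rewrite /= inordK.
- apply/fl_ant => //; rewrite -hx // /at_ -xr; congr (x _).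
  by apply: val_inj; rewrite /= inordK.
- move=> j i e; have jb : (j < size b)%N by rewrite -onthTE e.
  apply: relpos_step => //; rewrite -!hx //; last exact: ltnW.
  have := xs (Ordinal jb); rewrite (_ : tnth _ _ = i); last exact/tnth_onth.
  rewrite /at_ (_ : widen_ord _ _ = inord j); last by apply: val_inj; rewrite /= inordK // ltnW.
  by rewrite (_ : lift _ _ = inord j.+1) //; apply: val_inj; rewrite /= inordK.
Qed.

Lemma bv_frames b (x : flag_seq K n (size b)) : braid_variety x ->
  exists m, (forall j, m j \in unitmx) /\ (forall j, (j <= size b)%N -> at_ x j = fl (m j)).
Proof.
move=> [_ x0 _ xs].
have ex j : (j <= size b)%N -> exists2 A, A \in unitmx & at_ x j = fl A.
  elim: j => [|j IH] jb.
    exists 1%:M; first exact: unitmx1.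
    by rewrite -std_flagE -x0 /at_; congr (x _); apply: val_inj; rewrite /= inordK.
  have [A uA eA] := IH (ltnW jb).
  have := xs (Ordinal jb).
  rewrite (_ : widen_ord _ _ = inord j); last by apply: val_inj; rewrite /= inordK // ltnW.
  rewrite (_ : lift _ _ = inord j.+1); last by apply: val_inj; rewrite /= inordK.
  rewrite -/(at_ x j) eA => /(relpos_elim uA) [U [hU uU e]].
  exists (A *m U *m pm (simple_transp (tnth (in_tuple b) (Ordinal jb)))) => //.
  by rewrite !unitmx_mul uA uU pm_unit.
have /fin_all_exists [m hm] : forall j : 'I_(size b).+1, exists A, A \in unitmx /\ at_ x j = fl A.
  by move=> j; have [|A h1 h2] := ex j; [rewrite -ltnS | exists A].
exists (fun j => m (inord j)); split=> j; first by have [] := hm (inord j).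
by move=> jb; have [_] := hm (inord j); rewrite inordK.
Qed.

Lemma at_eq r (x y : flag_seq K n r) : (forall j, (j <= r)%N -> at_ x j = at_ y j) -> x = y.
Proof.
move=> h; apply/ffunP => j; have := h j; rewrite -ltnS ltn_ord => /(_ isT).
by rewrite /at_ inord_val.
Qed.

Lemma at_ffun r (h : nat -> flag K n) j : (j <= r)%N -> at_ [ffun i : 'I_r.+1 => h i] j = h j.
Proof. by move=> jr; rewrite /at_ ffunE inordK. Qed.

Lemma pm_word_chain (a : seq 'I_n) (G : M) : chain a (fun j => G *m pm (word_perm (take j a))).
Proof.
move=> j i e; have ja : (j < size a)%N by rewrite -onthTE e.
have en : nth i a j = i by apply: onth_nth e.
rewrite (take_nth i ja) en -cats1 word_perm_cat pmM /=.
exists 1%:M, 1%:M; split; try exact: borel1.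
by rewrite !mulmx1 mulmxA /comp_perm mul1g.
Qed.

End Points.

Section Gluing.
Variables (K : fieldType) (n : nat).
Notation M := 'M[K]_n.+1.
Notation w0 := (longest n).
Notation fl := (@flag_of_mx K n).
Variables (b1 b2 a1 a2 : seq 'I_n) (w : 'S_n.+1).
Let v := comp_perm w^-1 w0.
Hypotheses (ra1 : reduced_word a1 v) (ra2 : reduced_word a2 w).
Let q := comp_perm v^-1 w0.
Let l1 := size a1.
Let s1 := size b1.
Let s2 := size b2.

(** The unipotent matrices that fix the coordinate flag of v^-1. *)
Definition cell_group (c : M) := ptri v c /\ unip c.

Lemma cell_groupM c d : cell_group c -> cell_group d -> cell_group (c *m d).
Proof. by move=> [h1 h2] [h3 h4]; split; [apply: ptriM | apply: (unipM h1 h3)]. Qed.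
Lemma cell_group_unit c : cell_group c -> c \in unitmx.
Proof. by move=> [h1 h2]; apply: unip_unit h1 h2. Qed.
Lemma cell_groupV c : cell_group c -> cell_group (invmx c).
Proof.
move=> h; have [h1 h2] := h; split; last exact: unipV h1 h2.
by apply: ptriV => //; apply: cell_group_unit.
Qed.

Lemma cell_group_conj N : uptri N -> unip N -> cell_group (pm v^-1 *m N *m pm v).
Proof.
move=> h1 h2; split; last exact: unip_conjV.
by have := ptri_conjV (w := v) h1; rewrite mulg1.
Qed.

Lemma cell_group_conjV c : cell_group c -> uptri (pm v *m c *m pm v^-1) /\ unip (pm v *m c *m pm v^-1).
Proof.
move=> [h1 h2]; split; last exact: unip_conj.
by have := ptri_conj (w := v) h1; rewrite mulVg.
Qed.

Lemma vq : pm v *m pm q = pm w0 :> M.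
Proof. by rewrite /q pmM mulmxA pmKV mul1mx. Qed.

Lemma w0K : pm w0 *m pm w0 = 1%:M :> M.
Proof. by have := @pmKV K n w0; rewrite longestK. Qed.

Lemma qE : pm q = pm v^-1 *m pm w0 :> M.
Proof. by rewrite /q pmM. Qed.

Lemma wvE : pm w^-1 = pm v *m pm w0 :> M.
Proof. by rewrite /v pmM -mulmxA w0K mulmx1. Qed.

Lemma vwE : pm v^-1 = pm w0 *m pm w :> M.
Proof.
apply: (row_free_inj (A := pm v)); rewrite ?row_free_unit ?pm_unit //.
by rewrite pmVK /v pmM mulmxA -(mulmxA _ (pm w) (pm w^-1)) pmKV mulmx1 w0K.
Qed.

Lemma borel_conj_diag u (D : M) : (forall u', ptri u' D) -> D \in unitmx ->
  borel (pm u *m D *m pm u^-1).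
Proof.
move=> hD uD; split; last by rewrite !unitmx_mul !pm_unit uD.
by have := ptri_conj (w := u) (hD u); rewrite mulVg.
Qed.

(** Along a1 the flags leave the standard one inside the cell of v, an orbit of
    cell_group once it is read through v^-1. *)
Lemma first_cell m : framed (a1 ++ b1) m ->
  exists c U, [/\ cell_group c, borel U & pm v^-1 *m m l1 = c *m U].
Proof.
move=> [um m0 _ /chain_catl hc].
have [U [U' [hU hU' e]]] := chain_bruhat (reduced_ascending ra1) hc.
have [ew _] := ra1; rewrite ew in e.
have [hB uB] := borelM m0 hU; have [N [D [hN h1 hD uD eND]]] := uptri_split hB uB.
exists (pm v^-1 *m N *m pm v), (pm v^-1 *m D *m pm v *m U'); split.
- exact: cell_group_conj.
- by apply: borelM => //; have := borel_conj_diag (v^-1)%g hD uD; rewrite invgK.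
rewrite e eND -!mulmxA; congr (_ *m (_ *m _)).
by rewrite [RHS]mulmxA pmKV mul1mx.
Qed.

(** Reading a2 backwards from the antistandard flag leads in the same way to an
    orbit of cell_group. *)
Lemma second_cell m : framed (b2 ++ a2) m ->
  exists c U, [/\ cell_group c, borel U & pm q *m m s2 = c *m pm w0 *m U].
Proof.
move=> [um _ mr /chain_catr hc].
have [U [U' [hU hU' e]]] := chain_bruhat (reduced_ascending ra2) hc.
have [ew _] := ra2; rewrite ew addn0 -size_cat in e.
set mE := m (size (b2 ++ a2)) in mr e.
have [hB uB] := borelM mr (borelV hU').
have [N [D [hN h1 hD uD eND]]] := uptri_split hB uB.
exists (pm v^-1 *m N *m pm v), (pm w *m D *m pm w^-1 *m invmx U); split.
- exact: cell_group_conj.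
- by apply: borelM; [apply: borel_conj_diag | apply: borelV].
have [_ uU] := hU; have [_ uU'] := hU'.
have e1 : m s2 = mE *m invmx U' *m pm w^-1 *m invmx U.
  by rewrite e mulmxK // -(mulmxA _ (pm w) (pm w^-1)) pmKV mulmx1 mulmxK.
have e2 : mE *m invmx U' = pm w0 *m N *m D.
  by rewrite -mulmxA -eND !mulmxA pmKV mul1mx.
rewrite e1 e2 qE !mulmxA -(mulmxA _ (pm w0) (pm w0)) w0K mulmx1.
by rewrite -(mulmxA _ (pm v) (pm w0)) -wvE -(mulmxA _ (pm w^-1) (pm w)) pmVK mulmx1.
Qed.

(** G is a frame of the flag after a1, and H of the flag before a2. *)
Definition glued c (G H : M) :=
  [/\ cell_group c, borel (c *m pm v^-1 *m G) & borel (pm w0^-1 *m c *m pm q *m H)].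

(** Relative to the translations c1 and c2 of the two cells, the matrix c is
    found by an LU decomposition inside cell_group. *)
Lemma glued_exists m1 m2 : framed (a1 ++ b1) m1 -> framed (b2 ++ a2) m2 ->
  exists c, glued c (m1 l1) (m2 s2).
Proof.
move=> h1 h2.
have [c1 [U1 [g1 hU1 e1]]] := first_cell h1; have [c2 [U2 [g2 hU2 e2]]] := second_cell h2.
have gA := cell_groupM (cell_groupV g2) g1.
have [L [hL hL1 hLA hLp]] := LU (fun k : 'I_n.+1 => corner_unip k gA.1 gA.2).
have gL : cell_group L by split; [apply: hLp gA.1 | ].
have gc := cell_groupM gL (cell_groupV g2).
exists (L *m invmx c2); split=> //.
  rewrite -mulmxA e1 mulmxA; apply: borelM => //.
  rewrite -mulmxA; split=> //; rewrite !unitmx_mul unitmx_inv !cell_group_unit //.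
rewrite -mulmxA e2 !mulmxA -(mulmxA _ (invmx c2)) mulVmx ?cell_group_unit // mulmx1.
apply: borelM => //; split; last by rewrite !unitmx_mul !pm_unit cell_group_unit.
have := ptri_conjV (w := w0) hL; rewrite -{2}longestK mulgV //.
Qed.

(** The matrix d c^-1 is upper and lower triangular with zero diagonal. In this
    linear form the lemma also serves for the linear system that determines
    c. *)
Lemma glued_inj c G H (d : M) : glued c G H -> (forall i j, (v j <= v i)%N -> d i j = 0) ->
  uptri (d *m pm v^-1 *m G) -> uptri (pm w0^-1 *m d *m pm q *m H) -> d = 0.
Proof.
move=> [gc [h1 u1] [h2 u2]] hd d1 d2; have uc := cell_group_unit gc.
have [e ee] : exists e, e = d *m invmx c by eexists.
have ed : d = e *m c by rewrite ee mulmxKV.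
have he : uptri e.
  apply: (uptri_cancel (B := c *m pm v^-1 *m G)) => //.
  by rewrite !mulmxA -ed.
have he' : ptri w0 e.
  have : uptri (pm w0^-1 *m e *m pm w0).
    apply: (uptri_cancel (B := pm w0^-1 *m c *m pm q *m H)) => //.
    by rewrite !mulmxA -(mulmxA _ (pm w0) (pm w0^-1)) pmKV mulmx1 -(mulmxA _ e c) -ed.
  move=> /(ptri_conj (w := w0)); rewrite mulg1 !mulmxA pmKV mul1mx -mulmxA pmKV mulmx1.
  by rewrite longestK.
have eD := ptri_opposite he he'.
have e0 : e = 0.
  apply/matrixP => i j; rewrite [RHS]mxE; case: (eqVneq i j) => [<-|/eD //].
  rewrite ee mxE big1 // => k _; case: (leqP (v k) (v i)) => h; first by rewrite hd ?mul0r.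
  by rewrite (cell_groupV gc).1 ?mulr0.
by rewrite ed e0 mul0mx.
Qed.

Lemma uptriB (A B : M) : uptri A -> uptri B -> uptri (A - B).
Proof. by move=> hA hB i j ij; rewrite !mxE hA // hB // subr0. Qed.

Lemma glued_unique c c' G H : glued c G H -> glued c' G H -> c = c'.
Proof.
move=> h h'; apply/eqP; rewrite -subr_eq0; apply/eqP; apply: (glued_inj h).
- have [[p1 p2] _ _] := h; have [[p1' p2'] _ _] := h'.
  move=> i j; rewrite leq_eqVlt => /orP [/eqP/val_inj/perm_inj ->|ij]; rewrite !mxE.
    by rewrite p2 p2' subrr.
  by rewrite p1 // p1' // subr0.
- by have [_ [h1 _] _] := h; have [_ [h1' _] _] := h'; rewrite !mulmxBl; apply: uptriB.
- have [_ _ [h1 _]] := h; have [_ _ [h1' _]] := h'.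
  by rewrite mulmxBr !mulmxBl; apply: uptriB.
Qed.

(** The b1 part of the first point followed by the b2 part of the second
    one. *)
Definition glue_frames c (m1 m2 : nat -> M) (j : nat) : M :=
  if (j <= s1)%N then c *m pm v^-1 *m m1 (l1 + j)%N else c *m pm q *m m2 (j - s1)%N.

Lemma glue_framed c m1 m2 : framed (a1 ++ b1) m1 -> framed (b2 ++ a2) m2 ->
  glued c (m1 l1) (m2 s2) -> framed (b1 ++ b2) (glue_frames c m1 m2).
Proof.
move=> [u1 m10 m1r h1] [u2 m20 m2r h2] [gc g1 g2]; have uc := cell_group_unit gc.
(* The last flag of the first point is moved to the first flag of the second
   one. *)
have junction : exists2 U, borel U & c *m pm v^-1 *m m1 (l1 + s1)%N *m U = c *m pm q *m m2 0%N.
  exists (invmx (pm w0^-1 *m m1 (l1 + s1)%N) *m m2 0%N).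
    by apply: borelM => //; apply: borelV; move: m1r; rewrite size_cat.
  set A := m1 _; have uA : A \in unitmx by apply: u1.
  have uA' : pm w0^-1 *m A \in unitmx by rewrite unitmx_mul pm_unit.
  have [B eB] : exists B, B = pm w0^-1 *m A by eexists.
  have eA : A = pm w0 *m B by rewrite eB mulmxA pmKV mul1mx.
  rewrite -eB in uA' *; rewrite eA !mulmxA mulmxK // qE !mulmxA //.
split.
- by move=> j; rewrite /glue_frames; case: ifP => _; rewrite !unitmx_mul uc !pm_unit ?u1 ?u2.
- by rewrite /glue_frames /= addn0.
- rewrite /glue_frames size_cat -/s1 -/s2; case: leqP => h.
    have s20 : s2 = 0%N by lia.
    rewrite s20 addn0; have [U hU e] := junction; rewrite s20 in g2.
    have e' : c *m pm v^-1 *m m1 (l1 + s1)%N = c *m pm q *m m2 0%N *m invmx U.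
      by rewrite -e mulmxK //; case: hU.
    by rewrite e' !mulmxA; apply: borelM; [exact: g2 | apply: borelV].
  by rewrite addKn !mulmxA.
- move=> j i; rewrite onth_cat; case: ltnP => js e; rewrite /glue_frames.
    rewrite (ltnW js) js addnS; apply/step_mull/h1.
    by rewrite onth_cat ltnNge leq_addr /= addKn.
  rewrite [(j < s1)%N]ltnNge js /= -/s1.
  have hs : step i (c *m pm q *m m2 (j - s1)%N) (c *m pm q *m m2 (j.+1 - s1)%N).
    rewrite subSn //; apply/step_mull/h2; rewrite onth_cat -onthTE e //.
  case: leqP => h //; have ej : j = s1 by apply/eqP; rewrite eqn_leq h.
  have [U hU e'] := junction; move: hs; rewrite ej subnn -e'; apply: step_borel hU.
Qed.

Local Notation P1 := (flag_seq K n (size (a1 ++ b1))).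
Local Notation P2 := (flag_seq K n (size (b2 ++ a2))).
Local Notation X1 := (@braid_variety K n (a1 ++ b1)).
Local Notation X2 := (@braid_variety K n (b2 ++ a2)).
Local Notation X := (@braid_variety K n (b1 ++ b2)).

Definition is_glue (p1 : P1) (p2 : P2) (c : M) := [/\ cell_group c, mxact (c *m pm v^-1) (at_ p1 l1) = std_flag K n &
  mxact (c *m pm q) (at_ p2 s2) = ant_flag K n].

Definition splice (c : M) (p1 : P1) (p2 : P2) : flag_seq K n (size (b1 ++ b2)) :=
  [ffun j : 'I_(size (b1 ++ b2)).+1 =>
    if (j <= s1)%N then mxact (c *m pm v^-1) (at_ p1 (l1 + j)%N)
    else mxact (c *m pm q) (at_ p2 (j - s1)%N)].

Lemma is_glueP (p1 : P1) (p2 : P2) c G H : G \in unitmx -> H \in unitmx ->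
  at_ p1 l1 = fl G -> at_ p2 s2 = fl H -> is_glue p1 p2 c <-> glued c G H.
Proof.
move=> uG uH e1 e2.
have h : cell_group c -> (mxact (c *m pm v^-1) (at_ p1 l1) = std_flag K n <-> borel (c *m pm v^-1 *m G))
   /\ (mxact (c *m pm q) (at_ p2 s2) = ant_flag K n <-> borel (pm w0^-1 *m c *m pm q *m H)).
  move=> gc; have uc := cell_group_unit gc; rewrite e1 e2 !mxact_fl; split.
    by apply: fl_std; rewrite !unitmx_mul uc pm_unit.
  rewrite -!(mulmxA (pm w0^-1)) -mulmxA !mulmxA -2!(mulmxA (pm w0^-1)).
  by apply: fl_ant; rewrite !unitmx_mul uc pm_unit.
by split=> -[gc h1 h2]; have [E1 E2] := h gc; split=> //; [apply/E1|apply/E2|apply/E1|apply/E2].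
Qed.

Lemma splice_frames c (p1 : P1) (p2 : P2) m1 m2 j :
  (forall j, (j <= size (a1 ++ b1))%N -> at_ p1 j = fl (m1 j)) ->
  (forall j, (j <= size (b2 ++ a2))%N -> at_ p2 j = fl (m2 j)) ->
  (j <= size (b1 ++ b2))%N -> at_ (splice c p1 p2) j = fl (glue_frames c m1 m2 j).
Proof.
move=> h1 h2 hj; rewrite /at_ ffunE inordK // /glue_frames; rewrite size_cat in hj.
case: ifP => js; rewrite -mxact_fl; congr mxact.
  by apply: h1; rewrite size_cat leq_add2l.
by apply: h2; rewrite size_cat; rewrite -/s1 -/s2 in hj *; lia.
Qed.

Lemma splice_bv c (p1 : P1) (p2 : P2) : X1 p1 -> X2 p2 -> is_glue p1 p2 c -> X (splice c p1 p2).
Proof.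
move=> x1 x2; have [m1 [u1 e1]] := bv_frames x1; have [m2 [u2 e2]] := bv_frames x2.
have f1 := frames_chain x1 u1 e1; have f2 := frames_chain x2 u2 e2.
have l1a : (l1 <= size (a1 ++ b1))%N by rewrite size_cat leq_addr.
have s2a : (s2 <= size (b2 ++ a2))%N by rewrite size_cat leq_addr.
move/(is_glueP _ (u1 _) (u2 _) (e1 _ l1a) (e2 _ s2a)) => g.
have := framed_bv (glue_framed f1 f2 g); congr X; apply: at_eq => j hj.
rewrite (splice_frames c e1 e2 hj).
exact: (at_ffun (fun j => fl (glue_frames c m1 m2 j)) hj).
Qed.

Lemma is_glue_exists (p1 : P1) (p2 : P2) : X1 p1 -> X2 p2 -> exists c, is_glue p1 p2 c.
Proof.
move=> x1 x2; have [m1 [u1 e1]] := bv_frames x1; have [m2 [u2 e2]] := bv_frames x2.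
have [c g] := glued_exists (frames_chain x1 u1 e1) (frames_chain x2 u2 e2).
have l1a : (l1 <= size (a1 ++ b1))%N by rewrite size_cat leq_addr.
have s2a : (s2 <= size (b2 ++ a2))%N by rewrite size_cat leq_addr.
by exists c; apply/(is_glueP _ (u1 _) (u2 _) (e1 _ l1a) (e2 _ s2a)).
Qed.

Lemma is_glue_unique (p1 : P1) (p2 : P2) c c' : X1 p1 -> X2 p2 -> is_glue p1 p2 c -> is_glue p1 p2 c' -> c = c'.
Proof.
move=> x1 x2; have [m1 [u1 e1]] := bv_frames x1; have [m2 [u2 e2]] := bv_frames x2.
have l1a : (l1 <= size (a1 ++ b1))%N by rewrite size_cat leq_addr.
have s2a : (s2 <= size (b2 ++ a2))%N by rewrite size_cat leq_addr.
move=> /(is_glueP _ (u1 _) (u2 _) (e1 _ l1a) (e2 _ s2a)) g.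
move=> /(is_glueP _ (u1 _) (u2 _) (e1 _ l1a) (e2 _ s2a)) g'.
exact: glued_unique g g'.
Qed.

(** An LU decomposition of the middle frame provides c, and coordinate flags
    along a1 and a2 supply the missing parts of the two points. *)
Lemma splice_onto x m : X x -> (forall j, m j \in unitmx) ->
  (forall j, (j <= size (b1 ++ b2))%N -> at_ x j = fl (m j)) ->
  (forall k : 'I_n.+1, corner k (pm w0^-1 *m pm v *m m s1) \in unitmx) ->
  exists p1 p2 c, [/\ X1 p1, X2 p2, is_glue p1 p2 c & splice c p1 p2 = x].
Proof.
move=> hx um em hA; have [_ m0 mr hm] := frames_chain hx um em.
set A := _ *m m s1 in hA; have uA : A \in unitmx by rewrite !unitmx_mul !pm_unit um.
have [L [hL hL1 hLA _]] := LU hA; have uL := unip_unit hL hL1.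
pose N := pm w0 *m invmx L *m pm w0^-1.
have hN : uptri N by have := ptri_conj (w := w0) (ptriV hL uL); rewrite mulVg.
have hN1 : unip N by apply: unip_conj; apply: unipV hL hL1.
have gc := cell_group_conj hN hN1; set c := _ *m _ *m _ in gc.
have uc := cell_group_unit gc.
pose U := L *m A; have hU : borel U by split=> //; rewrite unitmx_mul uL.
have ems : m s1 = c *m pm q *m U.
  rewrite /c qE /U /N !mulmxA -(mulmxA _ (pm v) (pm v^-1)) pmKV mulmx1.
  rewrite -(mulmxA _ (pm w0^-1) (pm w0)) pmVK mulmx1 mulmxKV // /A ?mulmxA.
  by rewrite -(mulmxA _ (pm w0) (pm w0^-1)) pmKV mulmx1 pmVK mul1mx.
clearbody U c.
pose r := size (b1 ++ b2).
have er : r = (s1 + s2)%N by rewrite /r size_cat.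
pose B := pm w0^-1 *m m r; have eB : m r = pm w0 *m B by rewrite /B mulmxA pmKV mul1mx.
have hB : borel B by [].
pose P := pm v *m invmx c; have uP : P \in unitmx by rewrite unitmx_mul pm_unit unitmx_inv.
have cP : c *m pm v^-1 *m P = 1%:M.
  by rewrite /P mulmxA -(mulmxA _ (pm v^-1)) pmVK mulmx1 mulmxV.
have [n1 n2] := cell_group_conjV (cell_groupV gc); set N' := _ *m pm v^-1 in n1 n2.
have hN' : borel N' by apply: borel_unip.
have eN' : N' *m pm v = P by rewrite /N' -mulmxA pmVK mulmx1.
pose R := pm q^-1 *m invmx c; have uR : R \in unitmx by rewrite unitmx_mul pm_unit unitmx_inv.
have cR : c *m pm q *m R = 1%:M.
  by rewrite /R mulmxA -(mulmxA _ (pm q)) pmKV mulmx1 mulmxV.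
have eU : R *m m s1 = U.
  by rewrite ems /R -!mulmxA (mulmxA (invmx c)) mulVmx // mul1mx mulmxA pmVK mul1mx.
pose Q := R *m pm w0; have uQ : Q \in unitmx by rewrite unitmx_mul uR pm_unit.
have cQ : c *m pm q *m Q = pm w0 by rewrite /Q mulmxA cR mul1mx.
have eQ : pm w0^-1 *m Q *m pm w = N'.
  rewrite /Q /R -!mulmxA -vwE /N' !mulmxA; congr (_ *m _ *m _).
  apply: (row_free_inj (A := pm q)); rewrite ?row_free_unit ?pm_unit //.
  by rewrite -mulmxA pmVK mulmx1 vq longestK.
pose k1 j := if (j <= l1)%N then N' *m pm (word_perm (take j a1)) else P *m m (j - l1)%N.
pose k2 j := if (j < s2)%N then R *m m (s1 + j)%N else Q *m pm (word_perm (take (j - s2) a2)).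
have [ew1 _] := ra1; have [ew2 _] := ra2.
have k1l : k1 l1 = P by rewrite /k1 leqnn take_size ew1.
have k2s : k2 s2 = Q by rewrite /k2 ltnn subnn take0 pm1 mulmx1.
have uk1 j : k1 j \in unitmx.
  by rewrite /k1; case: ifP => _; rewrite unitmx_mul ?uP ?um ?pm_unit ?(proj2 hN').
have uk2 j : k2 j \in unitmx.
  by rewrite /k2; case: ifP => _; rewrite unitmx_mul ?uR ?uQ ?um ?pm_unit.
have f1 : framed (a1 ++ b1) k1.
  have e1 : pm w0^-1 *m (P *m m s1) = U.
    rewrite ems /P -!mulmxA (mulmxA (invmx c) c) mulVmx // mul1mx.
    by rewrite (mulmxA (pm v)) vq mulmxA pmVK mul1mx.
  split=> //.
  - by rewrite /k1 /= take0 pm1 mulmx1.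
  - rewrite size_cat -/l1 -/s1 /k1; case: leqP => h; last by rewrite addKn e1.
    have s10 : s1 = 0%N by lia.
    rewrite s10 addn0 take_size ew1 eN'; have := borelM hU (borelV m0).
    by rewrite -e1 s10 -!mulmxA mulmxV ?um // mulmx1.
  - move=> j i; rewrite onth_cat; case: ltnP => jl e.
      by rewrite /k1 jl (ltnW jl); apply: (pm_word_chain N' e).
    have hs : step i (P *m m (j - l1)%N) (P *m m (j.+1 - l1)%N).
      by rewrite subSn //; apply/step_mull/hm; rewrite onth_cat -onthTE e.
    rewrite {2}/k1 ltnNge jl /=; rewrite /k1; case: leqP => // h.
    have ej : j = l1 by apply/eqP; rewrite eqn_leq h.
    rewrite ej take_size ew1 eN'; apply: (step_borel m0).
    by move: hs; rewrite ej subnn.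
have f2 : framed (b2 ++ a2) k2.
  split=> //.
  - rewrite /k2 addn0 eU; case: posnP => // s20.
    rewrite s20 /= take0 pm1 mulmx1.
    have -> : Q = U *m invmx B.
      have ms : m s1 = m r by rewrite er s20 addn0.
      rewrite -eU ms eB mulmxA mulmxK //.
      by case: hB.
    by apply: borelM => //; apply: borelV.
  - rewrite /k2 size_cat -/s2 ltnNge leq_addr /= addKn take_size ew2 mulmxA eQ //.
  - move=> j i; rewrite onth_cat; case: ltnP => js e; last first.
      rewrite /k2 ltnNge js [(j.+1 < _)%N]ltnNge (leqW js) /= subSn //.
      by apply: (pm_word_chain Q e).
    have hs : step i (R *m m (s1 + j)%N) (R *m m (s1 + j.+1)%N).
      apply: step_mull; rewrite addnS; apply: hm.
      by rewrite onth_cat ltnNge leq_addr /= addKn.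
    rewrite /k2 js; case: ltnP => h //; have ej : j.+1 = s2 by apply/eqP; rewrite eqn_leq js.
    rewrite ej subnn take0 pm1 mulmx1.
    have -> : Q = R *m m (s1 + j.+1)%N *m invmx B.
      by rewrite ej -er eB mulmxA mulmxK //; case: hB.
    by apply: step_borelr => //; apply: borelV.
pose p1 : P1 := [ffun j : 'I_(size (a1 ++ b1)).+1 => fl (k1 j)].
pose p2 : P2 := [ffun j : 'I_(size (b2 ++ a2)).+1 => fl (k2 j)].
have e1 j : (j <= size (a1 ++ b1))%N -> at_ p1 j = fl (k1 j).
  exact: (at_ffun (fun j => fl (k1 j))).
have e2 j : (j <= size (b2 ++ a2))%N -> at_ p2 j = fl (k2 j).
  exact: (at_ffun (fun j => fl (k2 j))).
have l1a : (l1 <= size (a1 ++ b1))%N by rewrite size_cat leq_addr.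
have s2a : (s2 <= size (b2 ++ a2))%N by rewrite size_cat leq_addr.
exists p1, p2, c; split.
- exact: framed_bv f1.
- exact: framed_bv f2.
- apply/(is_glueP _ (uk1 _) (uk2 _) (e1 _ l1a) (e2 _ s2a)); split=> //.
    by rewrite k1l cP; apply: borel1.
  by rewrite k2s -(mulmxA _ (pm q)) -(mulmxA _ c) (mulmxA c) cQ pmVK; apply: borel1.
- apply: at_eq => j hj; rewrite (splice_frames c e1 e2 hj) em //.
  rewrite /glue_frames; case: leqP => js.
    rewrite /k1; case: (posnP j) => [->|j0].
      rewrite addn0 leqnn take_size ew1 eN' cP.
      by rewrite -std_flagE; apply/esym/fl_std.
    by rewrite leqNgt -{1}(addn0 l1) ltn_add2l j0 /= addKn mulmxA cP mul1mx.
  rewrite /k2; case: ltnP => h; first by rewrite subnKC 1?ltnW // mulmxA cR mul1mx.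
  have -> : j = r by rewrite er; rewrite -/r er in hj; lia.
  rewrite er addKn subnn take0 pm1 mulmx1 cQ -ant_flagE.
  by apply/esym/fl_ant => //; rewrite -er.
Qed.

End Gluing.

(** * Regular functions *)

Section RegularFunctions.
Variables (K : fieldType) (n r : nat) (Z : flag_seq K n r -> Prop).
Notation frames := (frames K n r).
Notation ev p M := (p.@[entries M]).
Implicit Types (M : frames) (g h : frames -> K).

Definition good M := invertible_frames M /\ Z (flags_of M).

(** Regularity at M0, in terms of frames; regular_on asks for it at every good
    M0. *)
Definition regat M0 g := exists p q, ev q M0 != 0 /\
  forall M, good M -> ev q M != 0 -> g M = ev p M / ev q M.

Lemma regularP phi : regular_on Z phi <-> forall M, good M -> regat M (fun M => phi (flags_of M)).
Proof.
split=> [h M [uM zM]|h M uM zM].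
  by have [p [q [q0 hq]]] := h M uM zM; exists p, q; split=> // M' [uM' zM']; apply: hq.
by have [p [q [q0 hq]]] := h M (conj uM zM); exists p, q; split=> // M' uM' zM'; apply: hq.
Qed.

Variable M0 : frames.
Notation reg := (regat M0).

Lemma regat_ext g h : (forall M, good M -> g M = h M) -> reg h -> reg g.
Proof. by move=> e [p [q [q0 hq]]]; exists p, q; split=> // M gM qM; rewrite e // hq. Qed.

Lemma regat_cst c : reg (fun=> c).
Proof.
exists c%:MP, 1; rewrite meval1 oner_neq0; split=> // M _ _.
by rewrite mevalC meval1 divr1.
Qed.

Lemma regat_entry j a b : reg (fun M => M j a b).
Proof.
pose t : entry_index n r := (j, (a, b)).
exists 'X_(enum_rank t), 1; rewrite meval1 oner_neq0; split=> // M _ _.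
by rewrite mevalXU meval1 divr1 /entries enum_rankK.
Qed.

Lemma regat_add g h : reg g -> reg h -> reg (fun M => g M + h M).
Proof.
move=> [p [q [q0 hq]]] [p' [q' [q0' hq']]].
exists (p * q' + p' * q), (q * q'); rewrite mevalM mulf_neq0 //; split=> // M gM.
rewrite mevalM mulf_eq0 negb_or => /andP [h1 h2].
by rewrite hq // hq' // mevalD !mevalM addf_div.
Qed.

Lemma regat_mul g h : reg g -> reg h -> reg (fun M => g M * h M).
Proof.
move=> [p [q [q0 hq]]] [p' [q' [q0' hq']]].
exists (p * p'), (q * q'); rewrite mevalM mulf_neq0 //; split=> // M gM.
rewrite mevalM mulf_eq0 negb_or => /andP [h1 h2].
by rewrite hq // hq' // !mevalM mulf_div.
Qed.

Lemma regat_opp g : reg g -> reg (fun M => - g M).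
Proof.
move=> hg; apply: (regat_ext _ (regat_mul (regat_cst (-1)) hg)) => M _.
by rewrite mulN1r.
Qed.

Lemma regat_sum (I : Type) (s : seq I) (P : pred I) (g : I -> frames -> K) :
  (forall i, P i -> reg (g i)) -> reg (fun M => \sum_(i <- s | P i) g i M).
Proof.
move=> hg; elim: s => [|i s IH].
  by apply: (regat_ext _ (regat_cst 0)) => M _; rewrite big_nil.
apply: (@regat_ext _ (fun M => (if P i then g i M else 0) + \sum_(i <- s | P i) g i M)).
  by move=> M _; rewrite big_cons; case: ifP; rewrite ?add0r.
apply: regat_add => //; case Pi : (P i); [exact: hg | exact: regat_cst].
Qed.

Lemma regat_prod (I : Type) (s : seq I) (P : pred I) (g : I -> frames -> K) :
  (forall i, P i -> reg (g i)) -> reg (fun M => \prod_(i <- s | P i) g i M).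
Proof.
move=> hg; elim: s => [|i s IH].
  by apply: (regat_ext _ (regat_cst 1)) => M _; rewrite big_nil.
apply: (@regat_ext _ (fun M => (if P i then g i M else 1) * \prod_(i <- s | P i) g i M)).
  by move=> M _; rewrite big_cons; case: ifP; rewrite ?mul1r.
apply: regat_mul => //; case Pi : (P i); [exact: hg | exact: regat_cst].
Qed.

Lemma regat_exp g k : reg g -> reg (fun M => g M ^+ k).
Proof.
move=> hg; elim: k => [|k IH]; first by apply: (regat_ext _ (regat_cst 1)) => M _; rewrite expr0.
by apply: (regat_ext _ (regat_mul hg IH)) => M _; rewrite exprS.
Qed.

Lemma regat_meval N (p : {mpoly K[N]}) (v : 'I_N -> frames -> K) :
  (forall i, reg (v i)) -> reg (fun M => p.@[fun i => v i M]).
Proof.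
move=> hv; apply: (@regat_ext _ (fun M => \sum_(m <- msupp p) p@_m * \prod_i v i M ^+ m i)).
  by move=> M _; rewrite mevalE.
apply: regat_sum => m _; apply: regat_mul; first exact: regat_cst.
by apply: regat_prod => i _; apply: regat_exp.
Qed.

Hypothesis gM0 : good M0.

(** It is enough to know g where h does not vanish. *)
Lemma regat_local g g' h : reg h -> h M0 != 0 -> reg g' ->
  (forall M, good M -> h M != 0 -> g M = g' M) -> reg g.
Proof.
move=> [ph [qh [qh0 hh]]] h0 [p [q [q0 hq]]] e.
have ph0 : ev ph M0 != 0.
  by apply: contraNneq h0 => ph0; rewrite hh // ph0 mul0r.
exists (p * (qh * ph)), (q * (qh * ph)); rewrite !mevalM !mulf_neq0 //; split=> // M gM.
rewrite !mevalM !mulf_eq0 !negb_or => /and3P [h1 h2 h3].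
rewrite e // ?hq //; last by rewrite hh // mulf_neq0 ?invr_eq0.
by rewrite -mulf_div divff ?mulr1 // mulf_neq0.
Qed.

Lemma regat_inv g : reg g -> g M0 != 0 -> reg (fun M => (g M)^-1).
Proof.
move=> [p [q [q0 hq]]] g0.
have p0 : ev p M0 != 0.
  by apply: contraNneq g0 => p0; rewrite hq // p0 mul0r.
exists (q * q), (p * q); rewrite mevalM mulf_neq0 //; split=> // M gM.
rewrite mevalM mulf_eq0 negb_or => /andP [h1 h2].
by rewrite hq // invf_div mevalM -mulf_div divff // mulr1.
Qed.

Definition mxreg a b (A : frames -> 'M[K]_(a, b)) := forall i j, reg (fun M => A M i j).

Lemma mxreg_cst a b (A : 'M[K]_(a, b)) : mxreg (fun=> A).
Proof. by move=> i j; apply: regat_cst. Qed.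

Lemma mxreg_frame j : mxreg (fun M => M j).
Proof. by move=> a b; apply: regat_entry. Qed.

Lemma mxreg_ext a b (A B : frames -> 'M[K]_(a, b)) :
  (forall M, good M -> A M = B M) -> mxreg B -> mxreg A.
Proof. by move=> e h i j; apply: regat_ext (h i j) => M gM; rewrite e. Qed.

Lemma mxreg_mul a b c (A : frames -> 'M[K]_(a, b)) (B : frames -> 'M[K]_(b, c)) :
  mxreg A -> mxreg B -> mxreg (fun M => A M *m B M).
Proof.
move=> hA hB i j; apply: (@regat_ext _ (fun M => \sum_k A M i k * B M k j)).
  by move=> M _; rewrite mxE.
by apply: regat_sum => k _; apply: regat_mul.
Qed.

Lemma regat_det a (A : frames -> 'M[K]_a) : mxreg A -> reg (fun M => \det (A M)).
Proof.
move=> hA; apply: regat_sum => s _; apply: regat_mul; first exact: regat_cst.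
by apply: regat_prod => i _; apply: hA.
Qed.

Lemma mxreg_inv a (A : frames -> 'M[K]_a) : mxreg A -> A M0 \in unitmx ->
  mxreg (fun M => invmx (A M)).
Proof.
move=> hA uA i j; have d0 : \det (A M0) != 0 by rewrite -unitfE -unitmxE.
apply: (@regat_local _ (fun M => (\det (A M))^-1 * (\adj (A M)) i j) (fun M => \det (A M))) => //.
- exact: regat_det.
- apply: regat_mul; first by apply: regat_inv => //; apply: regat_det.
  apply: (@regat_ext _ (fun M => (-1) ^+ (j + i) * \det (row' j (col' i (A M))))).
    by move=> M _; rewrite mxE /cofactor.
  apply: regat_mul; first exact: regat_cst.
  apply: regat_det => k l; apply: (@regat_ext _ (fun M => A M (lift j k) (lift i l))).
    by move=> M _; rewrite !mxE.
  exact: hA.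
- by move=> M _ dM; rewrite /invmx unitmxE unitfE dM mxE.
Qed.

(** Cramer's rule: suitable combinations of the equations form a system that is
    invertible at M0, hence near it. *)
Lemma mxreg_solve a b (c : frames -> 'rV[K]_a) (S : frames -> 'M[K]_(a, b)) (t : frames -> 'rV[K]_b) :
  mxreg S -> mxreg t -> (forall M, good M -> c M *m S M = t M) ->
  (forall d : 'rV[K]_a, d *m S M0 = 0 -> d = 0) -> mxreg c.
Proof.
move=> hS ht hc inj.
have rf : row_free (S M0).
  rewrite -kermx_eq0; apply/eqP/row_matrixP => i; rewrite row0; apply: inj.
  by rewrite -row_mul mulmx_ker row0.
pose R := pinvmx (S M0); have SR : S M0 *m R = 1%:M by apply: mulmxVp.
have hSR : mxreg (fun M => S M *m R) by apply: mxreg_mul => //; apply: mxreg_cst.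
move=> i j; apply: (@regat_local _ (fun M => ((t M *m R) *m invmx (S M *m R)) i j)
   (fun M => \det (S M *m R))).
- exact: regat_det.
- by rewrite SR det1 oner_neq0.
- apply: mxreg_mul; first by apply: mxreg_mul => //; apply: mxreg_cst.
  by apply: mxreg_inv => //; rewrite SR unitmx1.
- by move=> M gM dM; rewrite -hc // -(mulmxA (c M)) mulmxK // unitmxE unitfE.
Qed.

End RegularFunctions.

Section Pullback.
Variables (K : fieldType) (n r r' : nat).
Variables (Z : flag_seq K n r -> Prop) (Z' : flag_seq K n r' -> Prop).

(** A map between varieties of flags is regular when frames of the image can be
    chosen to depend regularly on the frames of the point. *)
Lemma regular_pullback (psi : flag_seq K n r -> flag_seq K n r')
    (N : frames K n r -> frames K n r') phi :
  (forall M, good Z M -> invertible_frames (N M) /\ flags_of (N M) = psi (flags_of M)) ->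
  (forall M, good Z M -> Z' (psi (flags_of M))) ->
  (forall M0, good Z M0 -> forall j, mxreg Z M0 (fun M => N M j)) ->
  regular_on Z' phi -> regular_on Z (fun x => phi (psi x)).
Proof.
move=> hN hZ hreg /regularP hphi; apply/regularP => M0 gM0.
have gN M : good Z M -> good Z' (N M).
  by move=> gM; have [uN eN] := hN M gM; split=> //; rewrite eN; apply: hZ.
have [p [q [q0 hq]]] := hphi _ (gN _ gM0).
have ev_reg (p' : {mpoly K[#|{: entry_index n r'}|]}) : regat Z M0 (fun M => p'.@[entries (N M)]).
  apply: (@regat_meval K n r Z M0 _ p' (fun t M => entries (N M) t)) => t.
  by rewrite /entries; case: (enum_val t) => j [a b]; apply: hreg.
apply: (@regat_local _ _ _ _ _ gM0 _ (fun M => p.@[entries (N M)] * (q.@[entries (N M)])^-1) (fun M => q.@[entries (N M)])) => //.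
- by apply: regat_mul => //; apply: regat_inv.
- move=> M gM qM; have [_ <-] := hN M gM; apply: hq => //; exact: gN.
Qed.

End Pullback.

(** * Regularity of the splicing *)

Section RegularGluing.
Variables (K : fieldType) (n r : nat) (Z : flag_seq K n r -> Prop) (w : 'S_n.+1).
Notation M := 'M[K]_n.+1.
Notation w0 := (longest n).
Let v := comp_perm w^-1 w0.
Let q := comp_perm v^-1 w0.
Variable M0 : frames K n r.
Hypothesis gM0 : good Z M0.

Lemma mxreg_row_mx a b c (A : frames K n r -> 'M[K]_(a, b)) (B : frames K n r -> 'M[K]_(a, c)) :
  mxreg Z M0 A -> mxreg Z M0 B -> mxreg Z M0 (fun x => row_mx (A x) (B x)).
Proof.
move=> hA hB i j; rewrite -(splitK j); case: (split j) => k /=.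
  by apply: regat_ext (hA i k) => x _; rewrite row_mxEl.
by apply: regat_ext (hB i k) => x _; rewrite row_mxEr.
Qed.

(** Discards the columns for which a condition imposes nothing. *)
Definition keep (P : pred 'I_n.+1) (A : M) : M := \matrix_(k, b) if P b then A k b else 0.

Lemma mxreg_keep P A : mxreg Z M0 A -> mxreg Z M0 (fun x => keep P (A x)).
Proof.
move=> hA k b; case Pb : (P b).
  by apply: regat_ext (hA k b) => x _; rewrite mxE Pb.
by apply: (regat_ext _ (regat_cst _ _ 0)) => x _; rewrite mxE Pb.
Qed.

Lemma mul_keep P (d : 'rV[K]_n.+1) A b : (d *m keep P A) 0 b = if P b then (d *m A) 0 b else 0.
Proof.
rewrite !mxE; case Pb : (P b); first by apply: eq_bigr => k _; rewrite mxE Pb.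
by rewrite big1 // => k _; rewrite mxE Pb mulr0.
Qed.

Lemma w0w0 i : w0 (w0 i) = i. Proof. by rewrite !longestE rev_ordK. Qed.

Lemma pm_w0_mul (A : M) i b : (pm w0^-1 *m A) i b = A (w0 i) b.
Proof. by rewrite longestK -{1}(w0w0 i) pm_mull. Qed.

(** Row by row, the conditions on c are linear equations, and glued_inj is the
    uniqueness of their solution. *)
Lemma glued_regular (c G H : frames K n r -> M) :
  mxreg Z M0 G -> mxreg Z M0 H -> (forall x, good Z x -> glued w (c x) (G x) (H x)) ->
  mxreg Z M0 c.
Proof.
move=> hG hH hc a.
pose PX : pred 'I_n.+1 := fun b => (b < a)%N.
pose PY : pred 'I_n.+1 := fun b => (b < w0 a)%N.
pose PI : pred 'I_n.+1 := fun b => (v b <= v a)%N.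
pose S x := row_mx (row_mx (keep PX (pm v^-1 *m G x)) (keep PY (pm q *m H x))) (keep PI 1%:M).
pose t : frames K n r -> 'rV[K]_(n.+1 + n.+1 + n.+1) :=
  fun=> row_mx (row_mx 0 0) (\row_b if PI b then (a == b)%:R else 0).
have hS : mxreg Z M0 S.
  apply: mxreg_row_mx; last exact: mxreg_cst.
  by apply: mxreg_row_mx; apply: mxreg_keep; apply: mxreg_mul => //; apply: mxreg_cst.
have rowE x : row a (c x) *m (pm v^-1 *m G x) = row a (c x *m pm v^-1 *m G x).
  by rewrite -mulmxA row_mul.
have rowE' x : row a (c x) *m (pm q *m H x) = row a (c x *m (pm q *m H x)).
  by rewrite row_mul.
suff: mxreg Z M0 (fun x => row a (c x)).
  by move=> h j; apply: regat_ext (h 0 j) => x _; rewrite mxE.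
apply: (mxreg_solve gM0 hS (mxreg_cst _ _ (t M0))) => [x gx|d].
  have [[g1 g2] [/uptriP h1 _] [/uptriP h2 _]] := hc x gx.
  rewrite /S !mul_mx_row; congr (row_mx (row_mx _ _) _).
  - apply/rowP => b; rewrite mul_keep rowE [RHS]mxE /PX; case: ifP => // ba.
    by rewrite mxE h1.
  - apply/rowP => b; rewrite mul_keep rowE' [RHS]mxE /PY; case: ifP => // ba.
    have := h2 (w0 a) b ba; rewrite -!mulmxA pm_w0_mul w0w0 => <-.
    by rewrite mxE.
  - apply/rowP => b; rewrite mul_keep mulmx1 !mxE; case: ifP => // ba.
    move: ba; rewrite /PI leq_eqVlt => /orP [/eqP/val_inj/perm_inj ->|h].
      by rewrite g2 eqxx.
    by rewrite g1 //; case: eqP => // e; rewrite e ltnn in h.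
rewrite /S !mul_mx_row => /eqP; rewrite !row_mx_eq0.
move=> /andP [/andP [/eqP dX /eqP dY] /eqP dI].
pose D : M := \matrix_(i, j) if i == a then d 0 j else 0.
have Da : row a D = d by apply/rowP => j; rewrite !mxE eqxx.
have D0 i A b : i != a -> (D *m A) i b = 0.
  by move=> ia; rewrite mxE big1 // => k _; rewrite mxE (negbTE ia) mul0r.
have DA A b : (D *m A) a b = (d *m A) 0 b by rewrite !mxE; apply: eq_bigr => k _; rewrite mxE eqxx.
suff: D = 0 by move=> D00; rewrite -Da D00 row0.
apply: (glued_inj (hc M0 gM0)).
- move=> i j ji; rewrite mxE; case: eqP => // ei; rewrite ei in ji.
  by have := congr1 (fun u : 'rV__ => u 0 j) dI; rewrite mul_keep mulmx1 /PI ji => ->; rewrite mxE.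
- apply/uptriP => i b bi; rewrite -mulmxA; case: (eqVneq i a) => [ei|/D0 -> //].
  rewrite ei in bi *; rewrite DA.
  by have := congr1 (fun u : 'rV__ => u 0 b) dX; rewrite mul_keep /PX bi => ->; rewrite mxE.
- apply/uptriP => i b bi; rewrite -!mulmxA pm_w0_mul; case: (eqVneq (w0 i) a) => [ei|/D0 -> //].
  rewrite ei DA; have := congr1 (fun u : 'rV__ => u 0 b) dY.
  by rewrite mul_keep /PY -ei w0w0 bi => ->; rewrite mxE.
Qed.

End RegularGluing.

Section RegularSplicing.
Variables (K : fieldType) (n : nat).
Notation M := 'M[K]_n.+1.
Notation w0 := (longest n).
Notation fl := (@flag_of_mx K n).
Variables (b1 b2 a1 a2 : seq 'I_n) (w : 'S_n.+1).
Hypotheses (ra1 : reduced_word a1 (comp_perm w^-1 w0)) (ra2 : reduced_word a2 w).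
Let v := comp_perm w^-1 w0.
Let q := comp_perm v^-1 w0.
Local Notation X1 := (@braid_variety K n (a1 ++ b1)).
Local Notation X2 := (@braid_variety K n (b2 ++ a2)).
Local Notation X := (@braid_variety K n (b1 ++ b2)).
Local Notation P1 := (flag_seq K n (size (a1 ++ b1))).
Local Notation P2 := (flag_seq K n (size (b2 ++ a2))).

Definition glue_elt (p1 : P1) (p2 : P2) : M :=
  epsilon (inhabits (0 : M)) (@is_glue K n b1 b2 a1 a2 w p1 p2).

Definition spliced (p1 : P1) (p2 : P2) := splice w (glue_elt p1 p2) p1 p2.

Lemma glue_eltP p1 p2 : X1 p1 -> X2 p2 -> is_glue w p1 p2 (glue_elt p1 p2).
Proof. by move=> x1 x2; apply: epsilon_spec; apply: (is_glue_exists ra1 ra2 x1 x2). Qed.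

Lemma spliced_bv p1 p2 : X1 p1 -> X2 p2 -> X (spliced p1 p2).
Proof. by move=> x1 x2; apply: (splice_bv x1 x2); apply: glue_eltP. Qed.

Lemma spliced_onto x m : X x -> (forall j, m j \in unitmx) ->
  (forall j, (j <= size (b1 ++ b2))%N -> at_ x j = fl (m j)) ->
  (forall k : 'I_n.+1, corner k (pm w0^-1 *m pm v *m m (size b1)) \in unitmx) ->
  exists p1 p2, [/\ X1 p1, X2 p2 & spliced p1 p2 = x].
Proof.
move=> hx um em hA; have [p1 [p2 [c [x1 x2 gc <-]]]] := splice_onto ra1 ra2 hx um em hA.
exists p1, p2; split=> //; rewrite /spliced; congr splice.
exact: (is_glue_unique x1 x2 (glue_eltP x1 x2) gc).
Qed.

Lemma spliced_frames p1 p2 m1 m2 : X1 p1 -> X2 p2 ->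
  (forall j, m1 j \in unitmx) -> (forall j, m2 j \in unitmx) ->
  (forall j, (j <= size (a1 ++ b1))%N -> at_ p1 j = fl (m1 j)) ->
  (forall j, (j <= size (b2 ++ a2))%N -> at_ p2 j = fl (m2 j)) ->
  [/\ glued w (glue_elt p1 p2) (m1 (size a1)) (m2 (size b2)),
      forall j, glue_frames b1 a1 w (glue_elt p1 p2) m1 m2 j \in unitmx &
      [ffun j : 'I_(size (b1 ++ b2)).+1 => fl (glue_frames b1 a1 w (glue_elt p1 p2) m1 m2 j)]
        = spliced p1 p2].
Proof.
move=> x1 x2 u1 u2 e1 e2; have g := glue_eltP x1 x2.
have l1a : (size a1 <= size (a1 ++ b1))%N by rewrite size_cat leq_addr.
have s2a : (size b2 <= size (b2 ++ a2))%N by rewrite size_cat leq_addr.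
have gl := proj1 (is_glueP w _ (u1 _) (u2 _) (e1 _ l1a) (e2 _ s2a)) g.
split=> //.
  by have [] := glue_framed (frames_chain x1 u1 e1) (frames_chain x2 u2 e2) gl.
apply: at_eq => j hj; rewrite (splice_frames w _ e1 e2 hj).
exact: (at_ffun (fun j => fl (glue_frames b1 a1 w (glue_elt p1 p2) m1 m2 j)) hj).
Qed.

Lemma flags_at r (N : frames K n r) j : at_ (flags_of N) j = fl (N (inord j)).
Proof. by rewrite /at_ ffunE. Qed.

Lemma flags_glue_frames c m1 m2 :
  flags_of [ffun j : 'I_(size (b1 ++ b2)).+1 => glue_frames b1 a1 w c m1 m2 j] =
  [ffun j : 'I_(size (b1 ++ b2)).+1 => fl (glue_frames b1 a1 w c m1 m2 j)].
Proof. by apply/ffunP => j; rewrite !ffunE. Qed.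

Lemma mxreg_glue_frames r (Z : flag_seq K n r -> Prop) M0 c (m1 m2 : nat -> frames K n r -> M) j :
  mxreg Z M0 c -> (forall j, mxreg Z M0 (m1 j)) -> (forall j, mxreg Z M0 (m2 j)) ->
  mxreg Z M0 (fun x => glue_frames b1 a1 w (c x) (m1^~ x) (m2^~ x) j).
Proof.
move=> hc h1 h2.
have hcp u : mxreg Z M0 (fun x => c x *m pm u) by apply: mxreg_mul hc (mxreg_cst _ _ _).
rewrite /glue_frames; case: (j <= _)%N; first exact: mxreg_mul (hcp _) (h1 _).
exact: mxreg_mul (hcp _) (h2 _).
Qed.

(** The two points vary together with a parameter y, which covers the case
    where one of them is fixed and the other one is y. *)
Lemma regular_splice r (Z : flag_seq K n r -> Prop) (p1 : flag_seq K n r -> P1)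
    (p2 : flag_seq K n r -> P2) (m1 m2 : nat -> frames K n r -> M) phi :
  (forall y, Z y -> X1 (p1 y) /\ X2 (p2 y)) ->
  (forall x j, good Z x -> m1 j x \in unitmx /\ m2 j x \in unitmx) ->
  (forall x j, (j <= size (a1 ++ b1))%N -> at_ (p1 (flags_of x)) j = fl (m1 j x)) ->
  (forall x j, (j <= size (b2 ++ a2))%N -> at_ (p2 (flags_of x)) j = fl (m2 j x)) ->
  (forall M0 j, mxreg Z M0 (m1 j) /\ mxreg Z M0 (m2 j)) ->
  regular_on X phi -> regular_on Z (fun y => phi (spliced (p1 y) (p2 y))).
Proof.
move=> hp um e1 e2 hm.
pose c x := glue_elt (p1 (flags_of x)) (p2 (flags_of x)).
pose N (x : frames K n r) : frames K n (size (b1 ++ b2)) :=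
  [ffun j : 'I_(size (b1 ++ b2)).+1 => glue_frames b1 a1 w (c x) (m1^~ x) (m2^~ x) j].
have key x : good Z x -> [/\ glued w (c x) (m1 (size a1) x) (m2 (size b2) x),
   invertible_frames (N x) & flags_of (N x) = spliced (p1 (flags_of x)) (p2 (flags_of x))].
  move=> gx; have [x1 x2] := hp _ gx.2.
  have [g u e] := spliced_frames x1 x2 (fun j => (um x j gx).1) (fun j => (um x j gx).2)
    (e1 x) (e2 x).
  by split=> //; [move=> j; rewrite ffunE; apply: u | rewrite /N flags_glue_frames].
apply: (regular_pullback (psi := fun y => spliced (p1 y) (p2 y)) (N := N)).
- by move=> x gx; have [] := key x gx.
- by move=> x [_ /hp [x1 x2]]; apply: spliced_bv.
- move=> M0 gM0 j.
  have hc : mxreg Z M0 c.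
    by apply: (glued_regular (w := w) gM0 (hm M0 (size a1)).1 (hm M0 (size b2)).2) => x /key [].
  apply: (@mxreg_ext _ _ _ _ _ _ _ _ (fun x => glue_frames b1 a1 w (c x) (m1^~ x) (m2^~ x) j)).
    by move=> x _; rewrite ffunE.
  by apply: mxreg_glue_frames => // k; have [] := hm M0 k.
Qed.

Lemma regular_left phi p2 : X2 p2 -> regular_on X phi ->
  regular_on X1 (fun p1 => phi (spliced p1 p2)).
Proof.
move=> x2; have [m2 [u2 e2]] := bv_frames x2.
apply: (regular_splice (p1 := id) (p2 := fun=> p2) (m1 := fun k x => x (inord k)) (m2 := fun k _ => m2 k)) => //.
- by move=> x j [ux _]; split.
- by move=> x j _; apply: flags_at.
- by move=> M0 j; split; [apply: mxreg_frame | apply: mxreg_cst].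
Qed.

Lemma regular_right phi p1 : X1 p1 -> regular_on X phi ->
  regular_on X2 (fun p2 => phi (spliced p1 p2)).
Proof.
move=> x1; have [m1 [u1 e1]] := bv_frames x1.
apply: (regular_splice (p1 := fun=> p1) (p2 := id) (m1 := fun k _ => m1 k) (m2 := fun k x => x (inord k))) => //.
- by move=> x j [ux _]; split.
- by move=> x j _; apply: flags_at.
- by move=> M0 j; split; [apply: mxreg_cst | apply: mxreg_frame].
Qed.

End RegularSplicing.

(** * The image of the splicing *)

Section CanonicalFrames.
Variables (K : fieldType) (n : nat).
Notation M := 'M[K]_n.+1.
Notation fl := (@flag_of_mx K n).
Implicit Types (B C U : M) (i : 'I_n) (b : seq 'I_n) (m : nat -> M).
Notation s i := (@simple_transp n i).

(** The coordinate t of the flag of B on the line of flags adjacent to the flag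
    of C. *)
Definition slope i C B : K := - (invmx B *m C) (hi i) (hi i) / (invmx B *m C) (hi i) (lo i).

Lemma mul_xmE i t (A : M) (a b : 'I_n.+1) :
  (A *m xm i t) a b = A a b + (if b == hi i then A a (lo i) * t else 0).
Proof.
rewrite /xm mulmxDr mulmx1 -scalemxAr !mxE; congr (_ + _).
rewrite (bigD1 (lo i)) //= !mxE eqxx /= big1 ?addr0.
  by case: eqP => _; rewrite ?mulr1 ?mulr0 // mulrC.
by move=> k /negbTE kh; rewrite !mxE kh mulr0.
Qed.

Lemma xm_unit i t : @xm K n i t \in unitmx.
Proof. by apply: unip_unit (xm_uptri i t) (xm_unip i t). Qed.

Lemma slopeE i t C B U : C \in unitmx -> borel U -> B = C *m xm i t *m pm (s i) *m U ->
  (invmx B *m C) (hi i) (lo i) != 0 /\ slope i C B = t.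
Proof.
move=> uC hU eB; have [hV uV] := borelV hU; have [_ uU] := hU.
have uB : B \in unitmx by rewrite eB !unitmx_mul uC xm_unit pm_unit.
have eY : invmx B *m C = invmx U *m pm (s i)^-1 *m xm i (- t).
  apply: (can_inj (mulKmx uB)); rewrite mulKVmx // eB.
  rewrite !mulmxA mulmxK // -(mulmxA (C *m _)) pmKV mulmx1 -mulmxA xmD addrN.
  by rewrite /xm scale0r addr0 mulmx1.
have lh : lo i == hi i = false by apply/negbTE/eqP => e; have := lohi i; rewrite e ltnn.
have sV : (s i)^-1%g = s i by apply: tpermV.
have e1 : (invmx B *m C) (hi i) (lo i) = invmx U (hi i) (hi i).
  by rewrite eY sV mul_xmE lh addr0 pm_mulr simple_loE.
have e2 : (invmx B *m C) (hi i) (hi i) = - (t * invmx U (hi i) (hi i)).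
  rewrite eY sV mul_xmE eqxx !pm_mulr simple_loE simple_hiE.
  by move/uptriP: hV => ->; rewrite ?lohi // add0r mulrN mulrC.
have d0 : invmx U (hi i) (hi i) != 0 by apply: (ptri_diag _ hV uV).
by rewrite /slope e1 e2 opprK mulfK.
Qed.

(** Frames normalised as products of x_i(t) and s_i. They depend on the flags
    alone, so that functions of these frames are functions on the braid
    variety. *)
Fixpoint cframe b m j : M := if j is j'.+1 then
    if onth b j' is Some i then cframe b m j' *m xm i (slope i (cframe b m j') (m j)) *m pm (s i)
    else 1%:M
  else 1%:M.

Lemma cframe_unit b m j : cframe b m j \in unitmx.
Proof.
elim: j => [|j IH] /=; first exact: unitmx1.
by case: (onth _ _) => [i|]; rewrite ?unitmx1 // !unitmx_mul IH xm_unit pm_unit.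
Qed.

Lemma step_slope i C U B : C \in unitmx -> borel U -> step i (C *m U) B ->
  exists t U', borel U' /\ B = C *m xm i t *m pm (s i) *m U'.
Proof.
move=> uC hU [U1 [U2 [h1 h2 ->]]].
have [t [U' [hU' e]]] := borel_simple i (borelM hU h1).
exists t, (U' *m U2); split; first exact: borelM.
by rewrite -(mulmxA C) -(mulmxA C) e !mulmxA.
Qed.

Lemma cframe_step b m j i U : borel U -> m j = cframe b m j *m U -> step i (m j) (m j.+1) ->
  onth b j = Some i ->
  (invmx (m j.+1) *m cframe b m j) (hi i) (lo i) != 0 /\
  exists2 U', borel U' & m j.+1 = cframe b m j.+1 *m U'.
Proof.
move=> hU e; rewrite e => /(step_slope (cframe_unit b m j) hU) [t [U' [hU' e']]] ei.
have [d0 es] := slopeE (cframe_unit b m j) hU' e'.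
by split=> //=; rewrite ei es; exists U'.
Qed.

Lemma cframe_spec b m j : framed b m -> (j <= size b)%N ->
  exists2 U, borel U & m j = cframe b m j *m U.
Proof.
move=> [um m0 _ hm]; elim: j => [|j IH] jb; first by exists (m 0%N); rewrite ?mul1mx.
have [U hU e] := IH (ltnW jb).
case ei : (onth b j) => [i|]; last by move: jb; rewrite -onthTE ei.
by have [_] := cframe_step hU e (hm _ _ ei) ei.
Qed.

Lemma cframe_flag b m j : framed b m -> (j <= size b)%N -> fl (cframe b m j) = fl (m j).
Proof.
move=> fm jb; have [U [hU uU] ->] := cframe_spec fm jb.
by rewrite fl_mulU // cframe_unit.
Qed.

Lemma cframe_ext b m m' j : framed b m -> framed b m' ->
  (forall k, (k <= size b)%N -> fl (m k) = fl (m' k)) -> (j <= size b)%N -> cframe b m j = cframe b m' j.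
Proof.
move=> fm fm' e; elim: j => [//|j IH] jb; have {}IH := IH (ltnW jb).
have [um _ _ hm] := fm; have [um' _ _ _] := fm'.
case ei : (onth b j) => [i|]; last by move: jb; rewrite -onthTE ei.
have [U hU eU] := cframe_spec fm (ltnW jb).
have [t [U1 [hU1 e1]]] : exists t U', borel U' /\ m j.+1 = cframe b m j *m xm i t *m pm (s i) *m U'.
  by apply: (step_slope (cframe_unit _ _ _) hU); rewrite -eU; apply: hm.
have e2 : m' j.+1 = cframe b m' j *m xm i t *m pm (s i) *m (U1 *m (invmx (m j.+1) *m m' j.+1)).
  by rewrite -IH mulmxA -e1 mulKVmx.
have hU2 : borel (U1 *m (invmx (m j.+1) *m m' j.+1)).
  apply: borelM => //; split; last by rewrite unitmx_mul unitmx_inv um um'.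
  by apply/fl_eq => //; apply: e.
have [_ s1] := slopeE (cframe_unit _ _ _) hU1 e1; have [_ s2] := slopeE (cframe_unit _ _ _) hU2 e2.
by rewrite /= ei s1 s2 IH.
Qed.

Lemma good_framed b (A : frames K n (size b)) : good (@braid_variety K n b) A ->
  framed b (fun k => A (inord k)).
Proof.
move=> [uA xA]; apply: (frames_chain xA) => [j|j _]; first exact: uA.
exact: flags_at.
Qed.

Lemma cframe_regular b (M0 : frames K n (size b)) j : good (@braid_variety K n b) M0 ->
  (j <= size b)%N -> mxreg (@braid_variety K n b) M0 (fun A => cframe b (fun k => A (inord k)) j).
Proof.
move=> gM0; have fM0 := good_framed gM0; have [u0 _ _ h0] := fM0.
elim: j => [_|j IH jb] /=; first exact: mxreg_cst.
have {}IH := IH (ltnW jb).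
case ei : (onth b j) => [i|]; last exact: mxreg_cst.
have [U hU e] := cframe_spec fM0 (ltnW jb).
have [d0 _] := cframe_step hU e (h0 _ _ ei) ei.
have hY : mxreg (@braid_variety K n b) M0
    (fun A => invmx (A (inord j.+1)) *m cframe b (fun k => A (inord k)) j).
  by apply: mxreg_mul IH; apply: mxreg_inv => //; apply: mxreg_frame.
have hs : regat (@braid_variety K n b) M0
    (fun A => slope i (cframe b (fun k => A (inord k)) j) (A (inord j.+1))).
  apply: regat_mul; first exact/regat_opp/hY.
  by apply: regat_inv => //; apply: hY.
apply: mxreg_mul; last exact: mxreg_cst.
apply: mxreg_mul => // a c.
apply: (regat_ext (h := fun A => (1%:M : M) a c +
   slope i (cframe b (fun k => A (inord k)) j) (A (inord j.+1)) * (delta_mx (lo i) (hi i) : M) a c)).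
  by move=> A _; rewrite /xm mxE [X in _ + X]mxE.
by apply: regat_add; [apply: regat_cst | apply: regat_mul => //; apply: regat_cst].
Qed.

End CanonicalFrames.

Section Discriminant.
Variables (K : fieldType) (n : nat).
Notation M := 'M[K]_n.+1.
Notation w0 := (longest n).
Notation fl := (@flag_of_mx K n).
Variables (b1 b2 a1 a2 : seq 'I_n) (w : 'S_n.+1).
Hypotheses (ra1 : reduced_word a1 (comp_perm w^-1 w0)) (ra2 : reduced_word a2 w).
Let v := comp_perm w^-1 w0.
Local Notation b := (b1 ++ b2).
Local Notation X1 := (@braid_variety K n (a1 ++ b1)).
Local Notation X2 := (@braid_variety K n (b2 ++ a2)).
Local Notation X := (@braid_variety K n (b1 ++ b2)).

Definition frames_of r (x : flag_seq K n r) : frames K n r :=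
  epsilon (inhabits ([ffun=> 0] : frames K n r)) (fun A => invertible_frames A /\ flags_of A = x).

Lemma frames_ofP (x : flag_seq K n (size b)) : X x -> good X (frames_of x) /\ flags_of (frames_of x) = x.
Proof.
move=> hx.
suff [h1 h2] : invertible_frames (frames_of x) /\ flags_of (frames_of x) = x.
  by split=> //; split; rewrite ?h2.
apply: (@epsilon_spec _ _ (fun A => invertible_frames A /\ flags_of A = x)).
have [m [um em]] := bv_frames hx.
exists [ffun j : 'I_(size b).+1 => m j]; split; first by move=> j; rewrite ffunE.
apply: at_eq => j hj; rewrite em // flags_at ffunE inordK //.
Qed.

Definition corners (A : M) := \prod_(k < n.+1) \det (corner k (pm w0^-1 *m pm v *m A)).

(** Vanishes where the middle flag is not in general position. *)
Definition discr (x : flag_seq K n (size b)) : K :=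
  corners (cframe b (fun k => frames_of x (inord k)) (size b1)).

Lemma b1_le : (size b1 <= size b)%N. Proof. by rewrite size_cat leq_addr. Qed.

Lemma discrE x m : X x -> (forall j, m j \in unitmx) ->
  (forall j, (j <= size b)%N -> at_ x j = fl (m j)) -> discr x = corners (cframe b m (size b1)).
Proof.
move=> hx um em; have [gx ex] := frames_ofP hx; congr corners.
apply: cframe_ext b1_le; [exact: good_framed | exact: frames_chain hx um em |].
by move=> k kb; rewrite -em // -[in RHS]ex flags_at.
Qed.

Lemma discr_regular : regular_on X discr.
Proof.
apply/regularP => M0 gM0.
apply: (regat_ext (h := fun A => corners (cframe b (fun k => A (inord k)) (size b1)))).
  move=> A [uA xA]; apply: discrE => // j jb; exact: flags_at.
apply: regat_prod => k _; apply: regat_det => i j.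
have hc : mxreg X M0 (fun A => pm w0^-1 *m pm v *m cframe b (fun k => A (inord k)) (size b1)).
  by apply: mxreg_mul (mxreg_cst _ _ _) _; apply: cframe_regular b1_le.
apply: (regat_ext (h := fun A => if ((i < k) && (j < k))%N then
   (pm w0^-1 *m pm v *m cframe b (fun k => A (inord k)) (size b1)) i j else (i == j)%:R)).
  by move=> A _; rewrite mxE.
case: (_ && _); [exact: hc | exact: regat_cst].
Qed.

Lemma corners_neq0 A : corners A != 0 ->
  forall k : 'I_n.+1, corner k (pm w0^-1 *m pm v *m A) \in unitmx.
Proof. by move=> /prodf_neq0 h k; rewrite unitmxE unitfE; apply: h. Qed.

Lemma discr_onto x : X x -> discr x != 0 ->
  exists p1 p2, [/\ X1 p1, X2 p2 & spliced w p1 p2 = x].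
Proof.
move=> hx; have [m [um em]] := bv_frames hx; rewrite (discrE hx um em) => d0.
apply: (spliced_onto ra1 ra2 (m := cframe b m) hx).
- by move=> j; apply: cframe_unit.
- by move=> j jb; rewrite em // (cframe_flag (frames_chain hx um em)).
- exact: corners_neq0.
Qed.

(** The middle frame of a spliced point is, after translation, a lower times an
    upper triangular matrix. *)
Lemma discr_spliced p1 p2 : X1 p1 -> X2 p2 -> discr (spliced w p1 p2) != 0.
Proof.
move=> x1 x2; have [m1 [u1 e1]] := bv_frames x1; have [m2 [u2 e2]] := bv_frames x2.
have [[gc _ _] um em] := spliced_frames ra1 ra2 x1 x2 u1 u2 e1 e2.
set c := glue_elt w p1 p2 in gc um em; set m := glue_frames b1 a1 w c m1 m2 in um em.
have hx := spliced_bv ra1 ra2 x1 x2.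
have em' j : (j <= size b)%N -> at_ (spliced w p1 p2) j = fl (m j).
  by move=> jb; rewrite -em (at_ffun (fun j => fl (m j))).
rewrite (discrE hx um em'); have fm := frames_chain hx um em'.
have [U hU eU] := cframe_spec fm b1_le; have [_ uU] := hU.
have -> : cframe b m (size b1) = m (size b1) *m invmx U by rewrite eU mulmxK.
have [_ _ hB _] := frames_chain x1 u1 e1; rewrite size_cat in hB.
have [hN hN1] := cell_group_conjV gc.
have [B eB] : exists B, B = pm w0^-1 *m m1 (size a1 + size b1)%N by eexists.
have eA : m1 (size a1 + size b1)%N = pm w0 *m B by rewrite eB mulmxA pmKV mul1mx.
apply/prodf_neq0 => k _; rewrite -unitfE -unitmxE /m /glue_frames leqnn eA.
have [N eN] : exists N : M, N = pm v *m c *m pm v^-1 by eexists.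
have -> : pm w0^-1 *m pm v *m (c *m pm v^-1 *m (pm w0 *m B) *m invmx U) =
          (pm w0^-1 *m N *m pm w0) *m (B *m invmx U) by rewrite eN !mulmxA.
apply: corner_LU.
- by have := ptri_conjV (w := w0) hN; rewrite mulg1 eN.
- by apply: unip_conjV; rewrite eN.
- by apply: borelM; [rewrite eB | apply: borelV].
Qed.

End Discriminant.

(** * Units on a braid variety *)

Section Regular.
Variables (K : fieldType) (n r : nat) (Z : flag_seq K n r -> Prop).
Implicit Types phi psi : flag_seq K n r -> K.

Lemma regular_cst c : regular_on Z (fun=> c).
Proof. by apply/regularP => A _; apply: regat_cst. Qed.

Lemma regular_sub phi psi : regular_on Z phi -> regular_on Z psi -> regular_on Z (fun x => phi x - psi x).
Proof.
move=> /regularP h1 /regularP h2; apply/regularP => A gA.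
by apply: regat_add (h1 A gA) (regat_opp (h2 A gA)).
Qed.

Lemma regular_mul phi psi : regular_on Z phi -> regular_on Z psi -> regular_on Z (fun x => phi x * psi x).
Proof.
move=> /regularP h1 /regularP h2; apply/regularP => A gA.
by apply: regat_mul (h1 A gA) (h2 A gA).
Qed.

Lemma regular_inv phi : regular_on Z phi -> (forall x, Z x -> phi x != 0) -> regular_on Z (fun x => (phi x)^-1).
Proof.
move=> /regularP h1 h; apply/regularP => A gA; apply: (regat_inv gA (h1 A gA)).
by apply: h; case: gA.
Qed.

Definition monomial f (z : 'I_f -> flag_seq K n r -> K) (e : 'I_f -> int) x := \prod_j z j x ^ e j.

(** What a cluster structure says about the units of the coordinate ring. *)
Record frozen_units f (z : 'I_f -> flag_seq K n r -> K) : Prop := FrozenUnits {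
  fu_regular : forall j, regular_on Z (z j);
  fu_neq0 : forall j x, Z x -> z j x != 0;
  fu_unit : forall phi, regular_on Z phi -> (forall x, Z x -> phi x != 0) ->
    exists c e, forall x, Z x -> phi x = c * monomial z e x;
  fu_onto : forall phi, regular_on Z phi -> (forall x, Z x -> phi x != 0) ->
    (forall x y, Z x -> Z y -> phi x = phi y) \/
    (forall l, l != 0 -> exists2 x, Z x & phi x = l);
  fu_indep : forall d o c e, regular_on Z d -> Z o -> d o != 0 ->
    (forall x, Z x -> d x != 0 -> monomial z e x = c) -> forall j, e j = 0 }.

End Regular.

Section ClusterUnits.
Variables (K : fieldType) (n : nat) (b : seq 'I_n) (m f : nat) (B : exchange_mx m f).
Variable Psi : ambient K m f -> flag_seq K n (size b) -> K.
Hypothesis char2 : (2%:R : K) != 0.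
Hypothesis validB : valid_exchange_mx B.
Hypothesis iso : cluster_iso B Psi.
Notation X := (@braid_variety K n b).
Notation A := (cluster_algebra B).
Notation cst := (@cst K (m + f)).
Notation var := (@var K (m + f)).

Let isoR y : A y -> regular_on X (Psi y). Proof. by have [h _] := iso; apply: h. Qed.
Let isoC c x : X x -> Psi (cst c) x = c. Proof. by have [_ [h _]] := iso; apply: h. Qed.
Let isoD y z x : A y -> A z -> X x -> Psi (y + z) x = Psi y x + Psi z x.
Proof. by have [_ [_ [h _]]] := iso; apply: h. Qed.
Let isoM y z x : A y -> A z -> X x -> Psi (y * z) x = Psi y x * Psi z x.
Proof. by have [_ [_ [_ [h _]]]] := iso; apply: h. Qed.
Let isoI y z : A y -> A z -> (forall x, X x -> Psi y x = Psi z x) -> y = z.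
Proof. by have [_ [_ [_ [_ [h _]]]]] := iso; apply: h. Qed.
Let isoS phi : regular_on X phi -> exists2 y, A y & forall x, X x -> Psi y x = phi x.
Proof. by have [_ [_ [_ [_ [_ h]]]]] := iso; apply: h. Qed.

Let A_cst c : A (cst c). Proof. exact: CA_cst. Qed.
Let A_frozen j : A (var (rshift m j)).
Proof. by have := CA_var K B [::] (rshift m j); rewrite /= initial_var. Qed.
Let A_frozenV j : A (var (rshift m j))^-1.
Proof. by have := CA_frozen_inv K B j; rewrite initial_var. Qed.

Definition frozen_fun j := Psi (var (rshift m j)).

Let frozen_funV j x : X x -> frozen_fun j x * Psi (var (rshift m j))^-1 x = 1.
Proof.
move=> hx; rewrite /frozen_fun -isoM //.
by rewrite (divff (var_neq0 K _)) -[1](rmorph1 cst) isoC.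
Qed.

Lemma frozen_fun_neq0 j x : X x -> frozen_fun j x != 0.
Proof.
move=> hx; apply: contraTneq (oner_neq0 K) => h.
by rewrite -(frozen_funV j hx) h mul0r eqxx.
Qed.

Let A_expn y k : A y -> A (y ^+ k) /\ forall x, X x -> Psi (y ^+ k) x = Psi y x ^+ k.
Proof.
move=> hy; elim: k => [|k [IH IHx]].
  rewrite expr0 -[1](rmorph1 cst); split=> [|x hx]; first exact: A_cst.
  by rewrite isoC // expr0.
by rewrite exprS; split=> [|x hx]; [apply: CA_mul | rewrite isoM // IHx // -exprS].
Qed.

Let A_expz j (a : int) : A (var (rshift m j) ^ a) /\
  forall x, X x -> Psi (var (rshift m j) ^ a) x = frozen_fun j x ^ a.
Proof.
case: a => k; first exact: A_expn.
have [h hx] := A_expn k.+1 (A_frozenV j); rewrite NegzE -exprz_inv -exprnP; split=> // x xx.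
rewrite hx // -exprz_inv -exprnP; congr (_ ^+ _).
by apply: (mulfI (frozen_fun_neq0 j xx)); rewrite frozen_funV // mulfV // frozen_fun_neq0.
Qed.

Let A_mono (e : 'I_f -> int) : A (frozen_mono K m e) /\
  forall x, X x -> Psi (frozen_mono K m e) x = monomial frozen_fun e x.
Proof.
suff [h hx] : A (frozen_mono K m e) /\ forall x, X x ->
    \prod_j frozen_fun j x ^ e j = Psi (frozen_mono K m e) x.
  by split=> // x xx; rewrite -hx.
rewrite /frozen_mono; elim: (index_enum _) => [|j s [h hx]].
  rewrite big_nil -[1](rmorph1 cst); split=> [|x xx]; first exact: A_cst.
  by rewrite big_nil isoC.
have [hj hjx] := A_expz j (e j).
rewrite big_cons; split=> [|x xx]; first exact: CA_mul.
by rewrite big_cons hx // isoM // hjx.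
Qed.

Hypothesis nonempty : exists x, X x.

Let skewB : skew_principal B.
Proof.
move=> i j; have [/matrixP/(_ j i) + _] := validB; rewrite !mxE => ->.
by [].
Qed.

(** The unit and its inverse both come from elements of the cluster algebra,
    where their product is 1. *)
Lemma unit_monomial phi : regular_on X phi -> (forall x, X x -> phi x != 0) ->
  exists c e, c != 0 /\ forall y, A y -> (forall x, X x -> Psi y x = phi x) ->
    y = cst c * frozen_mono K m e.
Proof.
move=> hphi phi0; have [y Ay ey] := isoS hphi.
have [y' Ay' ey'] := isoS (regular_inv hphi phi0).
have yy : y * y' = 1.
  rewrite -[1](rmorph1 cst); apply: isoI; [exact: CA_mul | exact: A_cst |] => x xx.
  by rewrite isoM // isoC // ey // ey' // mulfV // phi0.
have [_ nzB] := validB.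
have [c [e ec]] := upper_unit char2 skewB nzB (cluster_algebra_upper char2 skewB Ay)
  (cluster_algebra_upper char2 skewB Ay') yy.
exists c, e; split.
  have [x xx] := nonempty; have [Ae _] := A_mono e.
  apply: contraNneq (phi0 x xx) => c0; rewrite -ey // ec isoM // isoC // c0 mul0r //.
move=> y1 Ay1 ey1; rewrite -ec; apply: isoI => // x xx; rewrite ey1 // ey //.
Qed.

(** If phi omitted the value l, then phi - l would be a unit as well, contrary
    to frozen_three. A relation between the frozen variables on the set where d
    does not vanish holds after multiplication by d, hence everywhere, the
    cluster algebra being a domain. *)
Lemma cluster_frozen_units : frozen_units X frozen_fun.
Proof.
have monoE c e x : X x -> Psi (cst c * frozen_mono K m e) x = c * monomial frozen_fun e x.
  by move=> xx; have [Ae ee] := A_mono e; rewrite isoM // isoC // ee.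
split.
- by move=> j; apply: isoR.
- exact: frozen_fun_neq0.
- move=> phi hphi phi0; have [c [e [_ h]]] := unit_monomial hphi phi0.
  have [y Ay ey] := isoS hphi; exists c, e => x xx.
  by rewrite -ey // (h y Ay ey) monoE.
- move=> phi hphi phi0; have [c [e [c0 h]]] := unit_monomial hphi phi0.
  have [y Ay ey] := isoS hphi; have ec := h y Ay ey.
  case: (pickP (fun j => e j != 0)) => [j ej|e0].
    right=> l l0; apply: Classical_Prop.NNPP => hl.
    (* If l is omitted, phi - l has no zeros either. *)
    have psi0 x : X x -> phi x - l != 0.
      by move=> xx; rewrite subr_eq0; apply/eqP => el; apply: hl; exists x.
    have [d [e' [_ h']]] := unit_monomial (regular_sub hphi (regular_cst (Z := X) l)) psi0.
    have key : y + cst (- l) = cst d * frozen_mono K m e'.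
      by apply: h' => [|x xx]; [apply: CA_add | rewrite isoD // ey // isoC].
    by rewrite ec rmorphN in key; exact: (frozen_three c0 l0 ej key).
  left=> x x' xx xx'; rewrite -!ey // ec !monoE //; congr (_ * _).
  by apply: eq_bigr => j _; have /negbFE/eqP -> := e0 j; rewrite !expr0z.
- move=> d o c e hd xo d0 h j.
  have [D AD eD] := isoS hd; have [Ae ee] := A_mono e.
  have z : D * (frozen_mono K m e + cst (- c)) = cst 0.
    apply: isoI; [by apply: CA_mul => //; apply: CA_add | exact: A_cst |] => x xx.
    rewrite isoM ?isoD ?isoC ?eD ?ee //; last exact: CA_add.
    case: (eqVneq (d x) 0) => [->|dx]; first by rewrite mul0r.
    by rewrite h // subrr mulr0.
  have D0 : D != 0.
    apply: contraNneq d0 => D0; rewrite -eD // D0 -[0](rmorph0 cst) isoC //.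
  move/eqP: z; rewrite rmorph0 mulf_eq0 (negbTE D0) /= rmorphN subr_eq0 => /eqP.
  by move=> /frozen_mono_cst.
Qed.

End ClusterUnits.

Lemma num_frozen_units (K : fieldType) n (b : seq 'I_n) f : (2%:R : K) != 0 ->
  nonempty_braid_variety K b -> num_frozen K b f ->
  exists z : 'I_f -> flag_seq K n (size b) -> K, frozen_units (@braid_variety K n b) z.
Proof.
move=> c2 ne [m [B [vB [Psi iso]]]]; exists (frozen_fun Psi).
exact: cluster_frozen_units c2 vB iso ne.
Qed.

(** * Multiplicative relations *)

(** A rational kernel vector, cleared of denominators. *)
Lemma int_left_kernel s t (E : 'M[int]_(s, t)) : (t < s)%N ->
  exists a : 'rV[int]_s, a != 0 /\ a *m E = 0.
Proof.
move=> ts; pose E' : 'M[rat]_(s, t) := map_mx intr E.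
have : kermx E' != 0.
  rewrite kermx_eq0 /row_free neq_ltn; apply/orP; left.
  exact: leq_ltn_trans (rank_leq_col _) ts.
move=> /rowV0Pn [v /sub_kermxP vE v0].
pose d := \prod_i denq (v 0 i).
have d0 : d != 0 by apply/prodf_neq0 => i _; apply: denq_neq0.
pose a : 'rV[int]_s := \row_i (numq (v 0 i) * \prod_(j | j != i) denq (v 0 j)).
have ea : map_mx intr a = d%:~R *: v.
  apply/rowP => i; rewrite !mxE -[in RHS](divq_num_den (v 0 i)).
  have -> : d = denq (v 0 i) * \prod_(j | j != i) denq (v 0 j) by rewrite /d (bigD1 i).
  have di : (denq (v 0 i))%:~R != 0 :> rat by rewrite intr_eq0 denq_neq0.
  rewrite !rmorphM /=; move: (numq _)%:~R (denq _)%:~R (\prod_(_ | _) _)%:~R di => x y z y0.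
  by field.
exists a; split.
  apply: contraNneq v0 => a0; have : d%:~R *: v == 0 by rewrite -ea a0 map_mx0.
  by rewrite scaler_eq0 intr_eq0 (negbTE d0).
have h : map_mx (intr : int -> rat) (a *m E) = 0 by rewrite map_mxM ea -scalemxAl vE scaler0.
apply/matrixP => i j; apply: (intr_inj (R := rat)).
have := congr1 (fun u : 'M_(_, _) => u i j) h; rewrite !mxE => ->; by [].
Qed.

Lemma primes_injection : exists p : nat -> nat, injective p /\ forall k, prime (p k).
Proof.
pose next m := s2val (prime_above m).
have next_gt m : (m < next m)%N by rewrite /next; case: prime_above.
have next_prime m : prime (next m) by rewrite /next; case: prime_above.
pose p k := iter k.+1 next 0%N.
exists p; split=> [|k]; last exact: next_prime.
have lt k l : (p k < p (k + l.+1))%N.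
  elim: l => [|l IH]; first by rewrite addn1; apply: next_gt.
  by apply: ltn_trans IH _; rewrite [(k + l.+2)%N]addnS; apply: next_gt.
move=> k l e; case: (ltngtP k l) => // h.
  by have := lt k (l - k.+1)%N; rewrite addnS -addSn subnKC // e ltnn.
by have := lt l (k - l.+1)%N; rewrite addnS -addSn subnKC // e ltnn.
Qed.

Lemma prod_exprz (F : fieldType) (I : Type) (s : seq I) (P : pred I) (g : I -> F) (a : int) :
  (\prod_(i <- s | P i) g i) ^ a = \prod_(i <- s | P i) g i ^ a.
Proof. by apply: (big_morph (fun x => x ^ a)) => [x y|]; rewrite ?exp1rz ?expfzMl. Qed.

Lemma exprz_sum (F : fieldType) (I : Type) (s : seq I) (P : pred I) (x : F) (a : I -> int) :
  x != 0 -> x ^ (\sum_(i <- s | P i) a i) = \prod_(i <- s | P i) x ^ a i.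
Proof. by move=> x0; apply: (big_morph (fun k => x ^ k)) => [k l|]; rewrite ?expr0z ?expfzDr. Qed.

(** A left kernel vector of the exponent matrix is a multiplicative
    relation. *)
Lemma monomial_relation (F : fieldType) s t (E : 'M[int]_(s, t)) (a : 'rV[int]_s) (y : 'I_t -> F) :
  (forall i, y i != 0) -> a *m E = 0 -> \prod_k (\prod_i y i ^ E k i) ^ a 0 k = 1.
Proof.
move=> y0 aE.
have -> : \prod_k (\prod_i y i ^ E k i) ^ a 0 k = \prod_k \prod_i y i ^ (a 0 k * E k i).
  by apply: eq_bigr => k _; rewrite prod_exprz; apply: eq_bigr => i _; rewrite exprz_exp mulrC.
rewrite exchange_big big1 // => i _; rewrite -exprz_sum //.
by have := congr1 (fun u : 'rV_t => u 0 i) aE; rewrite !mxE => ->; rewrite expr0z.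
Qed.

Section Multiplicative.
Variable K : fieldType.
Hypothesis char0 : forall k, (k.+1%:R : K) != 0.

Lemma natr_inj0 : injective (fun k : nat => k%:R : K).
Proof.
have main k l : (k <= l)%N -> k%:R = l%:R :> K -> k = l.
  move=> kl /eqP; rewrite eq_sym -subr_eq0 -natrB //; case e : (l - k)%N => [|d].
    by move=> _; apply/eqP; rewrite eqn_leq kl -subn_eq0 e.
  by rewrite (negbTE (char0 d)).
by move=> k l e; case/orP: (leq_total k l) => h; [| apply/esym]; apply: main.
Qed.

Lemma expz_absz (x : K) (a : int) : x != 0 ->
  x ^ a * x ^+ (if a < 0 then absz a else 0%N) = x ^+ (if a < 0 then 0%N else absz a).
Proof.
move=> x0; case: a => k /=; first by rewrite mulr1.
by rewrite NegzE -exprnN mulVf // expf_neq0.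
Qed.

(** Unique factorisation, after the negative exponents have been moved to the
    other side. *)
Lemma primes_independent N (p : 'I_N -> nat) (a : 'I_N -> int) :
  injective p -> (forall i, prime (p i)) -> \prod_i ((p i)%:R : K) ^ a i = 1 ->
  forall i, a i = 0.
Proof.
move=> injp pp e i.
pose un j := if a j < 0 then absz (a j) else 0%N.
pose up j := if a j < 0 then 0%N else absz (a j).
have p0 j : ((p j)%:R : K) != 0 by have := prime_gt0 (pp j); case: (p j).
have eK : \prod_j ((p j) ^ un j)%N%:R = \prod_j ((p j) ^ up j)%N%:R :> K.
  rewrite -[LHS]mul1r -[X in X * _]e -big_split /=; apply: eq_bigr => j _.
  by rewrite !natrX expz_absz.
have eN : (\prod_j (p j) ^ un j = \prod_j (p j) ^ up j)%N.
  by apply: natr_inj0; rewrite !natr_prod.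
have dv g : (p i %| \prod_j (p j) ^ g j)%N = (0 < g i)%N.
  rewrite Euclid_dvd_prod // big_orE; apply/existsP/idP => [[j]|gi].
    rewrite Euclid_dvdX // dvdn_prime2 // => /and3P [_ /eqP pij gj]; by rewrite (injp _ _ pij).
  by exists i; rewrite Euclid_dvdX // dvdnn.
have := dv un; rewrite eN dv /un /up; case: (a i) => [[|k]|k] //=.
Qed.

(** The exponents of t + 1 primes with respect to t generators are linearly
    dependent, whereas primes are multiplicatively independent. *)
Lemma fin_gen_proper t (y : 'I_t -> K) : (forall i, y i != 0) ->
  ~ (forall l, l != 0 -> exists e : 'I_t -> int, l = \prod_i y i ^ e i).
Proof.
move=> y0 h; have [p [injp pp]] := primes_injection.
have p0 j : ((p j)%:R : K) != 0 by have := prime_gt0 (pp j); case: (p j).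
have /fin_all_exists [E hE] : forall k : 'I_t.+1, exists e : 'I_t -> int,
    (p k)%:R = \prod_i y i ^ e i by move=> k; apply: h.
have [a [a0 aE]] := int_left_kernel (\matrix_(k, i) E k i) (ltnSn t).
case/negP: a0; apply/eqP/rowP => k; rewrite mxE.
apply: (@primes_independent _ (fun k : 'I_t.+1 => p k) (fun k => a 0 k)) => //.
  by move=> i j /injp /val_inj.
apply: etrans (monomial_relation y0 aE); apply: eq_bigr => j _; rewrite hE.
by congr (_ ^ _); apply: eq_bigr => i _; rewrite mxE.
Qed.

End Multiplicative.

(** * Counting frozen variables *)

Section Frozen.
Variables (K : fieldType) (n : nat).
Hypothesis char0 : forall k, (k.+1%:R : K) != 0.

Section Product.
Variables (r1 r2 : nat) (Z1 : flag_seq K n r1 -> Prop) (Z2 : flag_seq K n r2 -> Prop).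
Variables (f1 f2 : nat) (x : 'I_f1 -> flag_seq K n r1 -> K) (y : 'I_f2 -> flag_seq K n r2 -> K).
Hypotheses (ux : frozen_units Z1 x) (uy : frozen_units Z2 y).
Variable F : flag_seq K n r1 -> flag_seq K n r2 -> K.
Hypothesis F0 : forall p1 p2, Z1 p1 -> Z2 p2 -> F p1 p2 != 0.
Hypothesis Fleft : forall p2, Z2 p2 -> regular_on Z1 (F^~ p2).
Hypothesis Fright : forall p1, Z1 p1 -> regular_on Z2 (F p1).

(** As a function of p2 the ratio is a unit on Z2. If it took all nonzero
    values, these would all be products of powers of the x_i(p1) / x_i(o1), by
    the description of units on Z1. *)
Lemma unit_ratio_cst p1 o1 p2 o2 : Z1 p1 -> Z1 o1 -> Z2 p2 -> Z2 o2 ->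
  F p1 p2 / F o1 p2 = F p1 o2 / F o1 o2.
Proof.
move=> hp1 ho1 hp2 ho2.
have hreg : regular_on Z2 (fun p => F p1 p / F o1 p).
  apply: regular_mul (Fright hp1) (regular_inv (Fright ho1) _) => p hp; exact: F0.
have h0 p : Z2 p -> F p1 p / F o1 p != 0 by move=> hp; rewrite mulf_neq0 ?invr_eq0 // F0.
case: (fu_onto uy hreg h0) => [h|h]; first exact: h.
exfalso; apply: (@fin_gen_proper K char0 f1 (fun i => x i p1 / x i o1)).
  by move=> i; rewrite mulf_neq0 ?invr_eq0 // (fu_neq0 ux).
move=> l l0; have [p hp <-] := h l l0.
have [c [e ec]] := fu_unit ux (Fleft hp) (fun q hq => F0 hq hp).
exists e; rewrite !ec //.
have c0 : c != 0 by apply: contraNneq (F0 hp1 hp) => c0; rewrite ec // c0 mul0r.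
have m0 : monomial x e o1 != 0 by apply: contraNneq (F0 ho1 hp) => m0; rewrite ec // m0 mulr0.
rewrite -mulf_div divff // mul1r; apply: (mulIf m0); rewrite divfK // /monomial -big_split.
apply: eq_bigr => i _; rewrite /= -expfzMl divfK //; exact: (fu_neq0 ux).
Qed.

Lemma unit_split o1 o2 : Z1 o1 -> Z2 o2 -> exists c (E : 'I_f1 -> int) (E' : 'I_f2 -> int),
  forall p1 p2, Z1 p1 -> Z2 p2 -> F p1 p2 = c * (monomial x E p1 * monomial y E' p2).
Proof.
move=> h1 h2.
have [c [E eE]] := fu_unit ux (Fleft h2) (fun q hq => F0 hq h2).
have [c' [E' eE']] := fu_unit uy (Fright h1) (fun q hq => F0 h1 hq).
exists (c * c' / F o1 o2), E, E' => p1 p2 hp1 hp2.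
have := unit_ratio_cst hp1 h1 hp2 h2; rewrite (eE p1) // (eE' p2) //.
have : F o1 p2 != 0 by apply: F0.
rewrite eE' // => d0 /(congr1 (fun t => t * (c' * monomial y E' p2))); rewrite divfK // => ->.
have := F0 h1 h2; move: (F o1 o2) (monomial x E p1) (monomial y E' p2) => t u v t0.
by field.
Qed.

End Product.

(** A vector orthogonal to all exponents would give a monomial in the frozen
    variables of the spliced variety that is constant where discr does not
    vanish. *)
Theorem frozen_count (b1 b2 a1 a2 : seq 'I_n) (w : 'S_n.+1) (f f1 f2 : nat) :
  reduced_word a1 (comp_perm (w^-1)%g (longest n)) -> reduced_word a2 w ->
  nonempty_braid_variety K (a1 ++ b1) -> nonempty_braid_variety K (b2 ++ a2) ->
  num_frozen K (b1 ++ b2) f -> num_frozen K (a1 ++ b1) f1 -> num_frozen K (b2 ++ a2) f2 ->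
  (f <= f1 + f2)%N.
Proof.
move=> ra1 ra2 ne1 ne2 nf nf1 nf2; have [o1 ho1] := ne1; have [o2 ho2] := ne2.
have ho := spliced_bv ra1 ra2 ho1 ho2.
have [x ux] := num_frozen_units (char0 1) ne1 nf1.
have [y uy] := num_frozen_units (char0 1) ne2 nf2.
have [z uz] := num_frozen_units (char0 1) (ex_intro _ _ ho) nf.
rewrite leqNgt; apply/negP => ff.
have /fin_all_exists [c /fin_all_exists [E /fin_all_exists [E' hE]]] : forall j, exists c (E : 'I_f1 -> int) (E' : 'I_f2 -> int),
    forall p1 p2, braid_variety p1 -> braid_variety p2 ->
      z j (spliced w p1 p2) = c * (monomial x E p1 * monomial y E' p2).
  move=> j; apply: (unit_split ux uy (F := fun p1 p2 => z j (spliced w p1 p2))) ho1 ho2.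
  - by move=> p1 p2 hp1 hp2; apply: (fu_neq0 uz); apply: spliced_bv.
  - by move=> p2 hp2; apply: (regular_left ra1 ra2 hp2 (fu_regular uz j)).
  - by move=> p1 hp1; apply: (regular_right ra1 ra2 hp1 (fu_regular uz j)).
have [a [a0 aE]] := int_left_kernel (row_mx (\matrix_(j, i) E j i) (\matrix_(j, i) E' j i)) ff.
move: aE; rewrite mul_mx_row => /eqP; rewrite row_mx_eq0 => /andP [/eqP aE /eqP aE'].
case/negP: a0; apply/eqP/rowP => j; rewrite mxE.
suff hF p : braid_variety p -> discr w p != 0 -> monomial z (fun j => a 0 j) p = \prod_j c j ^ a 0 j.
  exact: (fu_indep uz (@discr_regular K n b1 b2 w) ho (discr_spliced ra1 ra2 ho1 ho2) hF).
move=> hp dp.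
have [p1 [p2 [hp1 hp2 <-]]] := discr_onto ra1 ra2 hp dp.
have e1 := monomial_relation (fun i => fu_neq0 ux i hp1) aE.
have e2 := monomial_relation (fun i => fu_neq0 uy i hp2) aE'.
rewrite /monomial; under eq_bigr => k _ do rewrite hE // !expfzMl.
rewrite !big_split /= -[RHS]mulr1 -[X in _ = _ * X]mulr1; congr (_ * (_ * _)).
  apply: etrans e1; apply: eq_bigr => k _; congr (_ ^ _); apply: eq_bigr => i _; by rewrite mxE.
apply: etrans e2; apply: eq_bigr => k _; congr (_ ^ _); apply: eq_bigr => i _; by rewrite mxE.
Qed.

End Frozen.

Theorem corollary1p3 (R : realType) (n : nat) (b : seq 'I_n) (r1 : nat)
    (w : 'S_n.+1) (a1 a2 : seq 'I_n) (f f1 f2 : nat) :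
  contains_longest b ->
  (1 <= r1 <= size b)%N ->
  reduced_word a1 (comp_perm (w^-1)%g (longest n)) ->
  reduced_word a2 w ->
  nonempty_braid_variety (complex R) (a1 ++ take r1 b) ->
  nonempty_braid_variety (complex R) (drop r1 b ++ a2) ->
  num_frozen (complex R) b f ->
  num_frozen (complex R) (a1 ++ take r1 b) f1 ->
  num_frozen (complex R) (drop r1 b ++ a2) f2 ->
  (f1 + f2 >= f)%N.
Proof.
move=> _ _ ra1 ra2 ne1 ne2; rewrite -{1}(cat_take_drop r1 b) => nf nf1 nf2.
by apply: (frozen_count _ ra1 ra2 ne1 ne2 nf nf1 nf2) => k; rewrite pnatr_eq0.
Qed.
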